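(* For $\lambda\in S^{k,r}_{\mathbf c}$ and $x=e,f,\psi^+,\psi^-$ set $$x(z)|\lambda\rangle=\lim_{N\to\infty}x^{[k,N]}(z)|\lambda_1,\dots,\lambda_N\rangle,$$ where the right hand side is considered as an element of $W^{k,r}_{\mathbf c}(u)$ via $W^{k,r}_{\mathbf c}(u)\simeq\lim_{N\to\infty}W^{k,r,N,+}_{\mathbf c}(u)$. This formula endows $W^{k,r}_{\mathbf c}(u)$ with the structure of an $\mathcal E$-module of level $(1,q_3^k)$.
   Context: Let $k\ge1$, $r\ge2$ be integers, $u\in\mathbb C^\times$, and $q_1,q_2,q_3\in\mathbb C^\times$ with $q_1q_2q_3=1$ satisfying the resonance condition $q_1^{1-r}q_3^{k+1}=1$, and such that $q_1^nq_3^m=1$ ($n,m\in\mathbb Z$) if and only if there is an integer $\alpha$ with $n=(1-r)\alpha$, $m=(k+1)\alpha$. Put $g(z,w)=(z-q_1w)(z-q_2w)(z-q_3w)$. $\mathcal E$ is the unital associative $\mathbb C$-algebra generated by $e_i,f_i$ ($i\in\mathbb Z$), $\psi^+_j,\psi^-_{-j}$ ($j>0$) and $(\psi_0^{\pm})^{\pm1}$. With $e(z)=\sum_{i\in\mathbb Z}e_iz^{-i}$, $f(z)=\sum_{i\in\mathbb Z}f_iz^{-i}$, $\psi^\pm(z)=\sum_{\pm i\ge0}\psi^\pm_iz^{-i}$, $\delta(z)=\sum_{n\in\mathbb Z}z^n$, the defining relations (coefficientwise) are $$g(z,w)e(z)e(w)=-g(w,z)e(w)e(z),\quad g(w,z)f(z)f(w)=-g(z,w)f(w)f(z),$$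 $$g(z,w)\psi^\pm(z)e(w)=-g(w,z)e(w)\psi^\pm(z),\quad g(w,z)\psi^\pm(z)f(w)=-g(z,w)f(w)\psi^\pm(z),$$ $$[e(z),f(w)]=\frac{\delta(z/w)}{g(1,1)}(\psi^+(z)-\psi^-(z)),\quad [\psi^\pm_i,\psi^\pm_j]=0,\ [\psi^\pm_i,\psi^\mp_j]=0,$$ $$\psi^\pm_0(\psi^\pm_0)^{-1}=(\psi^\pm_0)^{-1}\psi^\pm_0=1,\quad [e_0,[e_1,e_{-1}]]=0,\quad [f_0,[f_1,f_{-1}]]=0.$$ A module has level $(l_+,l_-)$ if $\psi_0^\pm$ act by the scalars $l_\pm$. Finite modules. Let $\mathcal P^N=\{\lambda\in\mathbb Z^N\mid\lambda_1\ge\dots\ge\lambda_N\}$, $S^{k,r,N}=\{\lambda\in\mathcal P^N\mid\lambda_i-\lambda_{i+k}\ge r\ (1\le i\le N-k)\}$, and let $W^{k,r,N}(u)$ be the space with basis $|\lambda\rangle$, $\lambda\in S^{k,r,N}$. It is an $\mathcal E$-module with action, where $\lambda\pm\mathbf 1_i=(\lambda_1,\dots,\lambda_i\pm1,\dots,\lambda_N)$ and only terms with $\lambda\pm\mathbf 1_i\in S^{k,r,N}$ occur, $$(1-q_1)e(z)|\lambda\rangle=\sum_i\prod_{j=1}^{i-1}\frac{(1-q_1^{\lambda_i-\lambda_j}q_3^{i-j-1})(1-q_1^{\lambda_i-\lambda_j+1}q_3^{i-j+1})}{(1-q_1^{\lambda_i-\lambda_j}q_3^{i-j})(1-q_1^{\lambda_i-\lambda_j+1}q_3^{i-j})}\delta(q_1^{\lambda_i}q_3^{i-1}u/z)|\lambda+\mathbf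 1_i\rangle,$$ $$-(1-q_1^{-1})f(z)|\lambda\rangle=\sum_i\prod_{j=i+1}^N\frac{(1-q_1^{\lambda_j-\lambda_i+1}q_3^{j-i+1})(1-q_1^{\lambda_j-\lambda_i}q_3^{j-i-1})}{(1-q_1^{\lambda_j-\lambda_i+1}q_3^{j-i})(1-q_1^{\lambda_j-\lambda_i}q_3^{j-i})}\delta(q_1^{\lambda_i-1}q_3^{i-1}u/z)|\lambda-\mathbf 1_i\rangle,$$ $$\psi^\pm(z)|\lambda\rangle=\Big(\prod_{i=1}^N\frac{(1-q_1^{\lambda_i}q_3^{i}u/z)(1-q_1^{\lambda_i-1}q_3^{i-2}u/z)}{(1-q_1^{\lambda_i}q_3^{i-1}u/z)(1-q_1^{\lambda_i-1}q_3^{i-1}u/z)}\Big)^\pm|\lambda\rangle,$$ where $\gamma(z)^\pm$ is the expansion in powers of $z^{\mp1}$. Semi-infinite space. Fix integers $\mathbf c=(c_1,\dots,c_{k-1})$ with $0=c_0\le c_1\le\dots\le c_{k-1}\le r$ and put $\lambda^0_{\nu k+i+1}=-\nu r-c_i$ ($\nu\ge0$, $0\le i\le k-1$). Let $S^{k,r}_{\mathbf c}$ be the set of infinite integer sequences $\lambda_1\ge\lambda_2\ge\cdots$ with $\lambda_j-\lambda_{j+k}\ge r$ for all $j\ge1$ and $\lambda_j=\lambda_j^0$ for sufficiently large $j$, and let $W_{\mathbf c}^{k,r}(u)$ be the space with basis $|\lambda\rangle$, $\lambda\in S^{k,r}_{\mathbf c}$. Let $S^{k,r,N,+}_{\mathbf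 c}=\{\lambda\in S^{k,r,N}\mid\lambda_j\ge\lambda_j^0,\ 1\le j\le N\}$ and $W^{k,r,N,+}_{\mathbf c}(u)=\mathrm{span}\{|\lambda\rangle\mid\lambda\in S^{k,r,N,+}_{\mathbf c}\}$, with embeddings $W^{k,r,N,+}_{\mathbf c}(u)\to W^{k,r,N+k,+}_{\mathbf c}(u)$, $|\lambda_1,\dots,\lambda_N\rangle\mapsto|\lambda_1,\dots,\lambda_N,\lambda^0_{N+1},\dots,\lambda^0_{N+k}\rangle$; these identify $W^{k,r}_{\mathbf c}(u)$ with the inductive limit. Modified operators. For $N=\nu k+i+1$ ($0\le i\le k-1$, $\nu\ge0$) let $$\beta_{k,N}(z)=\prod_{j=0}^i\frac{1-q_1^{-c_j-\nu-1}q_3^{-\nu+j}u/z}{1-q_1^{-c_j-\nu-1}q_3^{-\nu+j-1}u/z}\prod_{j=i+1}^{k-1}\frac{1-q_1^{-c_j-\nu}q_3^{-\nu+j+1}u/z}{1-q_1^{-c_j-\nu}q_3^{-\nu+j}u/z},$$ and set $e^{[k,N]}(z)=e(z)$, $f^{[k,N]}(z)=\beta_{k,N}(z)f(z)$, $\psi^{\pm[k,N]}(z)=\beta_{k,N}(z)\psi^\pm(z)$. In $f^{[k,N]}$ each delta function occurring is multiplied by the value of $\beta_{k,N}$ at its support; in $\psi^{+[k,N]}$ (resp. $\psi^{-[k,N]}$) $\beta_{k,N}$ is expanded in powers of $z^{-1}$ (resp. $z$). The limit in the claim means the value for all sufficiently large $N$, these values being compatible with the embeddings. *)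

(* Defs.v *)
From HB Require Import structures.
From mathcomp Require Import all_boot all_order all_algebra.
From mathcomp Require Import generic_quotient.
From mathcomp Require Import finmap boolp reals complex monalg.

Set Implicit Arguments.
Unset Strict Implicit.
Unset Printing Implicit Defensive.

Import Order.TTheory GRing.Theory Num.Theory.
Local Open Scope ring_scope.
Local Open Scope quotient_scope.

(** * The algebra E, as a quotient of a free associative algebra *)

(* [Gpsi s n] is psi^+_n when [s = true] and psi^-_{-n} when [s = false];
   [Gpsi0V s] is the formal inverse of [Gpsi s 0]. *)
Inductive egen : Type :=
  | Ge of int | Gf of int | Gpsi of bool & nat | Gpsi0V of bool.

HB.instance Definition _ := gen_eqMixin egen.
HB.instance Definition _ := gen_choiceMixin egen.

Definition efree (F : fieldType) := {malg F[{fmonom egen}]}.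

Definition fgen (F : fieldType) (x : egen) : efree F := << fmu x >>.

Lemma malgC_comm (K : monomType) (F : fieldType) (c : F) (x : {malg F[K]}) :
  x * c%:MP = c%:MP * x.
Proof.
rewrite !malgM_def fgmulgU fgmulUg; apply: eq_bigr => k _.
by rewrite mulm1 mul1m mulrC.
Qed.

Lemma malg_scalerAr (K : monomType) (F : fieldType) (c : F)
    (x y : {malg F[K]}) :
  c *: (x * y) = x * (c *: y).
Proof.
have aux (R : nzRingType) (a b d : R) : b * a = a * b -> a * (b * d) = b * (a * d).
  by move=> ab; rewrite !mulrA ab.
by rewrite -(mul_malgC c (x * y)) -(mul_malgC c y); exact/aux/malgC_comm.
Qed.

Section Relations.
Context (F : fieldType) (q1 q2 q3 : F).
Local Notation A := (efree F).

Definition fe (i : int) : A := fgen F (Ge i).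
Definition ff (i : int) : A := fgen F (Gf i).

(* Coefficient of z^{-i} in psi^+(z) (s = true) or psi^-(z) (s = false). *)
Definition fpsi (s : bool) (i : int) : A :=
  if (if s then 0 <= i else i <= 0) then fgen F (Gpsi s `|i|%N) else 0.

Definition g (z w : F) : F := (z - q1 * w) * (z - q2 * w) * (z - q3 * w).

(* g(z,w) = \sum_(a < 4) gcoef a * z^a * w^(3-a) *)
Definition gcoef (a : nat) : F :=
  (('X - q1%:P) * ('X - q2%:P) * ('X - q3%:P) : {poly F})`_a.

(* Coefficients of z^{-m} w^{-n} in g(z,w) D(z,w) and in g(w,z) D(z,w), where
   D(z,w) is the formal distribution \sum_(i,j) D i j z^{-i} w^{-j}. *)
Definition gzw_mul (D : int -> int -> A) (m n : int) : A :=
  \sum_(a < 4) gcoef a *: D (m + a%:Z) (n + (3 - a)%N%:Z).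
Definition gwz_mul (D : int -> int -> A) (m n : int) : A :=
  \sum_(a < 4) gcoef a *: D (m + (3 - a)%N%:Z) (n + a%:Z).

Definition comm (x y : A) : A := x * y - y * x.

(* The delta function turns the right-hand side of the relation for
   [e(z), f(w)] into psi^+_{m+n} - psi^-_{m+n} at z^{-m} w^{-n}. *)
Inductive erel : A -> A -> Prop :=
  | rel_ee m n :
      erel (gzw_mul (fun i j => fe i * fe j) m n)
           (- gwz_mul (fun i j => fe j * fe i) m n)
  | rel_ff m n :
      erel (gwz_mul (fun i j => ff i * ff j) m n)
           (- gzw_mul (fun i j => ff j * ff i) m n)
  | rel_psie s m n :
      erel (gzw_mul (fun i j => fpsi s i * fe j) m n)
           (- gwz_mul (fun i j => fe j * fpsi s i) m n)
  | rel_psif s m n :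
      erel (gwz_mul (fun i j => fpsi s i * ff j) m n)
           (- gzw_mul (fun i j => ff j * fpsi s i) m n)
  | rel_ef m n :
      erel (comm (fe m) (ff n))
           ((g 1 1)^-1 *: (fpsi true (m + n) - fpsi false (m + n)))
  | rel_psipsi s t i j : erel (comm (fpsi s i) (fpsi t j)) 0
  | rel_psiV s : erel (fgen F (Gpsi s 0) * fgen F (Gpsi0V s)) 1
  | rel_Vpsi s : erel (fgen F (Gpsi0V s) * fgen F (Gpsi s 0)) 1
  | rel_serre_e : erel (comm (fe 0) (comm (fe 1) (fe (-1)))) 0
  | rel_serre_f : erel (comm (ff 0) (comm (ff 1) (ff (-1)))) 0.

(* The two-sided ideal generated by the differences x - y with [erel x y]. *)
Inductive eideal : A -> Prop :=
  | eideal0 : eideal 0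
  | eidealD a x y b z :
      erel x y -> eideal z -> eideal (a * (x - y) * b + z).

Let distr_mul (R : nzRingType) (a b c d x z : R) :
  c * (a * x * b + z) * d = (c * a) * x * (b * d) + c * z * d.
Proof. by rewrite mulrDr mulrDl !mulrA. Qed.

Let sub_mul (R : nzRingType) (x x' y y' : R) :
  x * y - x' * y' = (x - x') * y + x' * (y - y').
Proof. by rewrite mulrBl mulrBr addrA subrK. Qed.

Lemma eideal_gen a x y b : erel x y -> eideal (a * (x - y) * b).
Proof. by move=> xy; rewrite -[X in eideal X]addr0; apply: eidealD xy eideal0. Qed.

Lemma eideal_add x y : eideal x -> eideal y -> eideal (x + y).
Proof.
elim=> [|a p q b z pq _ IH] Iy; first by rewrite add0r.
by rewrite -addrA; apply: eidealD pq (IH Iy).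
Qed.

Lemma eideal_mul c d x : eideal x -> eideal (c * x * d).
Proof.
elim=> [|a p q b z pq _ IH]; first by rewrite mulr0 mul0r; exact: eideal0.
by rewrite distr_mul; exact: (eidealD _ _ pq IH).
Qed.

Lemma eideal_mull c x : eideal x -> eideal (c * x).
Proof. by move=> /(eideal_mul c 1); rewrite mulr1. Qed.

Lemma eideal_mulr c x : eideal x -> eideal (x * c).
Proof. by move=> /(eideal_mul 1 c); rewrite mul1r. Qed.

Lemma eideal_scale c x : eideal x -> eideal (c *: x).
Proof. by rewrite -mul_malgC; exact: eideal_mull. Qed.

Lemma eideal_opp x : eideal x -> eideal (- x).
Proof. by rewrite -scaleN1r; exact: eideal_scale. Qed.

Definition eqv (x y : A) : bool := `[< eideal (x - y) >].

Lemma eqv_equiv : equiv_class_of eqv.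
Proof.
split=> [x|x y|y x z].
- by apply/asboolP; rewrite subrr; exact: eideal0.
- by apply/asboolP/asboolP => /eideal_opp; rewrite opprB.
- move=> /asboolP xy /asboolP yz; apply/asboolP.
  by rewrite -(subrK y x) -addrA; exact: eideal_add.
Qed.

Canonical eqv_equiv_rel := EquivRelPack eqv_equiv.
Canonical eqv_encModRel := defaultEncModRel eqv.

Definition ealg := {eq_quot eqv}.
HB.instance Definition _ : EqQuotient A eqv ealg := EqQuotient.on ealg.
HB.instance Definition _ := Choice.on ealg.

Definition ecl (x : A) : ealg := \pi_ealg x.

Lemma ecl_eqP x y : ecl x = ecl y <-> eideal (x - y).
Proof.
rewrite /ecl; split=> [/eqP|/asboolP xy].
  by rewrite eqmodE => /asboolP.
by apply/eqP; rewrite eqmodE.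
Qed.

Lemma eclK x : eideal (repr (ecl x) - x).
Proof. by apply/ecl_eqP; rewrite /ecl reprK. Qed.

Lemma ecl_repr x : ecl (repr x) = x.
Proof. exact: reprK. Qed.

Definition eadd (x y : ealg) : ealg := ecl (repr x + repr y).
Definition eopp (x : ealg) : ealg := ecl (- repr x).
Definition emul (x y : ealg) : ealg := ecl (repr x * repr y).
Definition escale (c : F) (x : ealg) : ealg := ecl (c *: repr x).

Lemma eclD x y : ecl (x + y) = eadd (ecl x) (ecl y).
Proof.
apply/esym/ecl_eqP; rewrite opprD addrACA.
by apply: eideal_add; exact: eclK.
Qed.

Lemma eclN x : ecl (- x) = eopp (ecl x).
Proof. by apply/esym/ecl_eqP; rewrite -opprD; apply/eideal_opp/eclK. Qed.

Lemma eclM x y : ecl (x * y) = emul (ecl x) (ecl y).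
Proof.
apply/esym/ecl_eqP; rewrite sub_mul; apply: eideal_add.
  exact/eideal_mulr/eclK.
exact/eideal_mull/eclK.
Qed.

Lemma eclZ c x : ecl (c *: x) = escale c (ecl x).
Proof. by apply/esym/ecl_eqP; rewrite -scalerBr; exact/eideal_scale/eclK. Qed.

Local Opaque eadd eopp emul escale.

Lemma eaddA : associative eadd.
Proof.
by move=> x y z; rewrite -[x]ecl_repr -[y]ecl_repr -[z]ecl_repr -!eclD addrA.
Qed.
Lemma eaddC : commutative eadd.
Proof. by move=> x y; rewrite -[x]ecl_repr -[y]ecl_repr -!eclD addrC. Qed.
Lemma eadd0 : left_id (ecl 0) eadd.
Proof. by move=> x; rewrite -[x]ecl_repr -eclD add0r. Qed.
Lemma eaddN : left_inverse (ecl 0) eopp eadd.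
Proof. by move=> x; rewrite -[x]ecl_repr -eclN -eclD addNr. Qed.

HB.instance Definition _ :=
  GRing.isZmodule.Build ealg eaddA eaddC eadd0 eaddN.

Lemma emulA : associative emul.
Proof.
by move=> x y z; rewrite -[x]ecl_repr -[y]ecl_repr -[z]ecl_repr -!eclM mulrA.
Qed.
Lemma emul1l : left_id (ecl 1) emul.
Proof. by move=> x; rewrite -[x]ecl_repr -eclM mul1r. Qed.
Lemma emul1r : right_id (ecl 1) emul.
Proof. by move=> x; rewrite -[x]ecl_repr -eclM mulr1. Qed.
Lemma emulDl : left_distributive emul eadd.
Proof.
move=> x y z; rewrite -[x]ecl_repr -[y]ecl_repr -[z]ecl_repr.
by rewrite -!(eclD, eclM) mulrDl.
Qed.
Lemma emulDr : right_distributive emul eadd.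
Proof.
move=> x y z; rewrite -[x]ecl_repr -[y]ecl_repr -[z]ecl_repr.
by rewrite -!(eclD, eclM) mulrDr.
Qed.

(* E is not the zero ring: the character sending every e_i, f_i and psi_j with
   j <> 0 to 0, and every (psi_0)^{+-1} to 1, respects the relations. *)
Definition counit_gen (x : egen) : F :=
  match x with Gpsi _ 0 | Gpsi0V _ => 1 | _ => 0 end.
Definition counit_mon (m : {fmonom egen}) : F := \prod_(x <- m) counit_gen x.

Lemma counit_mon_morph : mmorphism counit_mon.
Proof.
split=> [x y|]; rewrite /counit_mon.
  by rewrite fmM big_cat.
by rewrite fm1 big_nil.
Qed.
HB.instance Definition _ :=
  isMultiplicative.Build {fmonom egen} F counit_mon counit_mon_morph.

Definition counit : A -> F := mmap idfun counit_mon.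
HB.instance Definition _ := GRing.RMorphism.on counit.

Lemma counitU x : counit (fgen F x) = counit_gen x.
Proof. by rewrite /counit /fgen mmapU mul1r /counit_mon fmU big_seq1. Qed.

Lemma counitZ c x : counit (c *: x) = c * counit x.
Proof. exact: mmapZ. Qed.

Lemma counitM : {morph counit : x y / x * y}. Proof. exact: rmorphM. Qed.
Lemma counitD : {morph counit : x y / x + y}. Proof. exact: rmorphD. Qed.
Lemma counitN : {morph counit : x / - x}. Proof. exact: rmorphN. Qed.
Lemma counitB : {morph counit : x y / x - y}. Proof. exact: rmorphB. Qed.
Lemma counit0 : counit 0 = 0. Proof. exact: rmorph0. Qed.
Lemma counit1 : counit 1 = 1. Proof. exact: rmorph1. Qed.

Lemma counit_psi s i : counit (fpsi s i) = (i == 0)%:R.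
Proof.
rewrite /fpsi; case: ifPn => [_|]; last first.
  by case: s; rewrite counit0 -ltNge; [move=> /lt_eqF->|move=> /gt_eqF->].
by rewrite counitU; case: i => [[|n]|n].
Qed.

Lemma counit_gzw D m n :
  (forall i j, counit (D i j) = 0) -> counit (gzw_mul D m n) = 0.
Proof.
move=> D0; rewrite [LHS]rmorph_sum big1// => a _.
by apply: etrans (counitZ _ _) _; rewrite D0 mulr0.
Qed.

Lemma counit_gwz D m n :
  (forall i j, counit (D i j) = 0) -> counit (gwz_mul D m n) = 0.
Proof.
move=> D0; rewrite [LHS]rmorph_sum big1// => a _.
by apply: etrans (counitZ _ _) _; rewrite D0 mulr0.
Qed.

Lemma counit_comm x y : counit (comm x y) = 0.
Proof. apply: etrans (counitB _ _) _; apply/eqP; rewrite subr_eq0; apply/eqP.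
exact: etrans (counitM x y) (etrans (mulrC _ _) (esym (counitM y x))). Qed.

Lemma counit_rel x y : erel x y -> counit x = counit y.
Proof.
have M a b : counit a = 0 -> counit (a * b) = 0 /\ counit (b * a) = 0.
  by move=> a0; split; [rewrite (counitM a) a0 mul0r
                       |rewrite (counitM b) a0 mulr0].
have E i : counit (fe i) = 0 by rewrite counitU.
have H i : counit (ff i) = 0 by rewrite counitU.
have EM i b := M (fe i) b (E i).
have HM i b := M (ff i) b (H i).
have O D D' m n : (forall i j, counit (D i j) = 0) ->
    (forall i j, counit (D' i j) = 0) ->
    counit (gzw_mul D m n) = counit (- gwz_mul D' m n) /\
    counit (gwz_mul D m n) = counit (- gzw_mul D' m n).
  have z a b : a = 0 -> b = 0 -> a = - b :> F by move=> -> ->; rewrite oppr0.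
  move=> D0 D0'; split; apply: etrans (esym (counitN _)).
    by apply: z; [exact: counit_gzw|exact: counit_gwz].
  by apply: z; [exact: counit_gwz|exact: counit_gzw].
case.
- move=> m n; apply: (proj1 (O _ _ m n _ _)) => i j.
  + exact: (proj1 (EM i (fe j))).
  + exact: (proj1 (EM j (fe i))).
- move=> m n; apply: (proj2 (O _ _ m n _ _)) => i j.
  + exact: (proj1 (HM i (ff j))).
  + exact: (proj1 (HM j (ff i))).
- move=> s m n; apply: (proj1 (O _ _ m n _ _)) => i j.
  + exact: (proj2 (EM j (fpsi s i))).
  + exact: (proj1 (EM j (fpsi s i))).
- move=> s m n; apply: (proj2 (O _ _ m n _ _)) => i j.
  + exact: (proj2 (HM j (fpsi s i))).
  + exact: (proj1 (HM j (fpsi s i))).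
- move=> m n; rewrite counit_comm counitZ counitB.
  by rewrite (counit_psi true) (counit_psi false) subrr mulr0.
- by move=> s t i j; rewrite counit_comm counit0.
- by move=> s; rewrite (counitM (fgen F _)) (counitU (Gpsi s 0)) counitU mulr1 counit1.
- by move=> s; rewrite (counitM (fgen F _)) (counitU (Gpsi0V s)) counitU mulr1 counit1.
- by rewrite counit_comm counit0.
- by rewrite counit_comm counit0.
Qed.

Lemma counit_ideal x : eideal x -> counit x = 0.
Proof.
elim=> [|a p q b z pq _ IH]; first exact: counit0.
rewrite counitD IH (counitM (a * _)) (counitM a) counitB (counit_rel pq).
by rewrite subrr mulr0 mul0r add0r.
Qed.

Lemma eone_neq0 : ecl 1 != ecl 0.
Proof.
apply/eqP => /ecl_eqP /counit_ideal; rewrite subr0 counit1.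
by move/eqP; rewrite oner_eq0.
Qed.

HB.instance Definition _ := GRing.Zmodule_isNzRing.Build ealg
  emulA emul1l emul1r emulDl emulDr eone_neq0.

Lemma escaleA a b x : escale a (escale b x) = escale (a * b) x.
Proof. by rewrite -[x]ecl_repr -!eclZ scalerA. Qed.
Lemma escale1 : left_id 1 escale.
Proof. by move=> x; rewrite -[x]ecl_repr -eclZ scale1r. Qed.
Lemma escaleDr : right_distributive escale eadd.
Proof.
by move=> c x y; rewrite -[x]ecl_repr -[y]ecl_repr -!(eclD, eclZ) scalerDr.
Qed.
Lemma escaleDl x : {morph escale^~ x : a b / a + b >-> eadd a b}.
Proof. by move=> a b; rewrite -[x]ecl_repr -!(eclD, eclZ) scalerDl. Qed.

HB.instance Definition _ := GRing.Zmodule_isLmodule.Build F ealg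
  escaleA escale1 escaleDr escaleDl.

Lemma escaleAl c (x y : ealg) : c *: (x * y) = (c *: x) * y.
Proof.
rewrite -[x]ecl_repr -[y]ecl_repr.
rewrite -[LHS]/(escale c (emul _ _)) -[RHS]/(emul (escale c _) _).
by rewrite -!(eclM, eclZ) scalerAl.
Qed.
HB.instance Definition _ := GRing.Lmodule_isLalgebra.Build F ealg escaleAl.

Lemma escaleAr c (x y : ealg) : c *: (x * y) = x * (c *: y).
Proof.
rewrite -[x]ecl_repr -[y]ecl_repr.
rewrite -[LHS]/(escale c (emul _ _)) -[RHS]/(emul _ (escale c _)).
rewrite -!(eclM, eclZ); congr ecl; exact: malg_scalerAr.
Qed.
HB.instance Definition _ := GRing.Lalgebra_isAlgebra.Build F ealg escaleAr.

Definition E_e (i : int) : ealg := ecl (fe i).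
Definition E_f (i : int) : ealg := ecl (ff i).
(* psi^+_n (s = true) or psi^-_{-n} (s = false) *)
Definition E_psi (s : bool) (n : nat) : ealg := ecl (fgen F (Gpsi s n)).

End Relations.

Record is_module (F : fieldType) (A : algType F) (V : lmodType F)
    (act : A -> V -> V) : Prop := IsModule {
  act_linearl : forall v, linear (act^~ v);
  act_linearr : forall a, linear (act a);
  act1 : forall v, act 1 v = v;
  actM : forall a b v, act (a * b) v = act a (act b v) }.

Definition has_level (F : fieldType) (q1 q2 q3 : F) (V : lmodType F)
    (act : ealg q1 q2 q3 -> V -> V) (lp lm : F) : Prop :=
  forall v, act (E_psi q1 q2 q3 true 0) v = lp *: v
         /\ act (E_psi q1 q2 q3 false 0) v = lm *: v.

(** * Rational functions of z and their expansions *)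

Section Rational.
Context (F : fieldType).

(* The list L stands for \prod_(p <- L) (1 - p.1 / z) / (1 - p.2 / z). *)
Definition ratfun := seq (F * F).

Definition reval (L : ratfun) (z : F) : F :=
  \prod_(p <- L) ((1 - p.1 / z) / (1 - p.2 / z)).

Definition psone (n : nat) : F := (n == 0)%:R.
Definition psmul (a b : nat -> F) (n : nat) : F :=
  \sum_(i < n.+1) a i * b (n - i)%N.
Definition pslin (a : F) (n : nat) : F := (n == 0)%:R - a * (n == 1)%:R.
Definition psgeom (b : F) (n : nat) : F := b ^+ n.

(* Power series in t = z^{-1} when [s = true], in t = z when [s = false].  The
   latter, for a, b != 0, uses
   (1 - a/z) / (1 - b/z) = (a/b) (1 - a^{-1} z) / (1 - b^{-1} z). *)
Definition fct_expand (s : bool) (p : F * F) : nat -> F :=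
  let: (a, b) := p in
  if s then psmul (pslin a) (psgeom b)
  else fun n => a / b * psmul (pslin a^-1) (psgeom b^-1) n.

Definition expand (s : bool) (L : ratfun) : nat -> F :=
  \big[psmul/psone]_(p <- L) fct_expand s p.

End Rational.

(** * The finite modules and the semi-infinite space

   Row indices start at 0: [l j] is lambda_{j+1}, so that q_3^{i-1} for the
   i-th row becomes q_3^i, and so on. *)

Definition in_fin (k r N : nat) (l : {ffun 'I_N -> int}) : bool :=
  [forall i : 'I_N, forall j : 'I_N, (j == i.+1 :> nat) ==> (l j <= l i)] &&
  [forall i : 'I_N, forall j : 'I_N,
     (j == i + k :> nat)%N ==> (r%:Z <= l i - l j)].

Definition fin_set (k r N : nat) : Type :=
  {l : {ffun 'I_N -> int} | in_fin k r l}.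
HB.instance Definition _ k r N := Choice.on (fin_set k r N).

(* [c] lists c_1, ..., c_{k-1}; thus [(0 :: c)`_i] is c_i for 0 <= i < k. *)
Definition lambda0 (k r : nat) (c : seq int) (j : nat) : int :=
  - ((j %/ k)%N%:Z * r%:Z) - (0 :: c)`_(j %% k).

Definition in_inf (k r : nat) (c : seq int) (l : nat -> int) : Prop :=
  [/\ forall j, l j.+1 <= l j,
      forall j, r%:Z <= l j - l (j + k)%N
    & exists J, forall j, (J <= j)%N -> l j = lambda0 k r c j].

Definition inf_set (k r : nat) (c : seq int) : Type :=
  {l : nat -> int | `[< in_inf k r c l >]}.
HB.instance Definition _ k r c := Choice.on (inf_set k r c).

Definition fin_space (F : fieldType) (k r N : nat) :=
  {malg F[(fin_set k r N)]}.

Definition inf_space (F : fieldType) (k r : nat) (c : seq int) :=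
  {malg F[(inf_set k r c)]}.

(* |l>, read as 0 when l is not in the index set. *)
Definition fin_ket (F : fieldType) (k r N : nat) (l : {ffun 'I_N -> int}) :
    fin_space F k r N :=
  if (insub l : option (fin_set k r N)) is Some m then << m >> else 0.

Definition inf_ket (F : fieldType) (k r : nat) (c : seq int) (l : nat -> int) :
    inf_space F k r c :=
  if (insub l : option (inf_set k r c)) is Some m then << m >> else 0.

Section Limit.
Context (F : fieldType) (k r : nat) (c : seq int).

Definition trunc (N : nat) (l : nat -> int) : {ffun 'I_N -> int} :=
  [ffun j : 'I_N => l j].

Definition extend (N : nat) (l : {ffun 'I_N -> int}) (j : nat) : int :=
  if (insub j : option 'I_N) is Some i then l i else lambda0 k r c j.

(* Membership in the span W^{k,r,N,+}_c(u). *)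
Definition in_plus (N : nat) (w : fin_space F k r N) : Prop :=
  forall l, w@_l != 0 -> forall j : 'I_N, lambda0 k r c j <= val l j.

(* The map to the inductive limit; meaningful on W^{k,r,N,+}_c(u). *)
Definition embed (N : nat) (w : fin_space F k r N) : inf_space F k r c :=
  \sum_(l <- msupp w) w@_l *: inf_ket F k r c (extend (val l)).

(* v is the limit of the series w_N: for all large N, w_N lies in W^{k,r,N,+}_c
   and v is its image (I indexes the coefficients of the series in z). *)
Definition is_ind_limit (I : Type) (w : forall N, I -> fin_space F k r N)
    (v : I -> inf_space F k r c) : Prop :=
  exists N0, forall N, (N0 <= N)%N ->
    forall n, in_plus (w N n) /\ embed (w N n) = v n.

End Limit.

Section Operators.
Context (F : fieldType) (k r : nat) (c : seq int) (q1 q3 u : F).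

Definition bf1 (N : nat) (i : 'I_N) : {ffun 'I_N -> int} :=
  [ffun j => (j == i)%:R].

Definition e_coef (N : nat) (l : {ffun 'I_N -> int}) (i : 'I_N) : F :=
  \prod_(j < N | (j < i)%N)
    (((1 - q1 ^ (l i - l j) * q3 ^ (i%:Z - j%:Z - 1)) *
      (1 - q1 ^ (l i - l j + 1) * q3 ^ (i%:Z - j%:Z + 1))) /
     ((1 - q1 ^ (l i - l j) * q3 ^ (i%:Z - j%:Z)) *
      (1 - q1 ^ (l i - l j + 1) * q3 ^ (i%:Z - j%:Z)))).

Definition f_coef (N : nat) (l : {ffun 'I_N -> int}) (i : 'I_N) : F :=
  \prod_(j < N | (i < j)%N)
    (((1 - q1 ^ (l j - l i + 1) * q3 ^ (j%:Z - i%:Z + 1)) *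
      (1 - q1 ^ (l j - l i) * q3 ^ (j%:Z - i%:Z - 1))) /
     ((1 - q1 ^ (l j - l i + 1) * q3 ^ (j%:Z - i%:Z)) *
      (1 - q1 ^ (l j - l i) * q3 ^ (j%:Z - i%:Z)))).

Definition psi_rat (N : nat) (l : {ffun 'I_N -> int}) : ratfun F :=
  flatten [seq [:: (q1 ^ (l i) * q3 ^ (i%:Z + 1) * u,
                    q1 ^ (l i) * q3 ^ i%:Z * u);
                   (q1 ^ (l i - 1) * q3 ^ (i%:Z - 1) * u,
                    q1 ^ (l i - 1) * q3 ^ i%:Z * u)] | i <- enum 'I_N].

(* N = nu * k + i + 1; only N > 0 is meaningful. *)
Definition beta (N : nat) : ratfun F :=
  let nu : int := (N.-1 %/ k)%N%:Z in
  let i := (N.-1 %% k)%N in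
  let cc j := (0 :: c)`_j in
  [seq (q1 ^ (- cc j - nu - 1) * q3 ^ (- nu + j%:Z) * u,
        q1 ^ (- cc j - nu - 1) * q3 ^ (- nu + j%:Z - 1) * u)
     | j <- iota 0 i.+1] ++
  [seq (q1 ^ (- cc j - nu) * q3 ^ (- nu + j%:Z + 1) * u,
        q1 ^ (- cc j - nu) * q3 ^ (- nu + j%:Z) * u)
     | j <- iota i.+1 (k - i.+1)].

(* The coefficient of z^{-n} in delta(a/z) is a^n. *)
Definition e_mod (N : nat) (n : int) (l : {ffun 'I_N -> int}) :
    fin_space F k r N :=
  (1 - q1)^-1 *: \sum_(i < N)
    (e_coef l i * (q1 ^ (l i) * q3 ^ i%:Z * u) ^ n) *:
      fin_ket F k r (l + bf1 i).

Definition f_mod (N : nat) (n : int) (l : {ffun 'I_N -> int}) :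
    fin_space F k r N :=
  (- (1 - q1^-1))^-1 *: \sum_(i < N)
    (let a := q1 ^ (l i - 1) * q3 ^ i%:Z * u in
     (reval (beta N) a * f_coef l i * a ^ n) *: fin_ket F k r (l - bf1 i)).

(* Coefficient of z^{-n} (s = true) or z^n (s = false). *)
Definition psi_mod (s : bool) (N : nat) (n : nat) (l : {ffun 'I_N -> int}) :
    fin_space F k r N :=
  psmul (expand s (beta N)) (expand s (psi_rat l)) n *: fin_ket F k r l.

End Operators.

(* Main.v *)
From HB Require Import structures.
Require Import Defs.
From mathcomp Require Import all_boot all_order all_algebra.
From mathcomp Require Import generic_quotient finmap boolp reals complex monalg.
From mathcomp Require Import ring lra zify.
Set Implicit Arguments.
Unset Strict Implicit.
Unset Printing Implicit Defensive.
Import Order.TTheory GRing.Theory Num.Theory.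
Local Open Scope ring_scope.

(** To a sequence [l] attach the points [pt l i = q1 ^ l i * q3 ^ i].  Every matrix
    coefficient of [e] and [f] is a product, over pairs of rows, of values of one
    function [phi] at the ratio of the two points, and [phi] is [g] in disguise:
    [phi X = K X * g X 1] and [phi (X / q1) = - K X * g 1 X] with the same [K]
    ([phiE], [phiE']).  Raising the upper row of a pair divides the ratio by [q1],
    so the coefficients of the two orders in which two rows can be moved differ,
    up to sign, by the exchange of the arguments of [g].  This is the quadratic
    relation ([exchange]), and it turns the Serre relation for three distinct rows
    into a polynomial identity ([serre_poly]).  The lowering coefficients are the
    raising ones of the reversed and negated sequence ([fcf_flip]); the correction
    [beta] enters through a factor that depends on the point alone and does not
    disturb the argument.

    The resonance condition is what makes these formulas compatible with the
    admissibility of sequences.  A coefficient vanishes when the target leaves the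
    admissible set ([ecf_adm], [fcf_adm]), because the ratio of two points is then
    [q3] or [q2], a root of the numerator of [phi].  Conversely, genericity and
    the gap condition leave so few coincidences between points
    ([pt_coincidence]) that no denominator vanishes where this matters.

    On a basis vector [psi] is a rational function of [z], given by its lists of
    zeros and poles.  The difference of its two expansions is the sum of the
    contributions of its poles ([partial_fractions]).  The poles coming from [beta]
    are also zeros, and the residues at the other ones are the products of the
    coefficients of [e] and [f] along one row ([res_px], [res_py]): this is the
    diagonal part of the commutator of [e] and [f] ([ef_diag]), while the parts
    that move two distinct rows cancel ([mixed_coef]).  Poles may collide, but
    only where enough zeros collide with them ([count_poles]).

    For a sequence that coincides with [lambda0] from [J] on, the gap condition is
    tight there, so that [pt l (i + k) = q2 * pt l i].  This relation makes the
    factor contributed by a new row cancel against the change of [beta]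
    ([psi_ser_stable], [bfcf_stable]), and the zeros of [beta] suppress the
    lowering of the last rows, which would leave the semi-infinite space
    ([bfcf_last]).  Hence the operators stabilise for [N >= J + k], and the
    relations, which hold for every sufficiently large [N], pass to the limit.
    Extending by linearity and passing to the quotient gives the module
    ([quot_act_module]).  Its level is the pair of values of [psi] at infinity and
    at zero: a row contributes 1 to both, and each of the [k] factors of [beta]
    contributes 1 and [q3] ([psi_ser0]). *)

(** * Expansions of rational functions *)

Section Series.
Context (F : fieldType).
Implicit Types (a b : nat -> F) (L : ratfun F).

(** Truncation reduces the algebra of power series to that of polynomials. *)
Lemma psmulE a b n m : (n < m)%N ->
  psmul a b n = ((\poly_(i < m) a i) * (\poly_(i < m) b i))`_n.
Proof.
move=> nm; rewrite coefM; apply: eq_bigr => i _.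
have im : (i < m)%N by apply: leq_ltn_trans nm; rewrite -ltnS.
by rewrite !coef_poly im (leq_ltn_trans (leq_subr _ _) nm).
Qed.

Lemma psmulC : commutative (@psmul F).
Proof.
by move=> a b; apply/funext => n; rewrite !(@psmulE _ _ n n.+1)// mulrC.
Qed.

Lemma psmulA : associative (@psmul F).
Proof.
move=> a b c; apply/funext => n.
rewrite [LHS](@psmulE _ _ n n.+1)// [RHS](@psmulE _ _ n n.+1)//.
have trunc_psmul (p q : nat -> F) i : (i < n.+1)%N ->
    (\poly_(j < n.+1) psmul p q j)`_i
    = ((\poly_(j < n.+1) p j) * (\poly_(j < n.+1) q j))`_i.
  by move=> lt_in; rewrite coef_poly lt_in; exact: psmulE.
transitivity ((\poly_(j < n.+1) a j) *
   ((\poly_(j < n.+1) b j) * (\poly_(j < n.+1) c j)))`_n.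
  rewrite !coefM; apply: eq_bigr => i _; congr (_ * _).
  by rewrite trunc_psmul// ltnS leq_subr.
rewrite mulrA !coefM; apply: eq_bigr => i _; congr (_ * _).
by rewrite trunc_psmul.
Qed.

Lemma psmul1l : left_id (@psone F) (@psmul F).
Proof.
move=> a; apply/funext => n; rewrite /psmul big_ord_recl /psone eqxx mul1r subn0.
by rewrite big1 ?addr0// => i _; rewrite mul0r.
Qed.

HB.instance Definition _ :=
  Monoid.isComLaw.Build (nat -> F) (@psone F) (@psmul F) psmulA psmulC psmul1l.

Lemma psmul1r : right_id (@psone F) (@psmul F).
Proof. exact: Monoid.mulm1. Qed.

Lemma psmul_lin c a n :
  psmul (pslin c) a n = a n - (if n is m.+1 then c * a m else 0).
Proof.
rewrite /psmul big_ord_recl /pslin /= mulr1n mulr0 subr0 mul1r subn0.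
case: n => [|n]; first by rewrite big_ord0 addr0 subr0.
rewrite big_ord_recl /= big1 => [|i _].
  by rewrite addr0 sub0r mulr1 mulNr subn1.
by rewrite mulr0 subrr mul0r.
Qed.

Definition psscale c0 a : nat -> F := fun n => c0 * a n.

Lemma psmulZl c0 a b : psmul (psscale c0 a) b = psscale c0 (psmul a b).
Proof.
apply/funext => n; rewrite /psmul /psscale mulr_sumr; apply: eq_bigr => i _.
by rewrite mulrA.
Qed.

Lemma psmulZr c0 a b : psmul a (psscale c0 b) = psscale c0 (psmul a b).
Proof. by rewrite psmulC psmulZl psmulC. Qed.

Lemma psscaleA c0 c1 a : psscale c0 (psscale c1 a) = psscale (c0 * c1) a.
Proof. by apply/funext => n; rewrite /psscale mulrA. Qed.

Lemma psscale1 a : psscale 1 a = a.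
Proof. by apply/funext => n; rewrite /psscale mul1r. Qed.

Lemma pslin_geom c : psmul (pslin c) (psgeom c) = @psone F.
Proof.
apply/funext => n; rewrite psmul_lin /psgeom /psone.
by case: n => [|n]; rewrite ?subr0// -exprS subrr.
Qed.

(** Expansion of [1 - c / z] for [s = true], of [- z * (1 - c / z)] for
    [s = false]; [den] is its inverse.  The factors [- z] cancel in a product with
    as many numerators as denominators. *)
Definition num (s : bool) (c : F) : nat -> F :=
  if s then pslin c else psscale c (pslin c^-1).

Definition den (s : bool) (c : F) : nat -> F :=
  if s then psgeom c else psscale c^-1 (psgeom c^-1).

Lemma num_den s c : c != 0 -> psmul (num s c) (den s c) = @psone F.
Proof.
move=> c0; case: s; rewrite /num /den ?pslin_geom//.
by rewrite psmulZl psmulZr pslin_geom psscaleA mulfV// psscale1.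
Qed.

Lemma fct_expandE s c d : fct_expand s (c, d) = psmul (num s c) (den s d).
Proof.
case: s => //=; rewrite psmulZl psmulZr psscaleA.
by apply/funext.
Qed.

Lemma expandE s L : expand s L =
  psmul (\big[@psmul F/@psone F]_(p <- L) num s p.1)
        (\big[@psmul F/@psone F]_(p <- L) den s p.2).
Proof.
rewrite -big_split /=; apply: eq_bigr => -[c d] _; exact: fct_expandE.
Qed.

Lemma psmul0E a b : psmul a b 0 = a 0 * b 0.
Proof. by rewrite /psmul big_ord1 subn0. Qed.

End Series.

(** * Partial fractions *)

Section PartialFractions.
Context (F : fieldType).
Implicit Types (A B : seq F) (a b z : F).

Definition rser (s : bool) A B : nat -> F :=
  psmul (\big[@psmul F/@psone F]_(a <- A) num s a)
        (\big[@psmul F/@psone F]_(b <- B) den s b).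

Definition rval A B z : F :=
  (\prod_(a <- A) (1 - a / z)) / (\prod_(b <- B) (1 - b / z)).

(** The coefficient of [1 / (1 - b / z)] in the partial fraction decomposition,
    for a simple pole [b]. *)
Definition res A B b : F := rval A (rem b B) b.

(** The expansion of [1 / (1 - b / z)]. *)
Definition pole_exp (s : bool) b (n : nat) : F :=
  if s then b ^+ n else if n is m.+1 then - (b^-1) ^+ n else 0.

(** Both kinds of expansions as families indexed by the exponent of [z^-1], as in
    the defining relations. *)
Definition ext (s : bool) (d : nat -> F) (i : int) : F :=
  if (if s then 0 <= i else i <= 0) then d `|i|%N else 0.

Lemma rser_cons s a b A B :
  rser s (a :: A) (b :: B) = psmul (psmul (num s a) (den s b)) (rser s A B).
Proof. by rewrite /rser !big_cons Monoid.mulmACA. Qed.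

Lemma rser_perm s A A' B B' : perm_eq A A' -> perm_eq B B' ->
  rser s A B = rser s A' B'.
Proof.
move=> pA pB; rewrite /rser.
by rewrite (perm_big _ pA) (perm_big _ pB).
Qed.

Lemma rval_perm A A' B B' z : perm_eq A A' -> perm_eq B B' ->
  rval A B z = rval A' B' z.
Proof. by move=> pA pB; rewrite /rval (perm_big _ pA) (perm_big _ pB). Qed.

Lemma res_perm A A' B B' b : perm_eq A A' -> perm_eq B B' ->
  res A B b = res A' B' b.
Proof.
move=> pA pB; apply: rval_perm => //; apply/permP => p.
by rewrite !count_rem (perm_mem pB) (permP pB).
Qed.

Lemma rval_cons a b A B z :
  rval (a :: A) (b :: B) z = (1 - a / z) / (1 - b / z) * rval A B z.
Proof. by rewrite /rval !big_cons invfM mulrACA. Qed.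

Lemma num_eq s a a' b (G G' : nat -> F) : b != 0 ->
  psmul (num s a) G = psmul (num s b) G' ->
  psmul (psmul (num s a) (den s b)) G = G'.
Proof.
move=> b0 e; rewrite (psmulC (num s a)) -psmulA e psmulA (psmulC (den s b)).
by rewrite num_den// psmul1l.
Qed.

Lemma psmul_num s c (G : nat -> F) n : c != 0 ->
  psmul (num s c) G n =
  if n is m.+1 then (if s then G n - c * G m else c * G n - G m)
  else if s then G 0%N else c * G 0%N.
Proof.
move=> c0; case: s; rewrite /num ?psmulZl /psscale psmul_lin.
  by case: n => // ; rewrite subr0.
by case: n => [|n]; rewrite ?subr0// mulrBr mulrA mulfV// mul1r.
Qed.

Lemma sub1_div a b : b != 0 -> (1 - a / b == 0) = (a == b).
Proof.
move=> b0; rewrite subr_eq0 eq_sym; apply/eqP/eqP => [e|->].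
  by rewrite -[a](mulfVK b0) e mul1r.
by rewrite mulfV.
Qed.

Lemma psone0 : psone F 0 = 1. Proof. by []. Qed.
Lemma psoneS n : psone F n.+1 = 0. Proof. by []. Qed.

Lemma pole_exp_falseS x n : x != 0 ->
  pole_exp false x n = x * pole_exp false x n.+1 + psone F n.
Proof.
move=> x0; case: n => [|n]; rewrite /pole_exp ?psone0 ?psoneS.
  by rewrite expr1; field.
by rewrite addr0 [in RHS]exprS mulrN mulVKf.
Qed.

(** By induction: multiplied by [(1 - a / z) / (1 - b / z)], the term of an old
    pole [x] becomes a combination of the terms of [x] and [b].  The formula for
    the value is proved along with that for the expansions because the residue
    at the new pole is a value of the old function. *)
Lemma pf_distinct A B : size A = size B -> uniq B ->
  all (predC1 0) A -> all (predC1 0) B ->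
  exists kappa,
   [/\ forall s, rser s A B = fun n => kappa * psone F n +
           \sum_(b <- B) res A B b * pole_exp s b n
    & forall z, z != 0 -> z \notin B ->
        rval A B z = kappa + \sum_(b <- B) res A B b / (1 - b / z)].
Proof.
elim: B A => [|b B IH] [|a A]//=.
  move=> _ _ _ _; exists 1; split=> [s|z _ _].
    apply/funext => n; rewrite big_nil addr0 mul1r.
    by rewrite /rser !big_nil psmul1l.
  by rewrite big_nil addr0 /rval !big_nil divr1.
move=> [sAB] /andP[bB uB] /andP[a0 nA] /andP[b0 nB].
have [kp [IHs IHz]] := IH A sAB uB nA nB.
have inB x : x \in B -> x != b by move=> xB; apply/eqP => e; rewrite -e xB in bB.
have in0 x : x \in B -> x != 0 by move=> xB; exact: (allP nB).
have resb : res (a :: A) (b :: B) b =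
    (1 - a / b) * (kp + \sum_(x <- B) res A B x / (1 - x / b)).
  by rewrite /res /= eqxx -IHz// /rval big_cons mulrA.
have resx x : x \in B -> res (a :: A) (b :: B) x =
    (1 - a / x) / (1 - b / x) * res A B x.
  move=> xB; rewrite /res /= eq_sym (negPf (inB x xB)).
  by rewrite rval_cons.
have sumE (h : F -> F) : \sum_(x <- b :: B) res (a :: A) (b :: B) x * h x =
   (1 - a / b) * kp * h b +
   \sum_(x <- B) res A B x * ((b - a) / (b - x) * h b +
                              (x - a) / (x - b) * h x).
  rewrite big_cons resb mulrDr mulrDl -addrA; congr (_ + _).
  rewrite mulr_sumr mulr_suml big_seq [X in _ + X]big_seq -big_split /=.
  rewrite [RHS]big_seq; apply: eq_bigr => x xB; rewrite resx//.
  have /negPf xb := inB x xB; have x0 := in0 x xB.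
  by field; rewrite ?subr_eq0 ?[b == x]eq_sym ?xb ?x0 ?b0.
exists (a / b * kp); split=> [s|z z0].
  rewrite rser_cons; apply: num_eq => //; apply/funext => n.
  rewrite !psmul_num// IHs sumE.
  case: n => [|n].
    case: s {IHs}.
      rewrite !psone0 /pole_exp !expr0 !mulr1 addrA; congr (_ + _).
        by field.
      apply: eq_big_seq => x xB; have /negPf xb := inB x xB; have x0 := in0 x xB.
      by field; rewrite ?subr_eq0 ?[b == x]eq_sym ?xb ?x0 ?b0.
    rewrite !psone0 !mulr1 /pole_exp mulr0 add0r.
    rewrite big1 => [|x _]; last by rewrite mulr0.
    rewrite big1 => [|x _]; last by rewrite !mulr0 addr0 mulr0.
    by rewrite !addr0; field.
  rewrite !sumE psoneS !mulr0 !add0r.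
  have split_n (c2 c3 c4 : F) (f1 f2 f3 f4 : F -> F) :
     - c2 = c3 - c4 ->
     (forall x, x \in B -> f1 x - f2 x = f3 x - f4 x) ->
     (\sum_(x <- B) f1 x) - (c2 + \sum_(x <- B) f2 x) =
     (c3 + \sum_(x <- B) f3 x) - (c4 + \sum_(x <- B) f4 x).
    move=> e1 e2; rewrite !opprD addrCA [RHS]addrACA e1 -!sumrB; congr (_ + _).
    exact: eq_big_seq.
  case: s {IHs}; rewrite !(mulrDr _ (_ * _)) ?mulrDr ?mulr_sumr.
    rewrite [X in _ = _ - X]addrA; apply: split_n => [|x xB].
      by rewrite /pole_exp exprS; field.
    have /negPf xb := inB x xB; rewrite /pole_exp !exprS.
    by field; rewrite ?subr_eq0 ?[b == x]eq_sym ?xb ?b0.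
  rewrite [X in _ = _ - X]addrA; apply: split_n => [|x xB].
    by rewrite (pole_exp_falseS n b0); field.
  have /negPf xb := inB x xB; have x0 := in0 x xB.
  rewrite (pole_exp_falseS n b0) (pole_exp_falseS n x0).
  by field; rewrite ?subr_eq0 ?[b == x]eq_sym ?xb ?b0.
move=> zB; rewrite in_cons negb_or in zB; case/andP: zB => zb zB.
rewrite rval_cons IHz// (sumE (fun x => (1 - x / z)^-1)).
rewrite mulrDr addrA; congr (_ + _).
  by field; rewrite ?subr_eq0 ?zb ?b0 ?z0.
rewrite mulr_sumr; apply: eq_big_seq => x xB.
have /negPf xb := inB x xB; have x0 := in0 x xB.
have zx : z != x by apply: contraNneq zB => ->.
by field; rewrite ?subr_eq0 ?[b == x]eq_sym ?xb ?b0 ?z0 ?zx ?zb.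
Qed.

Lemma res_zero A B b : b != 0 -> b \in A -> res A B b = 0.
Proof.
move=> b0 bA; rewrite /res /rval (perm_big _ (perm_to_rem bA)) /= big_cons.
by rewrite mulfV// subrr !mul0r.
Qed.

(** The hypothesis says that a multiple pole is cancelled by zeros.  At a cancelled
    pole [res] is 0, whatever is left in the denominator, since the numerator
    vanishes; so the sum may run over all the poles.  Removing common entries of
    [A] and [B] reduces to simple poles, and the constant term of the
    decomposition disappears in the difference of the two expansions. *)
Lemma partial_fractions A B (n : int) : size A = size B ->
  all (predC1 0) A -> all (predC1 0) B ->
  (forall b, b \in B -> (count_mem b B <= maxn 1 (count_mem b A))%N) ->
  ext true (rser true A B) n - ext false (rser false A B) n =
  \sum_(b <- B) res A B b * b ^ n.
Proof.
move: {2}(size B) (leqnn (size B)) => m.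
elim: m A B => [|m IH] A B; last first.
  case hB : (has (mem A) B); last first.
    move=> _ sAB nA nB H.
    have uB : uniq B.
      apply: count_mem_uniq => b; case: (boolP (b \in B)) => [bB|/count_memPn//].
      have bA : b \notin A by apply: contraFN hB => bA; apply/hasP; exists b.
      have := H b bB; rewrite (count_memPn bA) => H1.
      by apply/eqP; rewrite eqn_leq H1 -has_count has_pred1.
    have [kp [Hs _]] := pf_distinct sAB uB nA nB.
    clear IH; rewrite /ext !Hs; case: n => [[|n]|n] /=.
    + rewrite opprD addrACA subrr add0r -sumrB; apply: eq_bigr => b _.
      by rewrite mulr0 subr0.
    + by rewrite psoneS mulr0 add0r subr0.
    + rewrite psoneS mulr0 !add0r -sumrN; apply: eq_bigr => b _.
      by rewrite mulrN opprK NegzE -exprnN exprVn.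
  move/hasP: hB => [b bB /= bA] szB sAB nA nB H.
  pose A' := rem b A; pose B' := rem b B.
  have pA : perm_eq A (b :: A') := perm_to_rem bA.
  have pB : perm_eq B (b :: B') := perm_to_rem bB.
  have b0 : b != 0 := allP nB b bB.
  have nA' : all (predC1 0) A'.
    by apply/allP => x /mem_rem; exact: (allP nA).
  have nB' : all (predC1 0) B'.
    by apply/allP => x /mem_rem; exact: (allP nB).
  have cA x : count_mem x A = ((b == x) + count_mem x A')%N.
    by rewrite (permP pA).
  have cB x : count_mem x B = ((b == x) + count_mem x B')%N.
    by rewrite (permP pB).
  have H' x : x \in B' -> (count_mem x B' <= maxn 1 (count_mem x A'))%N.
    move=> xB'; have := H x (mem_rem xB'); rewrite cA cB.
    move: (count_mem x A') (count_mem x B') => p q.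
    by case: (b == x); rewrite ?add0n// !add1n; lia.
  have dropE s : rser s A B = rser s A' B'.
    by rewrite (rser_perm s pA pB) rser_cons num_den// psmul1l.
  have szB' : (size B' <= m)%N by rewrite size_rem//; move: szB; case: (size B).
  have sAB' : size A' = size B' by rewrite !size_rem// sAB.
  rewrite !dropE IH //.
  rewrite (perm_big _ pB) /= big_cons res_zero// mul0r add0r.
  apply: eq_big_seq => x xB'; congr (_ * _).
  have x0 : x != 0 := allP nB' x xB'.
  rewrite (res_perm x pA pB); have [bx|xb] := eqVneq b x; last first.
    rewrite /res /= (negPf xb) rval_cons mulfV ?mul1r//.
    by rewrite sub1_div.
  (* [b] is still a pole: it was multiple, hence cancelled more than once. *)
  rewrite -bx in xB' *.
  rewrite [RHS]res_zero ?mem_head// res_zero//.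
    have := H b bB; rewrite cA cB eqxx -has_pred1 has_count.
    have : (0 < count_mem b B')%N by rewrite -has_count has_pred1.
    lia.
move=> szB sAB _ _ _.
have B0 : B = [::] by apply/nilP; rewrite /nilp -leqn0.
have A0 : A = [::] by apply/nilP; rewrite /nilp sAB B0.
rewrite A0 B0 big_nil /ext /rser !big_nil !psmul1l.
by case: n => [[|n]|n]; rewrite /= ?psone0 ?psoneS subrr.
Qed.

End PartialFractions.

(** * From the generators to the quotient algebra *)

Section LinearExtension.
Context (F : fieldType) (K : choiceType) (V : lmodType F).
Implicit Types (h : K -> V) (v w : {malg F[K]}).

Definition linext h v : V := \sum_(x <- msupp v) v@_x *: h x.

Lemma linextEw h v (d : {fset K}) : (msupp v `<=` d)%fset ->
  linext h v = \sum_(x <- d) v@_x *: h x.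
Proof.
move=> vd; rewrite /linext (big_fset_incl _ vd)// => x _ xv.
by rewrite (mcoeff_outdom xv) scale0r.
Qed.

Lemma linext_linear h : linear (linext h).
Proof.
move=> a v w; pose d := (msupp v `|` msupp w)%fset.
have vd : (msupp v `<=` d)%fset by exact: fsubsetUl.
have wd : (msupp w `<=` d)%fset by exact: fsubsetUr.
have avd : (msupp (a *: v + w) `<=` d)%fset.
  apply: fsubset_trans (msuppD_le _ _) _; apply: fsetSU; exact: msuppZ_le.
rewrite (linextEw h vd) (linextEw h wd) (linextEw h avd) scaler_sumr -big_split.
by apply: eq_bigr => x _; rewrite /= mcoeffD mcoeffZ scalerDl scalerA.
Qed.

Lemma linextU h x : linext h << x >> = h x.
Proof. by rewrite /linext msuppU oner_eq0 big_seq_fset1 mcoeffUU scale1r. Qed.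

Lemma malg_sumE v : v = \sum_(x <- msupp v) v@_x *: << x >>.
Proof.
rewrite [LHS]monalgE; apply: eq_bigr => x _.
by apply/malgP => y; rewrite mcoeffZ !mcoeffU mulrnAr mulr1.
Qed.

(** [linear] is used unbundled: the operators below are plain functions, so the
    library lemmas on bundled linear maps are restated in this form. *)
Lemma linearf0 (U : lmodType F) (f : U -> V) : linear f -> f 0 = 0.
Proof.
by move=> lf; have := lf (-1) 0 0; rewrite scaler0 addr0 scaleN1r addNr.
Qed.

Lemma linearfZ (U : lmodType F) (f : U -> V) a (v : U) : linear f ->
  f (a *: v) = a *: f v.
Proof. by move=> lf; have := lf a v 0; rewrite linearf0// !addr0. Qed.

Lemma linearfB (U : lmodType F) (f : U -> V) (v w : U) : linear f ->
  f (v - w) = f v - f w.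
Proof. by move=> lf; rewrite -scaleN1r addrC lf scaleN1r addrC. Qed.

Lemma linfun_sumZ (U : lmodType F) (f : U -> V) (I : Type) (s : seq I)
    (a : I -> F) (g : I -> U) : linear f ->
  f (\sum_(i <- s) a i *: g i) = \sum_(i <- s) a i *: f (g i).
Proof.
move=> lf; elim: s => [|i s IH]; last by rewrite !big_cons lf IH.
by rewrite !big_nil linearf0.
Qed.

Lemma linear_ext (f f' : {malg F[K]} -> V) : linear f -> linear f' ->
  (forall x, f << x >> = f' << x >>) -> f =1 f'.
Proof.
move=> lf lf' e v; rewrite (malg_sumE v) !linfun_sumZ//.
by apply: eq_bigr => x _; rewrite e.
Qed.

Lemma linext_funP (W : lmodType F) (h : W -> K -> V) v :
  (forall x, linear (h^~ x)) -> linear (fun w0 : W => linext (h w0) v).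
Proof.
move=> lh a w1 w2; rewrite /linext scaler_sumr -big_split; apply: eq_bigr => x _.
by rewrite lh scalerDr !scalerA mulrC.
Qed.

End LinearExtension.

Section FreeAction.
Context (F : fieldType) (V : lmodType F) (ga : egen -> V -> V).
Hypothesis ga_linear : forall x, linear (ga x).

Definition mon_act (m : {fmonom egen}) (v : V) : V := foldr ga v m.

Definition free_act (a : efree F) (v : V) : V := linext (mon_act^~ v) a.

Lemma mon_act_linear m : linear (mon_act m).
Proof.
rewrite /mon_act => a v w; elim: (m : seq egen) => [|x s IH] //=.
by rewrite IH ga_linear.
Qed.

Lemma free_act_linearl v : linear (free_act^~ v).
Proof. exact: linext_linear. Qed.

Lemma free_act_linearr a : linear (free_act a).
Proof. by apply: linext_funP => m; exact: mon_act_linear. Qed.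

Lemma free_act1 v : free_act 1 v = v.
Proof. by rewrite /free_act -mpolyC1E linextU /mon_act fm1. Qed.

Lemma free_actM a b v : free_act (a * b) v = free_act a (free_act b v).
Proof.
pose f1 (x : efree F) := free_act (x * b) v.
pose f2 (x : efree F) := free_act x (free_act b v).
suff : f1 =1 f2 by exact.
apply: linear_ext => [c x y|c x y|m]; rewrite /f1 /f2.
- by rewrite mulrDl -scalerAl free_act_linearl.
- by rewrite free_act_linearl.
pose h1 (y : efree F) := free_act (<< m >> * y) v.
pose h2 (y : efree F) := free_act << m >> (free_act y v).
suff : h1 =1 h2 by exact.
apply: linear_ext => [c x y|c x y|n]; rewrite /h1 /h2.
- by rewrite mulrDr -malg_scalerAr free_act_linearl.
- by rewrite free_act_linearl free_act_linearr.
rewrite malgM_def fgmulUU mulr1 /free_act !linextU /mon_act fmM.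
by rewrite foldr_cat.
Qed.

Lemma free_act_gen x v : free_act (fgen F x) v = ga x v.
Proof. by rewrite /free_act /fgen linextU /mon_act fmU. Qed.

End FreeAction.

Section QuotientAction.
Context (F : fieldType) (q1 q2 q3 : F) (V : lmodType F) (ga : egen -> V -> V).
Hypothesis ga_linear : forall x, linear (ga x).
Hypothesis ga_rel : forall x y, erel q1 q2 q3 x y ->
  forall v, free_act ga x v = free_act ga y v.

Let faM := free_actM ga_linear.

Lemma free_actB x y v : free_act ga (x - y) v = free_act ga x v - free_act ga y v.
Proof. exact: (linearfB _ _ (free_act_linearl ga v)). Qed.

Lemma free_actD x y v : free_act ga (x + y) v = free_act ga x v + free_act ga y v.
Proof. by have := free_act_linearl ga v 1 x y; rewrite !scale1r. Qed.

Lemma free_act_ideal z v : eideal q1 q2 q3 z -> free_act ga z v = 0.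
Proof.
have zeror x : free_act ga x 0 = 0 := linearf0 (free_act_linearr ga_linear x).
elim=> [|a x y b w xy _ IH]; first exact: (linearf0 (free_act_linearl ga v)).
rewrite free_actD IH addr0 !faM free_actB (ga_rel xy) subrr.
exact: zeror.
Qed.

(** Well defined on classes by [free_act_ideal]. *)
Definition quot_act (x : ealg q1 q2 q3) (v : V) : V := free_act ga (repr x) v.

Lemma quot_act_ecl x v : quot_act (ecl q1 q2 q3 x) v = free_act ga x v.
Proof.
apply/eqP; rewrite -subr_eq0 /quot_act -free_actB.
by apply/eqP; apply: free_act_ideal; exact: eclK.
Qed.

Lemma quot_act_module : is_module quot_act.
Proof.
split.
- move=> v a x y; rewrite -[x]ecl_repr -[y]ecl_repr.
  have -> : a *: ecl q1 q2 q3 (repr x) + ecl q1 q2 q3 (repr y) =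
     ecl q1 q2 q3 (a *: repr x + repr y) by rewrite eclD eclZ.
  by rewrite !quot_act_ecl (free_act_linearl ga).
- by move=> x; apply: free_act_linearr.
- by move=> v; rewrite [1]/(ecl q1 q2 q3 1) quot_act_ecl free_act1.
- move=> x y v; rewrite -[x]ecl_repr -[y]ecl_repr.
  have -> : ecl q1 q2 q3 (repr x) * ecl q1 q2 q3 (repr y) =
     ecl q1 q2 q3 (repr x * repr y) by rewrite eclM.
  by rewrite !quot_act_ecl faM.
Qed.

End QuotientAction.

(** * Moving rows of admissible sequences *)

Definition up (l : nat -> int) (i j : nat) : int := l j + (j == i)%:R.
Definition dn (l : nat -> int) (i j : nat) : int := l j - (j == i)%:R.

Lemma up_eq l i : up l i i = l i + 1.
Proof. by rewrite /up eqxx. Qed.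
Lemma up_neq l i j : j != i -> up l i j = l j.
Proof. by rewrite /up => /negPf->; rewrite addr0. Qed.
Lemma upC l i j : up (up l i) j = up (up l j) i.
Proof. by apply/funext => m; rewrite /up addrAC. Qed.
Lemma dnC l i j : dn (dn l i) j = dn (dn l j) i.
Proof. by apply/funext => m; rewrite /dn addrAC. Qed.
Lemma dn_up l i j : dn (up l i) j = up (dn l j) i.
Proof. by apply/funext => m; rewrite /dn /up addrAC. Qed.
Lemma dnK l i : up (dn l i) i = l.
Proof. by apply/funext => m; rewrite /dn /up subrK. Qed.

Section Rows.
Context (k r : nat).
Hypotheses (hk : (1 <= k)%N) (hr : (2 <= r)%N).
Implicit Types (l : nat -> int).

(** The conditions of S^{k,r,N} on the first [N] entries of an infinite sequence,
    so that finite and semi-infinite sequences share their coefficients. *)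
Definition adm (N : nat) l : Prop :=
  (forall j, (j.+1 < N)%N -> l j.+1 <= l j) /\
  (forall j, (j + k < N)%N -> r%:Z <= l j - l (j + k)%N).

Lemma adm_mono N l i j : adm N l -> (i <= j < N)%N -> l j <= l i.
Proof.
move=> [mono _] /andP[]; elim: j => [|j IH].
  by rewrite leqn0 => /eqP->.
rewrite leq_eqVlt => /orP[/eqP->//|ij jN].
by apply: le_trans (mono j jN) (IH _ _); rewrite // ltnW.
Qed.

Lemma adm_gap N l i j b : adm N l -> (i + k * b <= j)%N -> (j < N)%N ->
  r%:Z * b%:Z <= l i - l j.
Proof.
move=> al; elim: b i => [|b IH] i ij jN.
  by rewrite mulr0 subr_ge0 (adm_mono al)// jN andbT; lia.
have ik : (i + k + k * b <= j)%N by nia.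
have h1 := IH _ ik jN; have h2 := al.2 i (leq_ltn_trans (leq_trans (leq_addr _ _) ik) jN).
by rewrite -addn1 PoszD mulrDr mulr1; lia.
Qed.

Lemma adm_up N l i : adm N l ->
  ((0 < i)%N -> l i < l i.-1) -> ((k <= i)%N -> r%:Z < l (i - k)%N - l i) ->
  adm N (up l i).
Proof.
move=> [mono gap] h1 h2; split=> j jN; rewrite /up.
  have := mono j jN; case: (eqVneq j.+1 i) => [<-|ji] in h1 h2 *.
    by have := h1 isT; rewrite /=; case: eqP; lia.
  by case: eqP; lia.
have := gap j jN; case: (eqVneq (j + k)%N i) => [<-|ji] in h1 h2 *.
  have := h2 (leq_addl _ _); rewrite addnK.
  by case: eqP; lia.
by case: eqP; lia.
Qed.

End Rows.

Lemma lambda0_shift k r (c : seq int) j : (0 < k)%N ->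
  lambda0 k r c (j + k) = lambda0 k r c j - r%:Z.
Proof.
move=> k0; rewrite /lambda0; have -> : (j + k = 1 * k + j)%N by lia.
by rewrite divnMDl// modnMDl PoszD mulrDl mul1r; lia.
Qed.

(** In an iterated bracket [[e_0, [e_1, e_(-1)]]] the operator [e_n] contributes
    the [n]-th power of the point of the row that it moves; this is the
    resulting weight when the points of the three rows are, in the order in
    which the rows are moved, [x], [y] and [z]. *)
Definition serre_wt (F : fieldType) (x y z : F) : F :=
  y / x - x / y - z / y + y / z.

(** * Relations between families of row-moving operators *)

Section SymmetricSums.
Context (F : fieldType) (V : lmodType F) (N : nat).
Hypothesis six : 6%:R != 0 :> F.

Lemma two_neq0 : 2%:R != 0 :> F.
Proof. by move: six; rewrite (natrM F 2 3) mulf_eq0 negb_or => /andP[]. Qed.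

(** Summing over all pairs or triples of rows, instead of sorted ones, lets every
    relation be checked one unordered pair or triple at a time; undoing the
    symmetrisation costs a division by 2 or 6. *)
Lemma sum_sym2 (T : 'I_N -> 'I_N -> V) :
  (forall i j, T i j + T j i = 0) -> \sum_i \sum_j T i j = 0.
Proof.
move=> h; set S := \sum_i _.
have : S + S = 0.
  rewrite {2}/S exchange_big -big_split big1// => i _.
  by rewrite /= -big_split big1//= => j _; exact: h.
rewrite -mulr2n -scaler_nat => /eqP; rewrite scaler_eq0 (negPf two_neq0).
by move/eqP.
Qed.

Let sum3 (T : 'I_N -> 'I_N -> 'I_N -> V) := \sum_i \sum_j \sum_h T i j h.

Let sum3_swap12 T : sum3 (fun i j h => T j i h) = sum3 T.
Proof. exact: exchange_big. Qed.

Let sum3_swap23 T : sum3 (fun i j h => T i h j) = sum3 T.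
Proof. by apply: eq_bigr => i _; exact: exchange_big. Qed.

Let sum3D T T' : sum3 T + sum3 T' = sum3 (fun i j h => T i j h + T' i j h).
Proof.
rewrite /sum3 -big_split; apply: eq_bigr => i _ /=; rewrite -big_split.
by apply: eq_bigr => j _ /=; rewrite -big_split.
Qed.

Lemma sum_sym3 (T : 'I_N -> 'I_N -> 'I_N -> V) :
  (forall i j h, T i j h + T i h j + T j i h + T j h i + T h i j + T h j i = 0) ->
  \sum_i \sum_j \sum_h T i j h = 0.
Proof.
move=> z; rewrite -/(sum3 T).
have e1 : sum3 (fun i j h => T i h j) = sum3 T := sum3_swap23 T.
have e2 : sum3 (fun i j h => T j i h) = sum3 T := sum3_swap12 T.
have e3 : sum3 (fun i j h => T j h i) = sum3 T.
  by rewrite -e1 -[RHS]sum3_swap12.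
have e4 : sum3 (fun i j h => T h i j) = sum3 T.
  by rewrite -e2 -[RHS]sum3_swap23.
have e5 : sum3 (fun i j h => T h j i) = sum3 T.
  by rewrite -e4 -[RHS]sum3_swap12.
have : sum3 T *+ 6 = 0.
  rewrite !mulrS mulr0n addr0 -{2}e1 -{2}e2 -{2}e3 -{2}e4 -{2}e5 !sum3D.
  rewrite /sum3 big1// => i _; rewrite big1// => j _; rewrite big1// => h _.
  by rewrite !addrA.
rewrite -scaler_nat => /eqP; rewrite scaler_eq0 (negPf six).
by move/eqP.
Qed.

End SymmetricSums.

(** The common form of [e] and [f]: [act n] moves a row [i] with coefficient
    [wt l i * pp l i ^ n], and [good d l] allows [d] successive moves from [l]. *)
Section Step.
Context (F : fieldType) (V : lmodType F) (N : nat).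
Hypothesis six : 6%:R != 0 :> F.
Context (ket : (nat -> int) -> V) (C : F) (wt : (nat -> int) -> nat -> F)
  (mv : (nat -> int) -> nat -> (nat -> int)) (pp : (nat -> int) -> nat -> F)
  (act : int -> V -> V) (good : nat -> (nat -> int) -> Prop).
Hypothesis act_linear : forall n, linear (act n).
Hypothesis mvC : forall l i j, mv (mv l i) j = mv (mv l j) i.
Hypothesis pp_neq0 : forall l i, pp l i != 0.
Hypothesis pp_neq : forall l i j, j != i -> pp (mv l i) j = pp l j.
Hypothesis act_good : forall d l n, good d.+1 l ->
  act n (ket l) = C *: \sum_(i < N) (wt l i * pp l i ^ n) *: ket (mv l i).
Hypothesis step_good : forall d l i, good d.+1 l -> (i < N)%N ->
  wt l i != 0 -> good d (mv l i).

Lemma act_comp (f : V -> V) d l n : linear f -> good d.+1 l ->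
  f (act n (ket l)) = C *: \sum_(i < N) (wt l i * pp l i ^ n) *: f (ket (mv l i)).
Proof.
by move=> lf gl; rewrite (act_good _ gl) linearfZ// linfun_sumZ.
Qed.

Lemma act2 l m n : good 2 l -> act m (act n (ket l)) =
  C ^+ 2 *: \sum_(i < N) \sum_(j < N)
    (wt l i * wt (mv l i) j * (pp l i ^ n * pp (mv l i) j ^ m)) *:
    ket (mv (mv l i) j).
Proof.
move=> gl; rewrite (act_comp _ (act_linear m) gl) expr2 -scalerA; congr (_ *: _).
rewrite scaler_sumr; apply: eq_bigr => i _.
have [->|nz] := eqVneq (wt l i) 0.
  rewrite mul0r scale0r big1 ?scaler0// => j _.
  by rewrite !mul0r scale0r.
rewrite (act_good _ (step_good gl _ nz))// !scaler_sumr; apply: eq_bigr => j _.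
by rewrite !scalerA; congr (_ *: _); ring.
Qed.

Lemma act3 l p m n : good 3 l -> act p (act m (act n (ket l))) =
  C ^+ 3 *: \sum_(i < N) \sum_(j < N) \sum_(h < N)
    (wt l i * wt (mv l i) j * wt (mv (mv l i) j) h *
     (pp l i ^ n * pp (mv l i) j ^ m * pp (mv (mv l i) j) h ^ p)) *:
    ket (mv (mv (mv l i) j) h).
Proof.
move=> gl; have lf : linear (fun v => act p (act m v)).
  by move=> a v w; rewrite !act_linear.
rewrite (act_comp (f := fun v => act p (act m v)) _ lf gl) exprS -scalerA.
congr (_ *: _); rewrite scaler_sumr; apply: eq_bigr => i _.
have [->|nz] := eqVneq (wt l i) 0.
  rewrite mul0r scale0r big1 ?scaler0// => j _; rewrite big1// => h _.
  by rewrite !mul0r scale0r.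
rewrite (act2 _ _ (step_good gl _ nz))// !scaler_sumr; apply: eq_bigr => j _.
rewrite !scaler_sumr; apply: eq_bigr => h _.
by rewrite !scalerA; congr (_ *: _); ring.
Qed.

(** [G] stands for [g] with its arguments in one order or the other.  In the
    symmetrised sum the powers of the points factor out of the two orders of the
    moves [i] and [j], leaving the hypothesis. *)
Lemma quadratic_rel (gc : nat -> F) (ea eb : nat -> nat) l m n :
  let G x y := \sum_(a < 4) gc a * (x ^+ ea a * y ^+ eb a) in
  good 2 l ->
  (forall i j, (i < N)%N -> (j < N)%N ->
     (wt l i * wt (mv l i) j * G (pp (mv l i) j) (pp l i) +
      wt l j * wt (mv l j) i * G (pp (mv l j) i) (pp l j)) *:
     ket (mv (mv l i) j) = 0) ->
  \sum_(a < 4) gc a *: act (m + (ea a)%:Z) (act (n + (eb a)%:Z) (ket l)) +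
  \sum_(a < 4) gc a *: act (n + (ea a)%:Z) (act (m + (eb a)%:Z) (ket l)) = 0.
Proof.
move=> G gl ex.
have half m' n' : \sum_(a < 4) gc a *: act (m' + (ea a)%:Z) (act (n' + (eb a)%:Z) (ket l))
  = C ^+ 2 *: \sum_(i < N) \sum_(j < N)
    (wt l i * wt (mv l i) j * G (pp (mv l i) j) (pp l i) *
     (pp l i ^ n' * pp (mv l i) j ^ m')) *: ket (mv (mv l i) j).
  under eq_bigr => a _.
    rewrite (act2 _ _ gl) scalerA [gc a * _]mulrC -scalerA scaler_sumr; over.
  rewrite -scaler_sumr exchange_big /=; congr (_ *: _); apply: eq_bigr => i _.
  under eq_bigr do rewrite scaler_sumr.
  rewrite exchange_big /=; apply: eq_bigr => j _.
  under eq_bigr do rewrite scalerA.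
  rewrite -scaler_suml; congr (_ *: _).
  rewrite [_ * G _ _]mulrC mulr_suml mulr_suml; apply: eq_bigr => a _.
  by rewrite !expfzDr// -!exprnP; ring.
rewrite !half -scalerDr -big_split /=.
under eq_bigr => i _ do rewrite -big_split /=.
rewrite sum_sym2 ?scaler0// => i j; rewrite (mvC l j i) -!scalerDl.
set X := _ + _; rewrite (_ : X = (pp l i ^ n * pp (mv l i) j ^ m +
    pp l i ^ m * pp (mv l i) j ^ n) *
     (wt l i * wt (mv l i) j * G (pp (mv l i) j) (pp l i) +
      wt l j * wt (mv l j) i * G (pp (mv l j) i) (pp l j))).
  by rewrite -scalerA ex// scaler0.
rewrite /X {X}; case: (eqVneq i j) => [->|ij]; first by ring.
have -> : pp (mv l i) j = pp l j by rewrite pp_neq// eq_sym.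
have -> : pp (mv l j) i = pp l i by rewrite pp_neq.
by ring.
Qed.

Lemma cubic_rel l :
  let T i j h := wt l i * wt (mv l i) j * wt (mv (mv l i) j) h *
     serre_wt (pp l i) (pp (mv l i) j) (pp (mv (mv l i) j) h) in
  good 3 l ->
  (forall i j h, (i < N)%N -> (j < N)%N -> (h < N)%N ->
    (T i j h + T i h j + T j i h + T j h i + T h i j + T h j i) *:
    ket (mv (mv (mv l i) j) h) = 0) ->
  act 0 (act 1 (act (-1) (ket l))) - act 0 (act (-1) (act 1 (ket l)))
  - act 1 (act (-1) (act 0 (ket l))) + act (-1) (act 1 (act 0 (ket l))) = 0.
Proof.
move=> T gl ex; rewrite !(act3 _ _ _ gl) -!scalerBr -scalerDr -!sumrB -big_split.
under eq_bigr => i _.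
  rewrite -!sumrB -big_split; under eq_bigr => j _.
    rewrite -!sumrB -big_split; under eq_bigr => h _.
      rewrite /= -!scalerBl -scalerDl.
      rewrite (_ : _ - _ - _ + _ = T i j h); last first.
        by rewrite /T /serre_wt !exprN1 !expr1z !expr0z; ring.
      over.
    over.
  over.
rewrite /= sum_sym3 ?scaler0// => i j h.
rewrite (mvC (mv l i) h j) (mvC l j i) (mvC (mv l j) h i) (mvC l j i).
rewrite (mvC l h i) (mvC (mv l i) h j) (mvC (mv l h) j i) (mvC l h i).
by rewrite (mvC (mv l i) h j) -!scalerDl ex.
Qed.

End Step.

Section DiagonalRelation.
Context (F : fieldType) (V : lmodType F) (N : nat).
Context (ket : (nat -> int) -> V) (C : F) (wt : (nat -> int) -> nat -> F)
  (mv : (nat -> int) -> nat -> (nat -> int)) (pp : (nat -> int) -> nat -> F)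
  (act diag : int -> V -> V) (ev : (nat -> int) -> int -> F) (l : nat -> int).
Hypothesis act_linear : forall n, linear (act n).
Hypothesis diag_linear : forall n, linear (diag n).
Hypothesis pp_neq0 : forall i, pp l i != 0.
Hypothesis act_ket : forall n,
  act n (ket l) = C *: \sum_(i < N) (wt l i * pp l i ^ n) *: ket (mv l i).
Hypothesis diag_ket : forall n, diag n (ket l) = ev l n *: ket l.
Hypothesis diag_step : forall i n, (i < N)%N -> wt l i != 0 ->
  diag n (ket (mv l i)) = ev (mv l i) n *: ket (mv l i).

(** On basis vectors [diag] is a scalar series, so that the relation compares the
    series before and after each single move. *)
Lemma diagonal_rel (gc : nat -> F) (ea eb : nat -> nat) m n :
  (forall i, (i < N)%N ->
   \sum_(a < 4) gc a * (pp l i ^+ eb a * ev (mv l i) (m + (ea a)%:Z)) =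
   - \sum_(a < 4) gc a * (pp l i ^+ ea a * ev l (m + (eb a)%:Z))) ->
  \sum_(a < 4) gc a *: diag (m + (ea a)%:Z) (act (n + (eb a)%:Z) (ket l)) +
  \sum_(a < 4) gc a *: act (n + (ea a)%:Z) (diag (m + (eb a)%:Z) (ket l)) = 0.
Proof.
move=> ex.
have h1 i j : diag i (act j (ket l)) =
    C *: \sum_(h < N) (wt l h * (pp l h ^ j * ev (mv l h) i)) *: ket (mv l h).
  rewrite act_ket linearfZ// linfun_sumZ//; congr (_ *: _).
  apply: eq_bigr => h _; have [->|nz] := eqVneq (wt l h) 0.
    by rewrite !mul0r !scale0r.
  by rewrite diag_step// scalerA mulrA.
have h2 i j : act j (diag i (ket l)) =
    C *: \sum_(h < N) (wt l h * (pp l h ^ j * ev l i)) *: ket (mv l h).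
  rewrite diag_ket linearfZ// act_ket scalerA mulrC -scalerA; congr (_ *: _).
  by rewrite scaler_sumr; apply: eq_bigr => h _; rewrite scalerA; congr (_ *: _); ring.
under eq_bigr => a _ do rewrite h1 scalerA [_ * C]mulrC -scalerA scaler_sumr.
under [X in _ + X]eq_bigr => a _
  do rewrite h2 scalerA [_ * C]mulrC -scalerA scaler_sumr.
rewrite -!scaler_sumr -scalerDr.
rewrite exchange_big [X in _ + X]exchange_big /= -big_split big1 ?scaler0// => h _ /=.
under eq_bigr => a _ do rewrite scalerA.
under [X in _ + X]eq_bigr => a _ do rewrite scalerA.
rewrite /= -!scaler_suml -scalerDl (_ : _ + _ = 0) ?scale0r//.
apply/eqP; rewrite addr_eq0; apply/eqP.
transitivity (wt l h * pp l h ^ n * \sum_(a < 4) gc a *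
    (pp l h ^+ eb a * ev (mv l h) (m + (ea a)%:Z))).
  rewrite mulr_sumr; apply: eq_bigr => a _.
  by rewrite expfzDr// -exprnP; ring.
rewrite ex// mulrN; congr (- _); rewrite mulr_sumr; apply: eq_bigr => a _.
by rewrite expfzDr// -exprnP; ring.
Qed.

End DiagonalRelation.

Section MixedRelation.
Context (F : fieldType) (V : lmodType F) (N : nat).
Context (ket : (nat -> int) -> V) (Ce Cf : F) (E G : (nat -> int) -> nat -> F)
  (X Y : (nat -> int) -> nat -> F) (ea fa : int -> V -> V)
  (good : nat -> (nat -> int) -> Prop).
Hypothesis ea_linear : forall n, linear (ea n).
Hypothesis fa_linear : forall n, linear (fa n).
Hypothesis ea_good : forall d l n, good d.+1 l ->
  ea n (ket l) = Ce *: \sum_(i < N) (E l i * X l i ^ n) *: ket (up l i).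
Hypothesis fa_good : forall d l n, good d.+1 l ->
  fa n (ket l) = Cf *: \sum_(i < N) (G l i * Y l i ^ n) *: ket (dn l i).
Hypothesis up_good : forall d l i, good d.+1 l -> (i < N)%N -> E l i != 0 ->
  good d (up l i).
Hypothesis dn_good : forall d l i, good d.+1 l -> (i < N)%N -> G l i != 0 ->
  good d (dn l i).
Hypothesis X_neq : forall l i j, j != i -> X (dn l i) j = X l j.
Hypothesis Y_neq : forall l i j, j != i -> Y (up l i) j = Y l j.
Hypothesis mixed : forall l i j, (i < N)%N -> (j < N)%N -> i != j ->
  G l i * E (dn l i) j = E l j * G (up l j) i.

(** The terms that move two distinct rows cancel because the two moves commute,
    coefficients included; the terms that move the same row up and down remain. *)
Lemma mixed_rel l m n : good 2 l ->
  ea m (fa n (ket l)) - fa n (ea m (ket l)) = (Ce * Cf * \sum_(i < N)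
    (E (dn l i) i * G l i * (X (dn l i) i ^ m * Y l i ^ n) -
     E l i * G (up l i) i * (X l i ^ m * Y (up l i) i ^ n))) *: ket l.
Proof.
move=> gl.
have h1 : ea m (fa n (ket l)) = (Ce * Cf) *: \sum_(i < N) \sum_(j < N)
   (G l i * E (dn l i) j * (X (dn l i) j ^ m * Y l i ^ n)) *: ket (up (dn l i) j).
  rewrite (fa_good _ gl) linearfZ// linfun_sumZ// [Ce * Cf]mulrC -scalerA.
  congr (_ *: _); rewrite scaler_sumr; apply: eq_bigr => i _.
  have [->|nz] := eqVneq (G l i) 0.
    rewrite mul0r scale0r big1 ?scaler0// => j _.
    by rewrite !mul0r scale0r.
  rewrite (ea_good _ (dn_good gl _ nz))// !scaler_sumr; apply: eq_bigr => j _.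
  by rewrite !scalerA; congr (_ *: _); ring.
have h2 : fa n (ea m (ket l)) = (Ce * Cf) *: \sum_(i < N) \sum_(j < N)
   (E l j * G (up l j) i * (X l j ^ m * Y (up l j) i ^ n)) *: ket (up (dn l i) j).
  rewrite exchange_big (ea_good _ gl) linearfZ// linfun_sumZ// -scalerA.
  congr (_ *: _); rewrite scaler_sumr; apply: eq_bigr => j _ /=.
  have [->|nz] := eqVneq (E l j) 0.
    rewrite mul0r scale0r big1 ?scaler0// => i _.
    by rewrite !mul0r scale0r.
  rewrite (fa_good _ (up_good gl _ nz))// !scaler_sumr; apply: eq_bigr => i _.
  by rewrite dn_up !scalerA; congr (_ *: _); ring.
rewrite h1 h2 -scalerBr -scalerA -sumrB scaler_suml; congr (_ *: _).
apply: eq_bigr => i _; rewrite -sumrB (bigD1 i)//= dnK -scalerBl.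
rewrite [G l i * _]mulrC big1 ?addr0// => j ji.
have ij : i != j :> nat by rewrite eq_sym.
by rewrite mixed// X_neq// Y_neq// subrr.
Qed.

End MixedRelation.

(** * The points of an admissible sequence *)

Record resonant (F : fieldType) (k r : nat) (q1 q2 q3 : F) : Prop := Resonant {
  k_gt0 : (1 <= k)%N;
  r_gt1 : (2 <= r)%N;
  q1_neq0 : q1 != 0;
  q2_neq0 : q2 != 0;
  q3_neq0 : q3 != 0;
  q_prod : q1 * q2 * q3 = 1;
  q_res : q1 ^ (1 - r%:Z) * q3 ^ (k%:Z + 1) = 1;
  q_gen : forall n m : int, q1 ^ n * q3 ^ m = 1 ->
    exists a : int, n = (1 - r%:Z) * a /\ m = (k%:Z + 1) * a }.

Section SemiInfiniteModule.
Context (F : fieldType) (k r : nat) (cs : seq int) (q1 q2 q3 u : F).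
Hypothesis H : resonant k r q1 q2 q3.
Hypothesis hu : u != 0.
Hypothesis six : 6%:R != 0 :> F.
Let hk : (1 <= k)%N := k_gt0 H.
Let hr : (2 <= r)%N := r_gt1 H.
Let hq1 : q1 != 0 := q1_neq0 H.
Let hq2 : q2 != 0 := q2_neq0 H.
Let hq3 : q3 != 0 := q3_neq0 H.
Let hq : q1 * q2 * q3 = 1 := q_prod H.
Let hres : q1 ^ (1 - r%:Z) * q3 ^ (k%:Z + 1) = 1 := q_res H.
Let hgen := q_gen H.
Implicit Types (l : nat -> int) (W : F -> F).

Local Notation adm := (adm k r).
Local Notation g := (g q1 q2 q3).
Local Notation l0 := (lambda0 k r cs).
Local Notation V := (inf_space F k r cs).
Local Notation ket := (@inf_ket F k r cs).
Local Notation inf := (in_inf k r cs).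
Local Notation embed := (@embed F k r cs).
Local Notation in_plus := (@in_plus F k r cs).

(** Up to the factor [u], the support of the delta function with which [e] raises
    the row [i]. *)
Definition pt l (i : nat) : F := q1 ^ (l i) * q3 ^ i%:Z.

Lemma pt_neq0 l i : pt l i != 0.
Proof. by rewrite mulf_neq0// expfz_neq0. Qed.
Let pt0 := pt_neq0.

Lemma pt_ext l l' i : l i = l' i -> pt l i = pt l' i.
Proof. by rewrite /pt => ->. Qed.

Lemma pt_up_eq l i : pt (up l i) i = q1 * pt l i.
Proof. by rewrite /pt up_eq addrC expfzDr// expr1z mulrA. Qed.

Lemma pt_up_neq l i j : j != i -> pt (up l i) j = pt l j.
Proof. by move=> ji; apply: pt_ext; rewrite up_neq. Qed.

Lemma pt_dn_eq l i : pt (dn l i) i = pt l i / q1.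
Proof. by rewrite -[in RHS](dnK l i) pt_up_eq mulrC mulKf. Qed.

(** By genericity the exponents lie on the resonance line, at a multiple [- b] of
    its generator; [b] is then also the number of gap conditions available between
    the rows [i] and [j], which bounds [b] by [p]. *)
Lemma pt_coincidence N l i j (p s : int) : adm N l -> (i <= j < N)%N ->
  -1 <= s <= 1 -> q1 ^ p * q3 ^ s * pt l j = pt l i ->
  exists b : nat, [/\ j%:Z - i%:Z = (k%:Z + 1) * b%:Z - s,
    l i - l j = p + (r%:Z - 1) * b%:Z & b%:Z <= p].
Proof.
move=> al /andP[ij jN] /andP[s1 s2] e.
have : q1 ^ (l i - l j - p) * q3 ^ (i%:Z - j%:Z - s) = 1.
  rewrite !expfzDr//; move: e; rewrite /pt => e.
  rewrite -!invr_expz.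
  have -> : q1 ^ l i / q1 ^ l j / q1 ^ p * (q3 ^ i / q3 ^ j / q3 ^ s) =
     (q1 ^ l i * q3 ^ i) / (q1 ^ p * q3 ^ s * (q1 ^ l j * q3 ^ j)).
    by rewrite !invfM; ring.
  by rewrite e mulfV// mulf_neq0// expfz_neq0.
move=> /hgen[a [e1 e2]].
have a0 : a <= 0 by nia.
have [b eb] : exists b : nat, a = - b%:Z by exists `|a|%N; lia.
subst a; exists b.
have b1 : s <= b%:Z by case: b e1 e2 a0 => [|b] *; lia.
have gap h := @adm_gap k r hk hr N l i j b al h jN.
have : (i + k * b <= j)%N by nia.
by move=> /gap {}gap; split; nia.
Qed.

(** * Raising coefficients and their exchange relation *)

(** The contribution of a pair of rows to a coefficient, at the ratio of their
    points. *)
Definition phi (X : F) : F :=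
  ((1 - X / q3) * (1 - q1 * q3 * X)) / ((1 - X) * (1 - q1 * X)).

Definition ecf l i : F := \prod_(j < i) phi (pt l i / pt l j).

Lemma q2E : q2 = (q1 * q3)^-1.
Proof.
have := hq; rewrite mulrAC => h; apply: (mulfI (mulf_neq0 hq1 hq3)).
by rewrite h mulfV// mulf_neq0.
Qed.

Lemma g_hom a z w : g (a * z) (a * w) = a ^+ 3 * g z w.
Proof. by rewrite /Defs.g; ring. Qed.

Lemma g_inv z w : z != 0 -> w != 0 -> g z^-1 w^-1 = g w z / (z * w) ^+ 3.
Proof. by move=> z0 w0; rewrite /Defs.g; field; rewrite z0 w0. Qed.

Lemma g_q1 z : g (q1 * z) z = 0.
Proof. by rewrite /Defs.g subrr !mul0r. Qed.

Definition phiK (X : F) : F := q1 / ((X - q1) * (1 - X) * (1 - q1 * X)).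

(** Together with [phiE'], the source of all the exchange relations: shifting a row
    exchanges the arguments of [g] and preserves [phiK].  Where a denominator
    other than the excluded one vanishes, both sides are 0. *)
Lemma phiE X : X != q1 -> phi X = phiK X * g X 1.
Proof.
rewrite -subr_eq0 => X1; rewrite /phi /phiK /Defs.g q2E !mulr1.
have [->|X2] := eqVneq (1 - X) 0; first by rewrite !(mul0r, mulr0, invr0).
have [->|X3] := eqVneq (1 - q1 * X) 0; first by rewrite !(mul0r, mulr0, invr0).
by field; rewrite X1 X2 X3 hq1 hq3.
Qed.

Lemma phiE' X : 1 - q1 * X != 0 -> phi (X / q1) = - phiK X * g 1 X.
Proof.
move=> X3; rewrite /phi /phiK /Defs.g q2E.
have -> : 1 - X / q1 = (X - q1) * - q1^-1 by field.
have -> : q1 * (X / q1) = X by field.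
have [->|X1] := eqVneq (X - q1) 0; first by rewrite !(mul0r, mulr0, invr0, oppr0).
have [->|X2] := eqVneq (1 - X) 0; first by rewrite !(mul0r, mulr0, invr0, oppr0).
by field; rewrite X1 X2 X3 hq1 hq3 oppr_eq0 oner_eq0.
Qed.

Lemma ecf_local l l' i : (forall m, (m <= i)%N -> l' m = l m) -> ecf l' i = ecf l i.
Proof.
move=> e; apply: eq_bigr => j _.
by rewrite !(pt_ext (l := l') (l' := l))// e// ltnW.
Qed.

(** Isolates the dependence on the row [j]: the factor [R] is common to all the
    sequences obtained by moving that row. *)
Lemma ecf_split1 l i j : (j < i)%N -> exists R, forall l',
  (forall m, (m <= i)%N -> m != j -> l' m = l m) ->
  ecf l' i = phi (pt l i / pt l' j) * R.
Proof.
move=> ji; exists (\prod_(m < i | m != Ordinal ji) phi (pt l i / pt l m)).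
move=> l' e; rewrite /ecf (bigD1 (Ordinal ji))//=.
have ij : i != j by rewrite gtn_eqF.
rewrite (pt_ext (l := l') (l' := l) (i := i)) ?e//; congr (_ * _).
apply: eq_bigr => m mj; rewrite (pt_ext (l := l') (l' := l) (i := m))// e//.
by rewrite ltnW.
Qed.

Lemma ecf_split2 l i j h : (j < i)%N -> (h < i)%N -> h != j ->
  exists R, forall l',
  (forall m, (m <= i)%N -> m != j -> m != h -> l' m = l m) ->
  ecf l' i = phi (pt l i / pt l' j) * phi (pt l i / pt l' h) * R.
Proof.
move=> ji hi hj.
exists (\prod_(m < i | (m != Ordinal ji) && (m != Ordinal hi))
   phi (pt l i / pt l m)).
move=> l' e; rewrite /ecf (bigD1 (Ordinal ji))//= (bigD1 (Ordinal hi))//=.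
have ij : i != j by rewrite gtn_eqF.
have ih : i != h by rewrite gtn_eqF.
rewrite (pt_ext (l := l') (l' := l) (i := i)) ?e// !mulrA; congr (_ * _).
apply: eq_bigr => m /andP[mj mh].
by rewrite (pt_ext (l := l') (l' := l) (i := m))// e// ltnW.
Qed.

Lemma ecf_eq0_mono l i : l i.+1 = l i -> ecf l i.+1 = 0.
Proof.
move=> e; apply/eqP; rewrite prodf_seq_eq0; apply/hasP; exists ord_max.
  by rewrite mem_index_enum.
rewrite /= /phi; have -> : pt l i.+1 / pt l i = q3.
  rewrite /pt e intS expfzDr// expr1z.
  by field; rewrite !expfz_neq0.
by rewrite mulfV// subrr !mul0r.
Qed.

(** The resonance condition in the form in which it is used. *)
Lemma pt_shift l i : l (i + k)%N = l i - r%:Z -> pt l (i + k)%N = q2 * pt l i.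
Proof.
move=> e; rewrite q2E.
have : q1 * q3 * pt l (i + k)%N =
   (q1 ^ (1 - r%:Z) * q3 ^ (k%:Z + 1)) * pt l i.
  by rewrite /pt e PoszD !expfzDr// !expr1z; ring.
by rewrite hres mul1r => <-; rewrite mulKf// mulf_neq0.
Qed.

Lemma ecf_eq0_gap l i : (k <= i)%N -> l (i - k)%N - l i = r%:Z -> ecf l i = 0.
Proof.
move=> ki e; have ii : (i - k < i)%N by lia.
apply/eqP; rewrite prodf_seq_eq0; apply/hasP; exists (Ordinal ii).
  by rewrite mem_index_enum.
have h : pt l i = q2 * pt l (i - k)%N.
  by rewrite -{1}(subnK ki) pt_shift// subnK//; lia.
rewrite /= /phi h mulfK// [q1 * q3 * q2]mulrAC hq subrr.
by rewrite mulr0 mul0r.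
Qed.

(** A raising that breaks monotonicity has a pair of rows with ratio [q3]; one that
    breaks the gap condition has a pair with ratio [q2], by [pt_shift].  Both are
    roots of the numerator of [phi], so the vectors to be omitted from the
    formula for [e] have coefficient 0. *)
Lemma ecf_adm N l i : adm N l -> (i < N)%N -> ecf l i != 0 ->
  ((0 < i)%N -> l i < l i.-1) /\ ((k <= i)%N -> r%:Z < l (i - k)%N - l i).
Proof.
move=> [mono gap] iN nz; split=> hi; rewrite lt_neqAle; apply/andP; split.
- case: i hi nz {iN} => // i _ nz; apply: contraNneq nz => e.
  by rewrite ecf_eq0_mono.
- by case: i hi iN {nz} => // i _ iN; exact: mono.
- by apply: contraNneq nz => e; rewrite ecf_eq0_gap.
- by have := gap (i - k)%N; rewrite subnK//; exact.
Qed.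

(** Here [m] is the target of moves that raise the row [j] at least [p] times.  A
    coincidence would put the row [j.-1] at least [b] gap conditions below the row
    [i], with [b > 0], and then [m] could not be monotone at [j]. *)
Lemma pt_far N l (m : nat -> int) i j (p : int) : adm N l -> adm N m -> (i < j < N)%N ->
  (j.-1 != i -> m j.-1 = l j.-1) -> p <= m j - l j ->
  q1 ^ p * pt l j != pt l i.
Proof.
move=> al am /andP[ij jN] e pm; apply/eqP => h.
have [|||b [e1 e2 bp]] :=
  pt_coincidence al (i := i) (j := j) (p := p) (s := 0) => //.
- by rewrite ltnW.
- by rewrite expr0z mulr1.
have jj : (j.-1 < N)%N by lia.
have b0 : (0 < b)%N by case: b e1 {e2 bp} => // e1; lia.
have ji : j.-1 != i by apply/eqP => ji; nia.
have ib : (i + k * b <= j.-1)%N by nia.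
have gap := adm_gap hk hr al ib jj.
have := am.1 j.-1; rewrite prednK ?(leq_trans _ ij)//.
by rewrite e// => /(_ jN); nia.
Qed.

Lemma pt_near N l i j (p : int) : adm N l -> (i < j < N)%N -> p <= 0 ->
  q1 ^ p * pt l j != pt l i.
Proof. by move=> al ij p0; apply: (pt_far al al ij); rewrite ?subrr. Qed.

Lemma ratio_neq (p : int) l i j : q1 ^ p * pt l j != pt l i ->
  1 - q1 ^ p * (pt l j / pt l i) != 0.
Proof.
by move=> h; rewrite [_ * (_ / _)]mulrA sub1_div.
Qed.

Lemma phi_ratio l i j : q1 ^ (-1) * pt l j != pt l i ->
  phi (pt l j / pt l i) =
    phiK (pt l j / pt l i) / pt l i ^+ 3 * g (pt l j) (pt l i).
Proof.
move=> h; rewrite phiE.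
  have := g_hom (pt l i)^-1 (pt l j) (pt l i).
  by rewrite mulVf// [_^-1 * _]mulrC => ->; rewrite exprVn mulrA.
apply: contraNneq h => h.
by rewrite -[pt l j](divfK (pt0 l i)) h exprN1 mulKf.
Qed.

Lemma phi_ratio' l i j : q1 ^ 1 * pt l j != pt l i ->
  phi (pt l j / (q1 * pt l i)) =
    - (phiK (pt l j / pt l i) / pt l i ^+ 3 * g (pt l i) (pt l j)).
Proof.
move=> h; rewrite invfM mulrCA mulrC (phiE').
  have := g_hom (pt l i)^-1 (pt l i) (pt l j).
  rewrite mulVf// [(pt l i)^-1 * pt l j]mulrC => ->.
  by rewrite exprVn mulNr mulrA.
by have := ratio_neq h; rewrite expr1z.
Qed.

Lemma up2_neq l (i j m : nat) : m != i -> m != j -> up (up l i) j m = l m.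
Proof. by move=> mi mj; rewrite !up_neq. Qed.

Lemma ecf_up_lt l i j : (j < i)%N -> ecf (up l i) j = ecf l j.
Proof.
by move=> ji; apply: ecf_local => m mj; rewrite up_neq// ltn_eqF// (leq_ltn_trans mj).
Qed.

(** For [j < i] the row [j] is insensitive to the row [i], and only the factor of the
    pair in the coefficient of [i] depends on the order of the moves. *)
Lemma exchange_lt N l i j : adm N l -> adm N (up (up l i) j) ->
  (j < i < N)%N ->
  ecf l i * ecf (up l i) j * g (pt l j) (pt l i) +
  ecf l j * ecf (up l j) i * g (pt l i) (pt l j) = 0.
Proof.
move=> al am jiN; have /andP[ji iN] := jiN.
have ij : i != j by rewrite gtn_eqF.
have far : q1 ^ 1 * pt l i != pt l j.
  apply: (pt_far al am jiN) => [h|].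
    by rewrite up2_neq// ltn_eqF// ltn_predL (leq_ltn_trans _ ji).
  by rewrite up_neq// up_eq; lia.
have near : q1 ^ (-1) * pt l i != pt l j by apply: (pt_near al jiN).
have [R hR] := ecf_split1 l ji.
rewrite (hR l)// (hR (up l j)) => [|m _ mj]; last by rewrite up_neq.
rewrite ecf_up_lt// pt_up_eq// phi_ratio// phi_ratio'//.
by ring.
Qed.

Lemma exchange N l i j : adm N l -> adm N (up (up l i) j) ->
  i != j -> (i < N)%N -> (j < N)%N ->
  ecf l i * ecf (up l i) j * g (pt l j) (pt l i) +
  ecf l j * ecf (up l j) i * g (pt l i) (pt l j) = 0.
Proof.
move=> al am ij iN jN; case: (ltngtP i j) => [lt_ij|lt_ji|e].
- rewrite addrC; apply: (@exchange_lt N) => //; first by rewrite upC.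
  by rewrite lt_ij.
- by apply: (exchange_lt al am); rewrite lt_ji.
- by rewrite e eqxx in ij.
Qed.

(** * The Serre relation for the raising coefficients *)

(** The symmetrisation over the six orders of the Serre weight times the products of
    values of [g] which those orders produce. *)
Lemma serre_poly a b c : a != 0 -> b != 0 -> c != 0 ->
  g a b * g a c * g b c * serre_wt a b c
  - g a b * g a c * g c b * serre_wt a c b
  - g b a * g a c * g b c * serre_wt b a c
  + g b a * g b c * g c a * serre_wt b c a
  + g a b * g c a * g c b * serre_wt c a b
  - g b a * g c a * g c b * serre_wt c b a = 0.
Proof.
pose s1 := q1 + q2 + q3; pose s2 := q1 * q2 + q1 * q3 + q2 * q3.
(* Once [q1 * q2 * q3 = 1], [g] depends on the [q]s through [s1] and [s2] only. *)
have gE z w : g z w = z ^+ 3 - s1 * z ^+ 2 * w + s2 * z * w ^+ 2 - w ^+ 3.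
  have -> : w ^+ 3 = q1 * q2 * q3 * w ^+ 3 by rewrite hq mul1r.
  by rewrite /s1 /s2 /Defs.g; ring.
move=> a0 b0 c0; rewrite !gE; move: s1 s2 {gE} => s1 s2; rewrite /serre_wt.
by field; rewrite a0 b0 c0.
Qed.

Ltac upl := intros; rewrite /up; repeat case: eqP => ?; lia.

(** [W] is a weight that depends on the points alone: it will account for [beta] in
    the lowering operators. *)
Definition serre_term W l i j h : F :=
  let a := pt l i in let b := pt (up l i) j in let c := pt (up (up l i) j) h in
  W a * W b * W c * (ecf l i * ecf (up l i) j * ecf (up (up l i) j) h) *
  serre_wt a b c.

Definition serre_sum W l i j h : F :=
  serre_term W l i j h + serre_term W l i h j + serre_term W l j i h +
  serre_term W l j h i + serre_term W l h i j + serre_term W l h j i.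

Lemma serre_termE W l i j h : i != j -> j != h -> i != h ->
  serre_term W l i j h = W (pt l i) * W (pt l j) * W (pt l h) *
    (ecf l i * ecf (up l i) j * ecf (up (up l i) j) h) *
    serre_wt (pt l i) (pt l j) (pt l h).
Proof.
move=> ij jh ih; rewrite /serre_term pt_up_neq 1?eq_sym// !pt_up_neq//.
  by rewrite eq_sym.
by rewrite eq_sym.
Qed.

(** [pt_far] does not cover the case where the row just above [h] is the middle row
    [j], which moves too.  Then a coincidence forces [h = i + k.+1] and
    [l i - l h = r], contradicting the gap conditions of [l] between [i], [j] and
    [h] if [k = 1], and that of the target between [i.+1] and [h] otherwise. *)
Lemma pt_far3 N l i j h : adm N l -> adm N (up (up (up l i) j) h) ->
  (i < j)%N -> (j < h < N)%N -> q1 ^ 1 * pt l h != pt l i.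
Proof.
move=> al am ij /andP[jh hN].
have ih : (i < h)%N := ltn_trans ij jh.
have hi : h != i by rewrite gtn_eqF.
have hj : h != j by rewrite gtn_eqF.
have [jE|jh1] := eqVneq j h.-1; last first.
  apply: (pt_far al am (N := N)); first by rewrite ih.
    by move=> hi1; rewrite !up_neq// 1?eq_sym//; lia.
  by rewrite up_eq !up_neq//; lia.
apply/eqP => e.
have [|||b [e1 e2 b1]] :=
  pt_coincidence al (i := i) (j := h) (p := 1) (s := 0) => //.
- by rewrite ltnW.
- by rewrite expr0z mulr1.
have {b1 e1 e2} [e1 e2] : h = (i + k.+1)%N /\ l i - l h = r%:Z.
  by case: b e1 e2 b1 => [|[|b]] e1 e2 b1; split; lia.
have [k1|k1] := eqVneq k 1%N.
  have g1 := al.2 i; have g2 := al.2 j; move: g1 g2.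
  have -> : (i + k = j)%N by lia.
  have -> : (j + k = h)%N by lia.
  by move=> /(_ (ltn_trans jh hN)) g1 /(_ hN) g2; lia.
have g1 := am.2 i.+1; move: g1.
have -> : (i.+1 + k = h)%N by lia.
move=> /(_ hN); rewrite up_eq !(up_neq _ (j := h))// up_neq; last by lia.
rewrite up_neq; last by lia.
rewrite up_neq; last by lia.
have := al.1 i; lia.
Qed.

(** Each of the six orders chooses, for each pair of rows, between the two values
    of [phi] given by [phiE] and [phiE']; the common factors come out and leave
    [serre_poly]. *)
Lemma serre_lt W N l i j h : adm N l -> adm N (up (up (up l i) j) h) ->
  (i < j)%N -> (j < h < N)%N -> serre_sum W l i j h = 0.
Proof.
move=> al am ij jhN; have /andP[jh hN] := jhN.
have ih : (i < h)%N := ltn_trans ij jh.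
have ijN : (i < j < N)%N by rewrite ij ltnW// (leq_ltn_trans _ hN).
have ihN : (i < h < N)%N by rewrite ih.
have farij : q1 ^ 1 * pt l j != pt l i.
  apply: (pt_far al am ijN) => [h1|].
    by rewrite !up_neq//; lia.
  by rewrite (up_neq _ (i := h)) ?up_eq ?up_neq//; lia.
have farih : q1 ^ 1 * pt l h != pt l i by apply: (pt_far3 al am).
have farjh : q1 ^ 1 * pt l h != pt l j.
  apply: (pt_far al am jhN) => [h1|].
    by rewrite !up_neq//; lia.
  by rewrite up_eq !up_neq//; lia.
have nearij : q1 ^ (-1) * pt l j != pt l i by apply: (pt_near al ijN).
have nearih : q1 ^ (-1) * pt l h != pt l i by apply: (pt_near al ihN).
have nearjh : q1 ^ (-1) * pt l h != pt l j by apply: (pt_near al jhN).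
have [ji hi hj] : [/\ j != i, h != i & h != j] by rewrite !gtn_eqF.
have [R hR] := ecf_split1 l ij.
have [S hS] := ecf_split2 l ih jh ji.
have EI l' : (forall m, (m <= i)%N -> l' m = l m) -> ecf l' i = ecf l i.
  exact: ecf_local.
have PI l' : l' i = l i + 1 -> pt l' i = q1 * pt l i.
  by move=> e; rewrite -pt_up_eq; apply: pt_ext; rewrite up_eq.
have PJ l' : l' j = l j + 1 -> pt l' j = q1 * pt l j.
  by move=> e; rewrite -pt_up_eq; apply: pt_ext; rewrite up_eq.
pose Kij := phiK (pt l j / pt l i) / pt l i ^+ 3.
pose Kih := phiK (pt l h / pt l i) / pt l i ^+ 3.
pose Kjh := phiK (pt l h / pt l j) / pt l j ^+ 3.
(* In [EJ] and [EH] the digits tell which of the rows above have been raised. *)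
have EJ0 l' : (forall m, (m <= j)%N -> l' m = l m) ->
    ecf l' j = Kij * g (pt l j) (pt l i) * R.
  by move=> e; rewrite (ecf_local e) (hR l)// phi_ratio.
have EJ1 l' : (forall m, (m <= j)%N -> m != i -> l' m = l m) ->
    l' i = l i + 1 -> ecf l' j = - (Kij * g (pt l i) (pt l j)) * R.
  by move=> e ei; rewrite (hR l')// PI// (phi_ratio').
have EH00 l' : (forall m, (m <= h)%N -> l' m = l m) ->
    ecf l' h = Kih * g (pt l h) (pt l i) * (Kjh * g (pt l h) (pt l j)) * S.
  by move=> e; rewrite (ecf_local e) (hS l)// !phi_ratio.
have EH10 l' : (forall m, (m <= h)%N -> m != i -> l' m = l m) ->
    l' i = l i + 1 -> ecf l' h =
    - (Kih * g (pt l i) (pt l h)) * (Kjh * g (pt l h) (pt l j)) * S.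
  move=> e ei; rewrite (hS l')// => [|m mh mi _]; last exact: e.
  rewrite PI// (pt_ext (e j _ _))// 1?ltnW//.
  by rewrite (phi_ratio')// phi_ratio.
have EH01 l' : (forall m, (m <= h)%N -> m != j -> l' m = l m) ->
    l' j = l j + 1 -> ecf l' h =
    Kih * g (pt l h) (pt l i) * - (Kjh * g (pt l j) (pt l h)) * S.
  move=> e ei; rewrite (hS l')// => [|m mh mi mj]; last exact: e.
  rewrite PJ// (pt_ext (e i _ _))// 1?eq_sym// 1?ltnW//.
  by rewrite phi_ratio// (phi_ratio').
have EH11 l' : (forall m, (m <= h)%N -> m != i -> m != j -> l' m = l m) ->
    l' i = l i + 1 -> l' j = l j + 1 -> ecf l' h =
    - (Kih * g (pt l i) (pt l h)) * - (Kjh * g (pt l j) (pt l h)) * S.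
  by move=> e ei ej; rewrite (hS l')// PI// PJ// !(phi_ratio').
have [ij' ih' jh'] : [/\ i != j, i != h & j != h].
  by rewrite !ltn_eqF.
rewrite /serre_sum !serre_termE//.
rewrite (EI (up l j)); last by (clear -ij jh ih; upl).
rewrite (EI (up l h)); last by (clear -ij jh ih; upl).
rewrite (EI (up (up l j) h)); last by (clear -ij jh ih; upl).
rewrite (EI (up (up l h) j)); last by (clear -ij jh ih; upl).
rewrite (EJ0 l)// (EJ0 (up l h)); last by (clear -ij jh ih; upl).
rewrite (EJ1 (up l i)); [|by (clear -ij jh ih; upl)..].
rewrite (EJ1 (up (up l i) h)); [|by (clear -ij jh ih; upl)..].
rewrite (EJ1 (up (up l h) i)); [|by (clear -ij jh ih; upl)..].
rewrite (EH00 l)// (EH10 (up l i)); [|by (clear -ij jh ih; upl)..].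
rewrite (EH01 (up l j)); [|by (clear -ij jh ih; upl)..].
rewrite (EH11 (up (up l i) j)); [|by (clear -ij jh ih; upl)..].
rewrite (EH11 (up (up l j) i)); [|by (clear -ij jh ih; upl)..].
have := serre_poly (pt0 l i) (pt0 l j) (pt0 l h).
move=> e; rewrite -[RHS](mulr0 (- (W (pt l i) * W (pt l j) * W (pt l h) *
  (ecf l i * R * S) * (Kij * Kih * Kjh)))) -[in RHS]e.
ring.
Qed.

(** With a repeated row the points shift by powers of [q1], and the claim becomes
    an identity between rational functions of the two points. *)
Lemma serre_iij W N l i j : adm N l -> adm N (up (up (up l i) i) j) ->
  (i < j < N)%N -> serre_sum W l i i j = 0.
Proof.
move=> al am ijN; have /andP[ij jN] := ijN.
have ji : j != i by rewrite gtn_eqF.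
have far : q1 ^ 1 * pt l j != pt l i.
  apply: (pt_far al am ijN) => [h1|]; first by rewrite !up_neq//; lia.
  by rewrite up_eq !up_neq//; lia.
have near0 : q1 ^ 0 * pt l j != pt l i by apply: (pt_near al ijN).
have near1 : q1 ^ (-1) * pt l j != pt l i by apply: (pt_near al ijN).
have near2 : q1 ^ (-2) * pt l j != pt l i by apply: (pt_near al ijN).
have [R hR] := ecf_split1 l ij.
have E0 : ecf (up l i) j = phi (pt l j / (q1 * pt l i)) * R.
  rewrite -pt_up_eq; apply: hR => m mj mi; exact: up_neq.
have PP : pt (up (up l i) i) i = q1 * (q1 * pt l i).
  by rewrite !pt_up_eq.
have E1 : ecf (up (up l i) i) j = phi (pt l j / (q1 * (q1 * pt l i))) * R.
  rewrite -PP; apply: hR => m mj mi; by rewrite !up_neq.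
have E2 : ecf (up (up l i) j) i = ecf (up l i) i.
  by apply: ecf_local => m mi; rewrite up_neq// ltn_eqF// (leq_ltn_trans mi).
have E3 : ecf (up (up l j) i) i = ecf (up l i) i.
  by rewrite upC E2.
have E4 : ecf (up l j) i = ecf l i.
  by apply: ecf_local => m mi; rewrite up_neq// ltn_eqF// (leq_ltn_trans mi).
have P1 : pt (up l i) i = q1 * pt l i := pt_up_eq l i.
have P2 : pt (up (up l i) i) j = pt l j by rewrite !pt_up_neq.
have P3 : pt (up l i) j = pt l j by rewrite pt_up_neq.
have P4 : pt (up (up l i) j) i = q1 * pt l i.
  by rewrite pt_up_neq ?P1// eq_sym.
have P5 : pt (up l j) i = pt l i by rewrite pt_up_neq// eq_sym.
have P6 : pt (up (up l j) i) i = q1 * pt l i by rewrite upC.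
rewrite /serre_sum /serre_term E0 E1 E2 E3 E4 (hR l)// P1 P2 P3 P4 P5 P6.
move: near0 near1 near2 far (pt0 l i) (pt0 l j).
move: (pt l i) (pt l j) (ecf l i) (ecf (up l i) i) => a b A B n0 n1 n2 f a0 b0.
rewrite /phi /serre_wt.
have {}n0 : a - b != 0 by rewrite subr_eq0 eq_sym -[b]mul1r.
have {}n1 : q1 * a - b != 0.
  by apply: contraNneq n1 => /subr0_eq <-; rewrite exprN1 mulKf.
have {}n2 : q1 * (q1 * a) - b != 0.
  apply: contraNneq n2 => /subr0_eq <-; apply/eqP.
  by rewrite -exprnN expr2; field.
have {}f : a - q1 * b != 0 by rewrite subr_eq0 eq_sym -[q1]expr1z.
by field; rewrite a0 hq1 b0 f n0 hq3 n1 n2.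
Qed.

Lemma serre_ijj W N l i j : adm N l -> adm N (up (up (up l i) j) j) ->
  (i < j < N)%N -> serre_sum W l i j j = 0.
Proof.
move=> al am ijN; have /andP[ij jN] := ijN.
have ji : j != i by rewrite gtn_eqF.
have ij' : i != j by rewrite ltn_eqF.
have far p : p <= 2 -> q1 ^ p * pt l j != pt l i.
  move=> p2; apply: (pt_far al am ijN) => [h1|]; first by rewrite !up_neq//; lia.
  by rewrite !up_eq !up_neq//; lia.
have n1 := far (-1) isT; have n0 := far 0 isT.
have f1 := far 1 isT; have f2 := far 2 isT.
have [R hR] := ecf_split1 l ij.
have [S hS] := ecf_split1 (up l j) ij.
have P1 : pt (up l j) j = q1 * pt l j := pt_up_eq l j.
have P2 : pt (up l j) i = pt l i by rewrite pt_up_neq.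
have P3 : pt (up l i) j = pt l j by rewrite pt_up_neq.
have P4 : pt (up (up l i) j) j = q1 * pt l j by rewrite pt_up_eq P3.
have P5 : pt (up (up l i) j) i = q1 * pt l i.
  by rewrite upC pt_up_eq P2.
have P6 : pt (up (up l j) j) i = pt l i by rewrite !pt_up_neq.
have E0 : ecf (up l i) j = phi (pt l j / (q1 * pt l i)) * R.
  by rewrite -pt_up_eq; apply: hR => m mj mi; exact: up_neq.
have E1 : ecf (up l j) j = phi (q1 * pt l j / pt l i) * S.
  by rewrite (hS (up l j))// P1 P2.
have E2 : ecf (up (up l i) j) j = phi (q1 * pt l j / (q1 * pt l i)) * S.
  rewrite (hS (up (up l i) j)) => [|m mj mi]; first by rewrite P1 P5.
  by rewrite upC up_neq.
have E3 : ecf (up l j) i = ecf l i.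
  by apply: ecf_local => m mi; rewrite up_neq// ltn_eqF// (leq_ltn_trans mi).
have E4 : ecf (up (up l j) j) i = ecf l i.
  by apply: ecf_local => m mi; rewrite !up_neq// ltn_eqF// (leq_ltn_trans mi).
rewrite /serre_sum /serre_term [up (up l j) i]upC.
rewrite E0 E1 E2 E3 E4 (hR l)// P1 P2 P3 P4 P6.
move: n0 n1 f1 f2 (pt0 l i) (pt0 l j).
move: (pt l i) (pt l j) (ecf l i) => a b A n0 n1 f1 f2 a0 b0.
rewrite /phi /serre_wt.
have {}n0 : a - b != 0 by rewrite subr_eq0 eq_sym -[b]mul1r.
have {}n1 : q1 * a - b != 0.
  by apply: contraNneq n1 => /subr0_eq <-; rewrite exprN1 mulKf.
have {}f1 : a - q1 * b != 0 by rewrite subr_eq0 eq_sym -[q1]expr1z.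
have {}f2 : a - q1 * (q1 * b) != 0.
  by rewrite subr_eq0 eq_sym mulrA; exact: f2.
by field; rewrite a0 b0 hq1 f2 f1 hq3 n0 n1.
Qed.

(** The Serre weight vanishes on a geometric progression. *)
Lemma serre_iii W l i : serre_sum W l i i i = 0.
Proof.
rewrite /serre_sum /serre_term !pt_up_eq /serre_wt.
move: (pt0 l i); move: (pt l i) => a a0.
have -> : q1 * a / a - a / (q1 * a) - q1 * (q1 * a) / (q1 * a) +
  q1 * a / (q1 * (q1 * a)) = 0 by field; rewrite hq1 a0.
by rewrite !mulr0 !addr0.
Qed.

Lemma serre_sum_swap12 W l i j h : serre_sum W l i j h = serre_sum W l j i h.
Proof. by rewrite /serre_sum; ring. Qed.

Lemma serre_sum_swap23 W l i j h : serre_sum W l i j h = serre_sum W l i h j.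
Proof. by rewrite /serre_sum; ring. Qed.

Lemma serre_sum_eq0 W N l i j h : adm N l -> adm N (up (up (up l i) j) h) ->
  (i < N)%N -> (j < N)%N -> (h < N)%N -> serre_sum W l i j h = 0.
Proof.
move=> al.
have sorted x y z : (x <= y)%N -> (y <= z)%N -> (z < N)%N ->
    adm N (up (up (up l x) y) z) -> serre_sum W l x y z = 0.
  rewrite [(x <= y)%N]leq_eqVlt [(y <= z)%N]leq_eqVlt.
  case/orP=> [/eqP<-|xy]; case/orP=> [/eqP<-|yz] zN am.
  - exact: serre_iii.
  - by apply: (serre_iij _ al am); rewrite yz.
  - by apply: (serre_ijj _ al am); rewrite xy.
  - by apply: (serre_lt _ al am); rewrite ?yz.
move=> am iN jN hN.
case: (leqP i j) => [ij|/ltnW ji].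
- case: (leqP j h) => [jh|/ltnW hj]; first exact: sorted.
  rewrite serre_sum_swap23; rewrite upC in am.
  case: (leqP i h) => [ih|/ltnW hi]; first exact: sorted.
  by rewrite serre_sum_swap12; apply: sorted; rewrite // (upC l).
- rewrite serre_sum_swap12; rewrite (upC l) in am.
  case: (leqP i h) => [ih|/ltnW hi]; first exact: sorted.
  rewrite serre_sum_swap23; rewrite upC in am.
  case: (leqP j h) => [jh|/ltnW hj]; first exact: sorted.
  by rewrite serre_sum_swap12; apply: sorted; rewrite // (upC l).
Qed.

(** * Lowering coefficients, by reversal of the rows *)

Definition fcf N l i : F := \prod_(j < N | (i < j)%N) phi (pt l j / pt l i).

(** Lowering a row of [l] raises the opposite row of [flip N l], and the ratios of
    points are preserved because the rows are reversed and the points inverted. *)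
Definition flip (N : nat) l (j : nat) : int :=
  if (j < N)%N then - l (N - j.+1)%N else 0.

Lemma flip_ord N l i : (i < N)%N -> flip N l (N - i.+1) = - l i.
Proof.
move=> iN; rewrite /flip ltn_subrL (leq_ltn_trans _ iN)//=.
by congr (- l _); lia.
Qed.

Lemma pt_flip N l i : (i < N)%N ->
  pt (flip N l) (N - i.+1) = q3 ^+ N.-1 / pt l i.
Proof.
move=> iN; rewrite /pt flip_ord// -invr_expz invfM mulrCA; congr (_ * _).
have -> : N.-1 = ((N - i.+1) + i)%N by lia.
by rewrite exprD mulfK// expf_neq0.
Qed.

Lemma fcf_flip N l i : (i < N)%N -> fcf N l i = ecf (flip N l) (N - i.+1).
Proof.
move=> iN; rewrite /ecf (big_ord_widen N (fun j => phi (_ / pt (flip N l) j))).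
  rewrite (reindex_inj rev_ord_inj) /fcf; apply: eq_big => [j|j _] /=.
    by have := ltn_ord j; lia.
  rewrite !pt_flip//; congr phi.
  have : q3 ^+ N.-1 != 0 by rewrite expf_neq0.
  by move: (q3 ^+ N.-1) => a a0; field; rewrite !pt0 a0.
exact: leq_subr.
Qed.

Lemma adm_flip N l : adm N l -> adm N (flip N l).
Proof.
move=> [mono gap]; split=> j jN; rewrite /flip jN.
  rewrite (ltn_trans (ltnSn j) jN); have := mono (N - j.+2)%N.
  have -> : (N - j.+2).+1 = (N - j.+1)%N by lia.
  by move=> /(_ ltac:(lia)); lia.
rewrite (leq_ltn_trans (leq_addr k j) jN); have := gap (N - (j + k).+1)%N.
have -> : (N - (j + k).+1 + k = N - j.+1)%N by lia.
by move=> /(_ ltac:(lia)); lia.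
Qed.

Lemma flip_dn N l i : (i < N)%N -> flip N (dn l i) = up (flip N l) (N - i.+1).
Proof.
move=> iN; apply/funext => j; rewrite /flip /dn /up; case: ifP => jN.
  rewrite opprB addrC; congr (_ + _%:R); congr nat_of_bool.
  by apply/eqP/eqP; lia.
by rewrite (_ : (j == _) = false) ?addr0//; apply/eqP; lia.
Qed.

Lemma fcf_adm N l i : adm N l -> (i < N)%N -> fcf N l i != 0 ->
  ((i.+1 < N)%N -> l i.+1 < l i) /\ ((i + k < N)%N -> r%:Z < l i - l (i + k)%N).
Proof.
move=> al iN; rewrite fcf_flip// => /(ecf_adm (adm_flip al)) [|h1 h2].
  by lia.
rewrite flip_ord// in h1 h2; split=> iN1.
  move: h1; have -> : (N - i.+1).-1 = (N - i.+2)%N by lia.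
  by rewrite flip_ord// => /(_ ltac:(lia)); lia.
move: h2; have -> : (N - i.+1 - k)%N = (N - (i + k).+1)%N by lia.
by rewrite flip_ord// => /(_ ltac:(lia)); lia.
Qed.

Lemma g_flip (c z w : F) : c != 0 -> z != 0 -> w != 0 ->
  g (c / z) (c / w) = (c / (z * w)) ^+ 3 * g w z.
Proof.
move=> c0 z0 w0; rewrite g_hom g_inv//.
by field; rewrite z0 w0.
Qed.

Lemma fexchange N l i j : adm N l -> adm N (dn (dn l i) j) ->
  i != j -> (i < N)%N -> (j < N)%N ->
  fcf N l i * fcf N (dn l i) j * g (pt l i) (pt l j) +
  fcf N l j * fcf N (dn l j) i * g (pt l j) (pt l i) = 0.
Proof.
move=> al am ij iN jN.
have ij' : (N - i.+1 != N - j.+1)%N by move: ij; apply: contraNneq; lia.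
have := @exchange N (flip N l) _ _ (adm_flip al) _ ij'.
rewrite -!flip_dn// => /(_ (adm_flip am)).
rewrite -!fcf_flip// !pt_flip// !g_flip ?expf_neq0//.
rewrite [pt l j * pt l i]mulrC.
move=> /(_ ltac:(lia) ltac:(lia)) e.
have d0 : (q3 ^+ N.-1 / (pt l i * pt l j)) ^+ 3 != 0.
  by rewrite expf_neq0// mulf_neq0 ?expf_neq0// invr_neq0// mulf_neq0.
apply: (mulfI d0); rewrite mulr0 -[RHS]e.
by move: (_ ^+ 3) => d; ring.
Qed.

Definition fserre_term N W l i j h : F :=
  let a := pt (dn l i) i in let b := pt (dn (dn l i) j) j in
  let c := pt (dn (dn (dn l i) j) h) h in
  W a * W b * W c *
  (fcf N l i * fcf N (dn l i) j * fcf N (dn (dn l i) j) h) *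
  serre_wt a b c.

Definition fserre_sum N W l i j h : F :=
  fserre_term N W l i j h + fserre_term N W l i h j +
  fserre_term N W l j i h + fserre_term N W l j h i +
  fserre_term N W l h i j + fserre_term N W l h j i.

Lemma pt_dn_flip N l i : (i < N)%N ->
  pt (dn l i) i = q3 ^+ N.-1 / (q1 * pt (flip N l) (N - i.+1)).
Proof.
move=> iN; rewrite -pt_up_eq -flip_dn// pt_flip//.
have : q3 ^+ N.-1 != 0 by rewrite expf_neq0.
by move: (q3 ^+ N.-1) => a a0; field; rewrite !pt0 a0.
Qed.

Lemma serre_wt_flip (c a b d : F) : c != 0 -> a != 0 -> b != 0 -> d != 0 ->
  serre_wt (c / a) (c / b) (c / d) = - serre_wt a b d.
Proof. by move=> c0 a0 b0 d0; rewrite /serre_wt; field; rewrite a0 b0 d0 c0. Qed.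

(** The inversion of the points changes the sign of the Serre weight; a
    common factor of the three points drops out of it. *)
Lemma fserre_termE N W l i j h : (i < N)%N -> (j < N)%N -> (h < N)%N ->
  fserre_term N W l i j h =
  - serre_term (fun x => W (q3 ^+ N.-1 / (q1 * x))) (flip N l)
      (N - i.+1) (N - j.+1) (N - h.+1).
Proof.
move=> iN jN hN; rewrite /fserre_term /serre_term -!flip_dn// -!fcf_flip//.
rewrite !(pt_dn_flip _ (N := N))// serre_wt_flip ?mulf_neq0 ?expf_neq0//.
have -> (a b c : F) : serre_wt (q1 * a) (q1 * b) (q1 * c) = serre_wt a b c.
  by rewrite /serre_wt !invfM; congr (_ - _ - _ + _);
     rewrite mulrACA mulfV// mul1r.
  by rewrite mulrN.
- exact: expfz_neq0.
- exact: expfz_neq0.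
- exact: expfz_neq0.
Qed.

Lemma fserre_sum_eq0 W N l i j h : adm N l -> adm N (dn (dn (dn l i) j) h) ->
  (i < N)%N -> (j < N)%N -> (h < N)%N -> fserre_sum N W l i j h = 0.
Proof.
move=> al am iN jN hN; rewrite /fserre_sum !fserre_termE// -!opprD.
apply/eqP; rewrite oppr_eq0; apply/eqP.
apply: (serre_sum_eq0 _ (adm_flip al)); try lia.
by rewrite -!flip_dn//; exact: adm_flip.
Qed.

(** * The series psi, with the correction beta *)

(** The supports of the delta functions with which [e] raises and [f] lowers the
    row [i]. *)
Definition px l i : F := pt l i * u.
Definition py l i : F := pt l i * u / q1.

Lemma px_neq0 l i : px l i != 0. Proof. exact: mulf_neq0. Qed.
Lemma py_neq0 l i : py l i != 0.
Proof. by rewrite mulf_neq0 ?invr_neq0 ?px_neq0. Qed.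
Let px0 := px_neq0.
Let py0 := py_neq0.

Lemma px_dn l i : px (dn l i) i = py l i.
Proof. by rewrite /px pt_dn_eq mulrAC. Qed.
Lemma py_up l i : py (up l i) i = px l i.
Proof. by rewrite /py pt_up_eq /px; field. Qed.

(** On the vector of [l] the series [psi] corrected by [beta] is the product of the
    [1 - a / z] over [zeros] divided by that of the [1 - b / z] over [poles]; the
    last [k] entries of each list come from [beta]. *)
Definition zeros N l : seq F :=
  [seq q3 * px l i | i <- index_iota 0 N] ++
  [seq py l i / q3 | i <- index_iota 0 N] ++
  [seq py l0 i | i <- index_iota (N - k) N].

Definition poles N l : seq F :=
  [seq px l i | i <- index_iota 0 N] ++
  [seq py l i | i <- index_iota 0 N] ++
  [seq py l0 i / q3 | i <- index_iota (N - k) N].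

Definition tail J l : Prop := forall j, (J <= j)%N -> l j = l0 j.

Lemma py_lambda0 v j : (j < k)%N -> py l0 (v * k + j) =
  q1 ^ (- (0 :: cs)`_j - v%:Z - 1) * q3 ^ (- v%:Z + j%:Z) * u.
Proof.
(* The exponents on the two sides differ by [v] times the resonance relation. *)
move=> jk; have e : (q1 ^ (1 - r%:Z) * q3 ^ (k%:Z + 1)) ^ v%:Z = 1.
  by rewrite hres exp1rz.
rewrite expfzMl !exprz_exp in e.
rewrite /py /pt /lambda0 divnMDl// modnMDl divn_small// modn_small// addn0.
rewrite -[RHS]mulr1 -[X in _ = _ * X]e -[q1^-1]exprN1.
transitivity (q1 ^ (- (v%:Z * r%:Z) - (0 :: cs)`_j - 1) *
              q3 ^ (v * k + j)%N%:Z * u).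
  by rewrite [q1 ^ (_ - _ - 1)]expfzDr//; ring.
have -> : - (v%:Z * r%:Z) - (0 :: cs)`_j - 1 =
   (- (0 :: cs)`_j - v%:Z - 1) + (1 - r%:Z) * v%:Z by ring.
have -> : (v * k + j)%N%:Z = (- v%:Z + j%:Z) + (k%:Z + 1) * v%:Z.
  by rewrite PoszD PoszM; ring.
by rewrite [q1 ^ (_ + _ * _)]expfzDr// [q3 ^ (_ + _ * _)]expfzDr//; ring.
Qed.

(** The two products in [beta] are the rows of the block of the row [N.-1] up to that
    row and the rows of the previous block after it, that is, the last [k] rows of
    the ground state [lambda0]. *)
Lemma beta_perm N : (k <= N)%N -> perm_eq (beta k cs q1 q3 u N)
  [seq (py l0 i, py l0 i / q3) | i <- index_iota (N - k) N].
Proof.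
move=> kN; rewrite /beta; set v := (N.-1 %/ k)%N; set i := (N.-1 %% k)%N.
have ik : (i < k)%N by rewrite ltn_mod.
have NE : N = (v * k + i.+1)%N.
  by rewrite addnS -divn_eq prednK// (leq_trans _ kN).
have eqp (s t : seq (F * F)) : s = t -> perm_eq s t by move=> ->.
have kE : iota (N - k) k = iota (N - k) (k - i.+1 + i.+1) by rewrite subnK.
rewrite perm_catC /index_iota subKn// kE iotaD map_cat perm_cat//.
  case: v NE => [|v] NE.
    by have -> : (k - i.+1 = 0)%N by lia.
  have -> : (N - k)%N = (v * k + i.+1)%N by rewrite NE; lia.
  rewrite iotaDl -map_comp; apply/eqp/eq_in_map => j; rewrite mem_iota => jk.
  rewrite /= py_lambda0; last by lia.
  rewrite [q3 ^ (- v%:Z + j%:Z)](_ : _ = q3 ^ (- v.+1%:Z + j%:Z) * q3); last first.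
    by rewrite -[X in _ * X]expr1z -expfzDr//; congr (q3 ^ _); lia.
  have -> : - (0 :: cs)`_j - v%:Z - 1 = - (0 :: cs)`_j - v.+1%:Z by lia.
  have -> : q3 ^ (- v.+1%:Z + j%:Z + 1) = q3 ^ (- v.+1%:Z + j%:Z) * q3.
    by rewrite expfzDr// expr1z.
  by congr (_, _); field.
have -> : (N - k + (k - i.+1) = v * k + 0)%N by rewrite NE; lia.
rewrite iotaDl -map_comp; apply/eqp/eq_in_map => j; rewrite mem_iota => jk.
rewrite /= py_lambda0; last by lia.
congr (_, _); rewrite [q3 ^ (_ - 1)]expfzDr// exprN1; ring.
Qed.

Lemma reval_beta N z : (k <= N)%N -> reval (beta k cs q1 q3 u N) z =
  \prod_(N - k <= j < N) ((1 - py l0 j / z) / (1 - py l0 j / q3 / z)).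
Proof. by move=> kN; rewrite /reval (perm_big _ (beta_perm kN)) big_map. Qed.

Lemma psi_mod_rser s N l : (k <= N)%N ->
  psmul (expand s (beta k cs q1 q3 u N)) (expand s (psi_rat q1 q3 u (trunc N l)))
  = rser s (zeros N l) (poles N l).
Proof.
move=> kN; have -> : expand s (beta k cs q1 q3 u N) =
    expand s [seq (py l0 i, py l0 i / q3) | i <- index_iota (N - k) N].
  by apply: perm_big; exact: beta_perm.
have -> : psi_rat q1 q3 u (trunc N l) =
    flatten [seq [:: (q3 * px l i, px l i); (py l i / q3, py l i)]
            | i <- index_iota 0 N].
  rewrite /psi_rat /index_iota subn0 -val_enum_ord -map_comp; congr flatten.
  apply: eq_map => i /=; rewrite !ffunE /py /px /pt.
  rewrite !expfzDr// !exprN1 expr1z.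
  by congr [:: (_, _); (_, _)]; field; rewrite ?hq1 ?hq3.
rewrite !expandE /rser /zeros /poles !big_cat !big_flatten !big_map /=.
have pairE (h : F * F -> nat -> F) (f1 f2 : nat -> F * F) (t : seq nat) :
    \big[@psmul F/@psone F]_(i <- t) \big[@psmul F/@psone F]_(p <- [:: f1 i; f2 i]) h p
    = psmul (\big[@psmul F/@psone F]_(i <- t) h (f1 i))
            (\big[@psmul F/@psone F]_(i <- t) h (f2 i)).
  by rewrite -big_split; apply: eq_bigr => i _; rewrite !big_cons big_nil psmul1r.
rewrite !pairE /=.
by rewrite Monoid.mulmACA /=; congr psmul; rewrite psmulC -psmulA.
Qed.

Definition psi_row s l i : nat -> F :=
  psmul (psmul (num s (q3 * px l i)) (num s (py l i / q3)))
        (psmul (den s (px l i)) (den s (py l i))).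

Definition psi_beta s i : nat -> F :=
  psmul (num s (py l0 i)) (den s (py l0 i / q3)).

Definition psi_ser s N l : nat -> F := rser s (zeros N l) (poles N l).

Lemma psi_serE s N l : psi_ser s N l =
  psmul (\big[@psmul F/@psone F]_(0 <= i < N) psi_row s l i)
        (\big[@psmul F/@psone F]_(N - k <= i < N) psi_beta s i).
Proof.
rewrite /psi_ser /rser /zeros /poles !big_cat !big_map /= !big_split /=.
by rewrite [RHS]Monoid.mulmACA /= -!psmulA.
Qed.

Lemma px_shift l i : l (i + k)%N = l i - r%:Z -> px l (i + k) = q2 * px l i.
Proof.
by move=> e; rewrite /px pt_shift// mulrA.
Qed.

(** In the tail [px l (i + k) = q2 * px l i]: the factors of the row [i + k] cancel
    those of [beta] at [i + k] and restore those at [i]. *)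
Lemma psi_row_stable s l i : l i = l0 i -> l (i + k)%N = l0 (i + k) ->
  psmul (psi_row s l (i + k)) (psi_beta s (i + k)) = psi_beta s i.
Proof.
move=> e1 e2; rewrite /psi_row /psi_beta.
have -> : px l (i + k) = q2 * px l0 i.
  rewrite px_shift; last by rewrite e1 e2 lambda0_shift.
  by rewrite /px (pt_ext e1).
have py2 : py l (i + k) = py l0 (i + k) by rewrite /py (pt_ext e2).
have -> : q3 * (q2 * px l0 i) = py l0 i.
  by rewrite /py /px q2E; field; rewrite hq3 hq1.
have -> : q2 * px l0 i = py l0 i / q3.
  by rewrite /py /px q2E; field; rewrite hq3 hq1.
rewrite py2; set a := py l0 (i + k); set b := py l0 i.
have e (x1 x2 x3 x4 x5 x6 : nat -> F) :
    psmul (psmul (psmul x1 x2) (psmul x3 x4)) (psmul x5 x6) =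
    psmul (psmul x5 x4) (psmul (psmul x2 x6) (psmul x1 x3)).
  rewrite [psmul (psmul x1 x2) _]Monoid.mulmACA /= -psmulA [psmul x5 x6]psmulC.
  rewrite [psmul (psmul x2 x4) _]Monoid.mulmACA /= psmulC.
  by rewrite [psmul (psmul x2 x6) _]psmulC -psmulA [psmul x4 x5]psmulC.
have a0 : a != 0 := py_neq0 _ _.
have a30 : a / q3 != 0 by rewrite mulf_neq0// invr_neq0.
by rewrite e (num_den s a0) (num_den s a30) !psmul1l.
Qed.

Lemma psi_ser_stable s N l : (k <= N)%N -> l (N - k)%N = l0 (N - k) ->
  l N = l0 N -> psi_ser s N.+1 l = psi_ser s N l.
Proof.
move=> kN e1 e2; rewrite !psi_serE big_nat_recr//= subSn//.
rewrite big_nat_recr/=; last by rewrite ltn_subrL hk (leq_trans hk).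
rewrite [in RHS](@big_ltn _ _ _ (N - k) N); last first.
  by rewrite ltn_subrL hk (leq_trans hk).
rewrite Monoid.mulmACA /=; have := @psi_row_stable s l (N - k) e1.
rewrite subnK// => /(_ e2) ->.
by rewrite -psmulA; congr psmul; rewrite psmulC.
Qed.

Lemma psi_ser_split s N l i : (i < N)%N -> exists R, forall l',
  (forall j, j != i -> l' j = l j) ->
  psi_ser s N l' = psmul (psi_row s l' i) R.
Proof.
move=> iN; pose R0 := \big[@psmul F/@psone F]_(j < N | j != Ordinal iN) psi_row s l j.
exists (psmul R0 (\big[@psmul F/@psone F]_(N - k <= i < N) psi_beta s i)) => l' e.
rewrite psi_serE psmulA; congr psmul.
rewrite big_mkord (bigD1 (Ordinal iN))//=; congr psmul.
apply: eq_bigr => j ji; rewrite /psi_row.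
have ep : pt l' j = pt l j by apply: pt_ext; rewrite e.
by rewrite /px /py ep.
Qed.

(** The constant term is the value at infinity or at zero: a row contributes the
    product [q3 / q3] and a factor of [beta] contributes [q3] at zero. *)
Lemma psi_ser0 s N l : (k <= N)%N -> psi_ser s N l 0 = if s then 1 else q3 ^+ k.
Proof.
move=> kN.
have big0 (f : nat -> nat -> F) m n (v : F) : (forall i, f i 0 = v) ->
    (\big[@psmul F/@psone F]_(m <= i < n) f i) 0%N = v ^+ (n - m).
  move=> e; rewrite -prodr_const_nat.
  elim/big_rec2: _ => // i x y _ IH; rewrite psmul0E IH e//.
have num0 a : num s a 0 = if s then 1 else a.
  by case: s; rewrite /num /psscale /pslin /= !mulr0 subr0 ?mulr1.
have den0 a : den s a 0 = if s then 1 else a^-1.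
  by case: s {num0}; rewrite /den /psscale /psgeom !expr0 ?mulr1.
rewrite psi_serE psmul0E (big0 _ _ _ 1) ?(big0 _ _ _ (if s then 1 else q3)).
- by rewrite expr1n mul1r subKn//; case: s {num0 den0}; rewrite ?expr1n.
- move=> i; rewrite /psi_beta psmul0E num0 den0; case: s {num0 den0}; rewrite ?mulr1//.
  by field; rewrite hq3 py_neq0.
move=> i; rewrite /psi_row !psmul0E !num0 !den0; case: s {num0 den0}; rewrite ?mulr1//.
by field; rewrite hq3 py_neq0 px_neq0.
Qed.

(** * How psi changes when a row is raised *)

(** Multiplication by [z - a], on coefficients of powers of [z^-1]. *)
Definition shift_op (a : F) (D : int -> F) (m : int) : F := D (m + 1) - a * D m.

Lemma gcoefE : [/\ gcoef q1 q2 q3 0 = - 1, gcoef q1 q2 q3 1 = q1 * q2 + q1 * q3 + q2 * q3,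
  gcoef q1 q2 q3 2 = - (q1 + q2 + q3) & gcoef q1 q2 q3 3 = 1].
Proof.
have gE : ('X - q1%:P) * ('X - q2%:P) * ('X - q3%:P) =
   'X^3 + (- (q1 + q2 + q3)) *: 'X^2 + (q1 * q2 + q1 * q3 + q2 * q3) *: 'X + (-1)%:P.
  rewrite -hq -!mul_polyC !polyCN !polyCD !polyCM; ring.
rewrite /gcoef gE !coefD !coefZ !coefXn !coefX !coefC /=.
by rewrite ?(mulr0, mulr1, add0r, addr0).
Qed.

(** At [w = x], [g] is a product of three linear factors in [z]. *)
Lemma gsum_shift (x : F) (D : int -> F) (m : int) :
  \sum_(a < 4) gcoef q1 q2 q3 a * (x ^+ (3 - a) * D (m + a%:Z)) =
  shift_op (q1 * x) (shift_op (q2 * x) (shift_op (q3 * x) D)) m.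
Proof.
have [g0 g1 g2 g3] := gcoefE.
rewrite !big_ord_recr big_ord0 /= g0 g1 g2 g3 add0r /shift_op.
rewrite addr0 -!addrA -[1%:Z + 1]/2%:Z -[1%:Z + 2%:Z]/3%:Z.
have -> : -1 = - (q1 * q2 * q3) :> F by rewrite hq.
rewrite -[(3 - 0)%N]/3%N -[(3 - 1)%N]/2%N -[(3 - 2)%N]/1%N subnn.
move: (D m) (D (m + 1)) (D (m + 2%:Z)) (D (m + 3%:Z)) => d0 d1 d2 d3.
by ring.
Qed.

Lemma gsum_shift' (x : F) (D : int -> F) (m : int) :
  \sum_(a < 4) gcoef q1 q2 q3 a * (x ^+ a * D (m + (3 - a)%N%:Z)) =
  - shift_op (x / q1) (shift_op (x / q2) (shift_op (x / q3) D)) m.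
Proof.
have [g0 g1 g2 g3] := gcoefE.
rewrite !big_ord_recr big_ord0 /= g0 g1 g2 g3 add0r /shift_op.
rewrite -!addrA -[1%:Z + 1]/2%:Z -[1%:Z + 2%:Z]/3%:Z.
rewrite -[(3 - 0)%N]/3%N -[(3 - 1)%N]/2%N -[(3 - 2)%N]/1%N subnn addr0.
rewrite q2E.
move: (D m) (D (m + 1)) (D (m + 2%:Z)) (D (m + 3%:Z)) => d0 d1 d2 d3.
by field; rewrite hq1 hq3 oner_eq0.
Qed.

Definition shift_sign (s : bool) : F := if s then 1 else -1.

(** On the expansion of a rational function, multiplication by [z - a] is
    multiplication by [num s a], up to a sign and a shift of the index. *)
Lemma shift_ext s a (d : nat -> F) (m : int) : a != 0 ->
  shift_op a (ext s d) m = shift_sign s * ext s (psmul (num s a) d) (m + s%:Z).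
Proof.
move=> a0; rewrite /shift_op /ext psmul_num//; case: s => /=.
  rewrite mul1r; case: m => [m|[|m]] /=.
  - by rewrite addn1.
  - by rewrite mulr0 subr0.
  - by rewrite mulr0 subr0.
rewrite mulN1r addr0; case: m => [[|m]|m] /=.
- by rewrite add0r.
- by rewrite mulr0 subr0 oppr0.
rewrite opprB; have -> : Negz m + 1 <= 0 by lia.
by have -> : absz (Negz m + 1) = m by lia.
Qed.

Lemma shift_opZ a b (D : int -> F) m :
  shift_op a (fun n => b * D n) m = b * shift_op a D m.
Proof. by rewrite /shift_op; ring. Qed.

Lemma shift_op_comp a b (D : int -> F) n m :
  shift_op a (fun i => b * D (i + n)) m = b * shift_op a D (m + n).
Proof. by rewrite shift_opZ /shift_op addrAC. Qed.

Lemma shift_ext3 s a1 a2 a3 (d : nat -> F) m : a1 != 0 -> a2 != 0 -> a3 != 0 ->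
  shift_op a1 (shift_op a2 (shift_op a3 (ext s d))) m =
  shift_sign s ^+ 3 * ext s (psmul (psmul (num s a1) (psmul (num s a2) (num s a3))) d)
    (m + s%:Z + s%:Z + s%:Z).
Proof.
move=> n1 n2 n3.
have -> : shift_op a3 (ext s d) = fun i => shift_sign s *
    ext s (psmul (num s a3) d) (i + s%:Z).
  by apply/funext => i; rewrite shift_ext.
have -> : shift_op a2 (fun i => shift_sign s *
    ext s (psmul (num s a3) d) (i + s%:Z)) = fun i => shift_sign s ^+ 2 *
    ext s (psmul (num s a2) (psmul (num s a3) d)) (i + (s%:Z + s%:Z)).
  by apply/funext => i; rewrite shift_op_comp shift_ext// mulrA -expr2 addrA.
rewrite shift_op_comp shift_ext// mulrA -exprSr !psmulA.
by congr (_ * ext _ _ _); rewrite !addrA addrAC.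
Qed.

(** Raising the row [i] multiplies [psi z] by [- g x z / g z x], where
    [x = px l i]: the factor of that row is the only one to change. *)
Lemma psi_up s N l i (m : int) : (i < N)%N ->
  \sum_(a < 4) gcoef q1 q2 q3 a *
    (px l i ^+ (3 - a) * ext s (psi_ser s N (up l i)) (m + a%:Z)) =
  - \sum_(a < 4) gcoef q1 q2 q3 a *
    (px l i ^+ a * ext s (psi_ser s N l) (m + (3 - a)%N%:Z)).
Proof.
move=> iN; rewrite gsum_shift gsum_shift' opprK.
set x := px l i; have x0 : x != 0 := px0 l i.
have [n1 n2 n3] : [/\ q1 * x != 0, q2 * x != 0 & q3 * x != 0].
  by split; exact: mulf_neq0.
have [d1 d2 d3] : [/\ x / q1 != 0, x / q2 != 0 & x / q3 != 0].
  by split; rewrite mulf_neq0// invr_neq0.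
rewrite !shift_ext3//; congr (_ * ext _ _ _).
have [R hR] := psi_ser_split s l iN.
rewrite (hR l)// (hR (up l i)) => [|j ji]; last exact: up_neq.
rewrite !psmulA; congr psmul; rewrite /psi_row.
have -> : py (up l i) i = x by exact: py_up.
have -> : px (up l i) i = q1 * x by rewrite /px pt_up_eq -mulrA.
have -> : py l i = x / q1 by [].
have -> : x / q1 / q3 = q2 * x by rewrite q2E; field; rewrite hq3 hq1.
have -> : x / q2 = q3 * (q1 * x).
  by rewrite q2E; field; rewrite hq3 hq1 oner_eq0.
have := num_den s n1; have := num_den s d1.
move: (num s (q1 * x)) (den s (q1 * x)) (num s (x / q1)) (den s (x / q1)) => a1 b1 a2 b2 e2 e1.
move: (num s (q2 * x)) (num s (q3 * x)) (num s (x / q3)) (num s (q3 * (q1 * x)))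
  (den s x) => m1 m2 m3 m4 m5.
rewrite [LHS](@psmul F).[ACl 1*6*(2*3*4*5*7)] /= e1.
by rewrite [RHS](@psmul F).[ACl 1*7*(5*4*2*3*6)] /= e2.
Qed.

(** * Residues of psi and the commutator of e and f *)

Lemma count_le1 (T : eqType) (p : pred T) (s : seq T) : uniq s ->
  {in s &, forall x y, p x -> p y -> x = y} -> (count p s <= 1)%N.
Proof.
move=> us inj; rewrite -size_filter.
case e : (filter p s) => [|x [|y s']] //.
have us' : uniq (filter p s) by rewrite filter_uniq.
have : x \in filter p s by rewrite e mem_head.
have : y \in filter p s by rewrite e !inE eqxx orbT.
rewrite !mem_filter => /andP[py ys] /andP[px xs].
by move: us'; rewrite e /= inE (inj x y)// eqxx.
Qed.

Lemma count_gt0 (T : eqType) (p : pred T) (s : seq T) x :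
  x \in s -> p x -> (0 < count p s)%N.
Proof. by move=> xs px; rewrite -has_count; apply/hasP; exists x. Qed.

Lemma px_inj N l i j : adm N l -> (i < N)%N -> (j < N)%N ->
  px l i = px l j -> i = j.
Proof.
move=> al; wlog ij : i j / (i <= j)%N.
  by move=> h iN jN e; case: (leqP i j) => [/h|/ltnW/h]; [exact|move=> ->].
move=> iN jN /(mulIf hu) e.
have [|||b [e1 _ b0]] :=
  pt_coincidence al (i := i) (j := j) (p := 0) (s := 0) => //.
- by rewrite ij.
- by rewrite !expr0z !mul1r.
have b00 : b = 0%N by lia.
by rewrite b00 in e1; lia.
Qed.

Lemma py_inj N l i j : adm N l -> (i < N)%N -> (j < N)%N ->
  py l i = py l j -> i = j.
Proof.
move=> al iN jN /(mulIf (invr_neq0 hq1)); exact: (px_inj al).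
Qed.

(** This lemma and the next two list the possible collisions between poles. *)
Lemma px_eq_py N l i j : adm N l -> (i < N)%N -> (j < N)%N ->
  px l i = py l j -> i = (j + k.+1)%N /\ l j - l i = r%:Z.
Proof.
move=> al iN jN e.
have {}e : q1 * pt l i = pt l j.
  apply: (mulIf hu); apply: (mulIf (invr_neq0 hq1)).
  by rewrite -/(py l j) -e /px; field.
case: (leqP j i) => [ji|ij].
  have [|||b [e1 e2 b1]] :=
    pt_coincidence al (i := j) (j := i) (p := 1) (s := 0) => //.
  - by rewrite ji.
  - by rewrite expr0z mulr1 expr1z.
  case: b e1 e2 b1 => [|[|b]] e1 e2 b1; last by lia.
    by have ij : i = j; [lia|rewrite ij in e2; exfalso; lia].
  by split; lia.
have [|||b [e1 e2 b1]] :=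
    pt_coincidence al (i := i) (j := j) (p := -1) (s := 0) => //.
- by rewrite ltnW.
- by rewrite expr0z mulr1 exprN1 -e mulKf.
Qed.

Lemma px_eq_py3 N l i j : adm N l -> (i < N)%N -> (j < N)%N ->
  px l i = py l j / q3 -> i = (j + k)%N.
Proof.
move=> al iN jN e.
have {}e : q1 * q3 * pt l i = pt l j.
  apply: (mulIf hu); apply: (mulIf (invr_neq0 hq1)); apply: (mulIf (invr_neq0 hq3)).
  by rewrite -/(py l j) -e /px; field; rewrite hq1 hq3.
case: (leqP j i) => [ji|ij].
  have [|||b [e1 e2 b1]] :=
    pt_coincidence al (i := j) (j := i) (p := 1) (s := 1) => //.
  - by rewrite ji.
  by case: b e1 e2 b1 => [|[|b]] e1 e2 b1; lia.
have [|||b [e1 e2 b1]] :=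
    pt_coincidence al (i := i) (j := j) (p := -1) (s := -1) => //.
- by rewrite ltnW.
- by rewrite !exprN1 -e -invfM mulKf// mulf_neq0.
Qed.

Lemma py_eq_py3 N l i j : adm N l -> (i < N)%N -> (j < N)%N ->
  py l i = py l j / q3 -> j = i.+1.
Proof.
move=> al iN jN e.
have {}e : q3 * pt l i = pt l j.
  apply: (mulIf hu); apply: (mulIf (invr_neq0 hq1)); apply: (mulIf (invr_neq0 hq3)).
  by rewrite -/(py l j) -e /py; field; rewrite hq1 hq3.
case: (leqP j i) => [ji|ij].
  have [|||b [e1 e2 b1]] :=
    pt_coincidence al (i := j) (j := i) (p := 0) (s := 1) => //.
  - by rewrite ji.
  - by rewrite expr0z expr1z mul1r.
  by case: b e1 e2 b1 => [|b] e1 e2 b1; lia.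
have [|||b [e1 e2 b1]] :=
    pt_coincidence al (i := i) (j := j) (p := 0) (s := -1) => //.
- by rewrite ltnW.
- by rewrite expr0z mul1r !exprN1 -e mulKf.
have b00 : b = 0%N by lia.
by rewrite b00 in e1; lia.
Qed.

Lemma px_pred l i : l i.+1 = l i -> px l i.+1 = q3 * px l i.
Proof.
by move=> e; rewrite /px /pt e intS expfzDr// expr1z; ring.
Qed.

(** Poles collide in two ways.  If [px l (j + k.+1) = py l j], then [l] is constant
    on the rows [j], [j.+1] and on the rows [j + k], [j + k.+1], and
    [q3 * px l (j + k)] and [py l j.+1 / q3] are zeros there.  If a pole
    [py l j.+1 / q3] of [beta] meets [py l j], it is a zero from the row [j.+1],
    and [py l j] is a second one, either from [beta] or as [q3 * px l (j + k)]. *)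
Lemma count_poles N l b : adm N l -> (k < N)%N ->
  (forall j, (N - k <= j < N)%N -> l j = l0 j) ->
  l N.-1 = l (N.-1 - k)%N - r%:Z ->
  (count_mem b (poles N l) <= maxn 1 (count_mem b (zeros N l)))%N.
Proof.
move=> al kN tl gapN; rewrite /poles /zeros !count_cat !count_map.
set nX := count _ (index_iota 0 N); set nY := count _ (index_iota 0 N).
set nB := count _ (index_iota (N - k) N).
set mX := count _ (index_iota 0 N); set mY := count _ (index_iota 0 N).
set mB := count _ (index_iota (N - k) N).
have pyl0 j : (N - k <= j < N)%N -> py l0 j = py l j.
  by move=> /tl e; rewrite /py (pt_ext e).
have nX1 : (nX <= 1)%N.
  apply: count_le1 (iota_uniq _ _) _ => i j; rewrite !mem_index_iota /=.
  by move=> iN jN /eqP<- /eqP e; apply: (px_inj al).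
have nY1 : (nY <= 1)%N.
  apply: count_le1 (iota_uniq _ _) _ => i j; rewrite !mem_index_iota /=.
  by move=> iN jN /eqP<- /eqP e; apply: (py_inj al).
have nB1 : (nB <= 1)%N.
  apply: count_le1 (iota_uniq _ _) _ => i j; rewrite !mem_index_iota /=.
  move=> iN jN /eqP<- /eqP; rewrite !pyl0// => /(mulIf (invr_neq0 hq3)) e.
  by case/andP: iN => _ iN; case/andP: jN => _ jN; apply: (py_inj al).
have nXP : (0 < nX)%N -> exists2 i, (i < N)%N & px l i = b.
  rewrite -has_count => /hasP[x]; rewrite mem_index_iota /= => xN /eqP.
  by exists x.
have nYP : (0 < nY)%N -> exists2 i, (i < N)%N & py l i = b.
  rewrite -has_count => /hasP[x]; rewrite mem_index_iota /= => xN /eqP.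
  by exists x.
have nBP : (0 < nB)%N -> exists i, [/\ (N - k <= i)%N, (i < N)%N & py l i / q3 = b].
  rewrite -has_count => /hasP[x]; rewrite mem_index_iota /= => xN /eqP e.
  by exists x; rewrite -pyl0//; case/andP: xN.
have mXP i : (i < N)%N -> q3 * px l i = b -> (0 < mX)%N.
  by move=> iN e; apply: (@count_gt0 _ _ _ i); rewrite ?mem_index_iota//=; apply/eqP.
have mYP i : (i < N)%N -> py l i / q3 = b -> (0 < mY)%N.
  by move=> iN e; apply: (@count_gt0 _ _ _ i); rewrite ?mem_index_iota//=; apply/eqP.
have mBP i : (N - k <= i < N)%N -> py l i = b -> (0 < mB)%N.
  move=> iN e; apply: (@count_gt0 _ _ _ i); rewrite ?mem_index_iota//=.
  by apply/eqP; rewrite pyl0.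
clearbody nX nY nB mX mY mB.
have XY : (0 < nX)%N -> (0 < nY)%N -> [/\ (0 < mX)%N, (0 < mY)%N & nB = 0%N].
  move=> /nXP[x xN ex] /nYP[j jN ej].
  have [ij lij] := px_eq_py al xN jN (etrans ex (esym ej)).
  rewrite addnS in ij; subst x.
  have g1 : r%:Z <= l j - l (j + k)%N by apply: al.2; lia.
  have g2 : r%:Z <= l j.+1 - l (j.+1 + k)%N by apply: al.2; lia.
  have m1 := al.1 (j + k)%N xN; have m2 : l j.+1 <= l j by apply: al.1; lia.
  rewrite addSn in g2.
  have e1 : l (j + k).+1 = l (j + k)%N by lia.
  have e2 : l (j.+1 + k)%N = l j.+1 - r%:Z by rewrite addSn; lia.
  split.
  - by apply: (mXP (j + k)%N); [exact: ltnW|rewrite -(px_pred e1)].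
  - apply: (mYP j.+1); first by lia.
    rewrite -ex -addSn px_shift//.
    by rewrite /py q2E /px; field; rewrite hq1 hq3.
  - apply/eqP; rewrite -leqn0 leqNgt; apply/negP => /nBP[h [hN1 hN2 eh]].
    by have := px_eq_py3 al xN hN2 (etrans ex (esym eh)); lia.
have XB : (0 < nX)%N -> nB = 0%N.
  move=> /nXP[x xN ex].
  apply/eqP; rewrite -leqn0 leqNgt; apply/negP => /nBP[h [hN1 hN2 eh]].
  have := px_eq_py3 al xN hN2 (etrans ex (esym eh)); lia.
have YB : (0 < nY)%N -> (0 < nB)%N -> (0 < mY)%N /\ ((0 < mX)%N \/ (0 < mB)%N).
  move=> /nYP[x xN ex] /nBP[j [jN1 jN2 ej]].
  have ji := py_eq_py3 al xN jN2 (etrans ex (esym ej)).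
  split; first exact: (mYP j).
  case: (leqP (N - k) x) => [iNk|iNk].
    by right; apply: (mBP x); rewrite ?iNk.
  left; have ik : x = (N.-1 - k)%N by lia.
  apply: (mXP (x + k)%N); first by lia.
  rewrite px_shift; last by rewrite ik subnK//; lia.
  by rewrite -ex /px /py q2E; field; rewrite hq1 hq3.
move: XY XB YB nX1 nY1 nB1; clear=> XY XB YB.
case: nX XY XB => [|[|//]] XY XB _; last first.
  rewrite (XB isT); case: nY XY {YB} => [|[|//]] XY _ _.
    by rewrite leq_maxl.
  by have [m1 m2 _] := XY isT isT; lia.
case: nY YB {XY} => [|[|//]] YB _; first by move=> nB1; lia.
case: nB YB {XB} => [|[|//]] YB _; first by lia.
by have [m1 [m2|m2]] := YB isT isT; lia.
Qed.

(** [rho (px l j / b)] is the value at [z = b] of the factor of [psi] contributed by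
    the row [j]. *)
Definition rho (Z : F) : F :=
  ((1 - q3 * Z) * (1 - Z / q1 / q3)) / ((1 - Z) * (1 - Z / q1)).

Lemma phi_rho Z : phi (Z / q1) = rho Z.
Proof.
rewrite /phi /rho; congr (_ / _); last first.
  by rewrite mulrC; congr (_ * _); field.
by rewrite mulrC; congr (_ * _); field.
Qed.

Lemma phi_rho_inv Z : Z != 0 -> phi Z^-1 = rho Z.
Proof.
move=> Z0; rewrite /phi /rho.
have -> : 1 - Z^-1 / q3 = (1 - q3 * Z) * - (q3 * Z)^-1.
  by field; rewrite hq3 Z0.
have -> : 1 - q1 * q3 * Z^-1 = (1 - Z / q1 / q3) * - (q1 * q3 / Z).
  by field; rewrite hq1 hq3 Z0.
have -> : 1 - Z^-1 = (1 - Z) * - Z^-1 by field.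
have -> : 1 - q1 * Z^-1 = (1 - Z / q1) * - (q1 / Z).
  by field; rewrite hq1 Z0.
have [->|h1] := eqVneq (1 - Z) 0; first by rewrite !(mul0r, mulr0, invr0).
have [->|h2] := eqVneq (1 - Z / q1) 0; first by rewrite !(mul0r, mulr0, invr0).
have h2' : q1 - Z != 0.
  by move: h2; apply: contraNneq => /subr0_eq <-; rewrite mulfV// subrr.
by field; rewrite hq1 h2' h1 hq3 Z0 !oppr_eq0 hq1 oner_eq0.
Qed.

(** Raising the row [i] and lowering it back meets every other row once, above
    through [ecf] and below through [fcf]; both times the factor is [rho]. *)
Lemma ecf_fcf N l i (iN : (i < N)%N) : ecf l i * fcf N (up l i) i =
  \prod_(j < N | j != Ordinal iN) rho (px l j / px l i).
Proof.
have -> : ecf l i = \prod_(j < N | (j < i)%N) phi (pt l i / pt l j).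
  exact: (big_ord_widen N (fun j : nat => phi (pt l i / pt l j)) (ltnW iN)).
have pxE j : px l j / px l i = pt l j / pt l i.
  by rewrite /px; field; rewrite pt0 hu.
rewrite [RHS](bigID (fun j : 'I_N => (j < i)%N)) /=; congr (_ * _).
  apply: eq_big => j; first rewrite andbC.
    by case: ltngtP => //= e; apply/esym/eqP => h; move: e; rewrite h /= ltnn.
  move=> _; have Zn : pt l j / pt l i != 0 by rewrite mulf_neq0// invr_neq0.
  by rewrite pxE -(phi_rho_inv Zn) invf_div.
apply: eq_big => j.
  rewrite -leqNgt ltn_neqAle; congr (_ && _); rewrite eq_sym.
  by rewrite -val_eqE /=.
move=> ij; rewrite pxE -phi_rho pt_up_eq pt_up_neq; last by rewrite gtn_eqF.
by rewrite invfM; congr phi; rewrite mulrCA mulrC.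
Qed.

Lemma rval_row N l i (iN : (i < N)%N) (t : seq F) b : (k <= N)%N -> b != 0 ->
  rval (zeros N l) (t ++ [seq px l j | j <- [seq j <- index_iota 0 N | j != i]] ++
     [seq py l j | j <- [seq j <- index_iota 0 N | j != i]] ++
     [seq py l0 j / q3 | j <- index_iota (N - k) N]) b =
  ((1 - q3 * px l i / b) * (1 - py l i / q3 / b)) / (\prod_(x <- t) (1 - x / b)) *
  (\prod_(j < N | j != Ordinal iN) rho (px l j / b)) *
  reval (beta k cs q1 q3 u N) b.
Proof.
move=> kN b0; rewrite reval_beta // /rval /zeros.
rewrite [X in _ = _ * X]prodf_div !big_cat !big_map !big_filter /=.
rewrite 2!(big_mkord xpredT) 2!(big_mkord (fun j => j != i)).
rewrite (bigD1 (Ordinal iN)) //= [X in _ * (X * _) / _](bigD1 (Ordinal iN))//=.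
have -> : \prod_(j < N | j != Ordinal iN) rho (px l j / b) =
   (\prod_(j < N | j != Ordinal iN) (1 - q3 * px l j / b)) *
   (\prod_(j < N | j != Ordinal iN) (1 - py l j / q3 / b)) /
   ((\prod_(j < N | j != Ordinal iN) (1 - px l j / b)) *
   (\prod_(j < N | j != Ordinal iN) (1 - py l j / b))).
  rewrite -!big_split -prodf_div; apply: eq_bigr => j _.
  by rewrite /rho; congr ((_ * _) / (_ * _)); rewrite /py /px; field;
    rewrite ?hq1 ?hq3 b0.
have eqN (f : nat -> F) : \prod_(j < N | (j : nat) != i) f j =
   \prod_(j < N | j != Ordinal iN) f j by [].
rewrite (eqN (fun j => 1 - px l j / b)) (eqN (fun j => 1 - py l j / b)) !invfM.
by ring.
Qed.

Lemma poles_perm N l i : (i < N)%N -> perm_eq (poles N l)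
  (px l i :: py l i :: [seq px l j | j <- [seq j <- index_iota 0 N | j != i]] ++
     [seq py l j | j <- [seq j <- index_iota 0 N | j != i]] ++
     [seq py l0 j / q3 | j <- index_iota (N - k) N]).
Proof.
move=> iN; have pi : perm_eq (index_iota 0 N)
    (i :: [seq j <- index_iota 0 N | j != i]).
  rewrite -rem_filter ?iota_uniq//; apply: perm_to_rem.
  by rewrite mem_index_iota.
rewrite /poles; apply: (perm_trans (perm_cat (perm_map _ pi)
  (perm_cat (perm_map _ pi) (perm_refl _)))).
rewrite /= perm_cons; exact/permPl/(perm_catCA _ [:: py l i]).
Qed.

Lemma q1_neq1 : q1 != 1.
Proof.
apply/eqP => q11; have [|a [a1 a2]] := @hgen 1 0.
  by rewrite q11 exp1rz expr0z mul1r.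
by have a0 : a = 0; [nia|rewrite a0 mulr0 in a1].
Qed.

Lemma px_neq_py l i : px l i != py l i.
Proof.
rewrite -subr_eq0; have -> : px l i - py l i = px l i * (q1 - 1) / q1.
  by rewrite /py /px; field.
by rewrite mulf_neq0 ?invr_neq0// mulf_neq0// subr_eq0 q1_neq1.
Qed.

Lemma res_px N l i (iN : (i < N)%N) : (k <= N)%N ->
  res (zeros N l) (poles N l) (px l i) =
  (1 - q3) * (1 - q2) / (1 - q1^-1) *
  (ecf l i * fcf N (up l i) i * reval (beta k cs q1 q3 u N) (px l i)).
Proof.
move=> kN; rewrite (res_perm _ (perm_refl _) (poles_perm _ iN)) /res /= eqxx.
have := @rval_row N l i iN [:: py l i] (px l i) kN (px0 l i).
rewrite /= => ->; rewrite ecf_fcf big_seq1 -[LHS]mulrA; congr (_ * _).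
rewrite -[py l i]/(px l i / q1) q2E; move: (px l i) (px0 l i) q1_neq1 => x x0 h.
by field; rewrite hq1 hq3 x0 subr_eq0 h.
Qed.

Lemma res_py N l i (iN : (i < N)%N) : (k <= N)%N ->
  res (zeros N l) (poles N l) (py l i) =
  (1 - q2^-1) * (1 - q3^-1) / (1 - q1) *
  (ecf (dn l i) i * fcf N l i * reval (beta k cs q1 q3 u N) (py l i)).
Proof.
move=> kN; rewrite (res_perm _ (perm_refl _) (poles_perm _ iN)) /res /=.
rewrite (negPf (px_neq_py l i)) eqxx.
have := @rval_row N l i iN [:: px l i] (py l i) kN (py0 l i).
rewrite /= => ->.
have := ecf_fcf (dn l i) iN; rewrite dnK px_dn => ->.
have -> : \prod_(j < N | j != Ordinal iN) rho (px (dn l i) j / py l i) =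
          \prod_(j < N | j != Ordinal iN) rho (px l j / py l i).
  apply: eq_bigr => j ji; rewrite /px (pt_ext (l := dn l i) (l' := l))//.
  by rewrite /dn (negPf (_ : (j : nat) != i)) ?subr0.
rewrite big_seq1 -[LHS]mulrA; congr (_ * _).
rewrite -[py l i]/(px l i / q1) q2E; move: (px l i) (px0 l i) q1_neq1 => x x0 h.
by field; rewrite subr_eq0 eq_sym h hq3 hq1 oner_eq0 x0.
Qed.

Lemma g11_neq0 : g 1 1 != 0.
Proof.
have h2 : 1 != q2.
  apply/eqP => e; have [|a [a1 a2]] := @hgen 1 1.
    by rewrite !expr1z -[q1 * q3]invrK -q2E -e invr1.
  by nia.
have h3 : 1 != q3.
  apply/eqP => e; have [|a [a1 a2]] := @hgen 0 1.
    by rewrite -e exp1rz expr0z mul1r.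
  by nia.
by rewrite /Defs.g !mulr1; apply: mulf_neq0; first apply: mulf_neq0;
  rewrite subr_eq0// eq_sym q1_neq1.
Qed.

(** The poles of [beta] do not contribute: in the last [k] rows [l] is the ground
    state, so [py l j / q3] is also a zero. *)
Lemma ef_diag N l (n : int) : adm N l -> (k < N)%N ->
  (forall j, (N - k <= j < N)%N -> l j = l0 j) ->
  l N.-1 = l (N.-1 - k)%N - r%:Z ->
  (g 1 1)^-1 * (ext true (psi_ser true N l) n - ext false (psi_ser false N l) n)
  = (1 - q1)^-1 * (- (1 - q1^-1))^-1 * \sum_(i < N)
    (ecf (dn l i) i * (reval (beta k cs q1 q3 u N) (py l i) * fcf N l i) * py l i ^ n
   - ecf l i * (reval (beta k cs q1 q3 u N) (px l i) * fcf N (up l i) i) * px l i ^ n).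
Proof.
move=> al kN tl gapN; have kN' := ltnW kN.
have pyl0 j : (N - k <= j < N)%N -> py l0 j = py l j.
  by move=> /tl e; rewrite /py (pt_ext e).
rewrite partial_fractions; last first.
- by move=> b _; exact: count_poles.
- apply/allP => b; rewrite !mem_cat => /or3P[] /mapP[j _ ->] /=.
  + exact: px0.
  + exact: py0.
  + by rewrite mulf_neq0 ?invr_neq0 ?py_neq0.
- apply/allP => b; rewrite !mem_cat => /or3P[] /mapP[j _ ->] /=.
  + by rewrite mulf_neq0.
  + by rewrite mulf_neq0 ?invr_neq0.
  + exact: py_neq0.
- by rewrite !size_cat !size_map.
rewrite {2}/poles !big_cat !big_map /= [X in _ + (_ + X)]big_nat_cond.
rewrite [X in _ + (_ + X)]big1 ?addr0 => [|j]; last first.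
  rewrite andbT => jN; rewrite res_zero ?mul0r//.
    by rewrite mulf_neq0 ?invr_neq0 ?py_neq0.
  rewrite /zeros !mem_cat pyl0//; apply/or3P/Or32/map_f.
  by rewrite mem_index_iota; case/andP: jN.
rewrite !big_mkord -big_split /= !mulr_sumr; apply: eq_bigr => i _.
rewrite (res_px _ (ltn_ord i))// (res_py _ (ltn_ord i))//.
have [a1 a2 a3] : [/\ 1 - q1 != 0, 1 - q2 != 0 & 1 - q3 != 0].
  by have := g11_neq0; rewrite /Defs.g !mulr1 !mulf_eq0 !negb_or => /andP[/andP[]].
have a2' : q1 * q3 - 1 != 0.
  apply: contraNneq a2 => /subr0_eq e.
  by rewrite q2E e invr1 subrr.
have a1' : q1 - 1 != 0 by rewrite -opprB oppr_eq0.
rewrite /Defs.g !mulr1 q2E.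
move: (ecf l i) (fcf N (up l i) i) (reval (beta k cs q1 q3 u _) (px l i))
  (px l i ^ n) => x1 x2 x3 x4.
move: (ecf (dn l i) i) (fcf N l i) (reval (beta k cs q1 q3 u _) (py l i))
  (py l i ^ n) => y1 y2 y3 y4.
by field; rewrite hq1 oppr_eq0 a1' hq3 oner_eq0 a3 a2'.
Qed.

(** * Stabilisation of the operators on semi-infinite sequences *)

Lemma inf_adm N l : inf l -> adm N l.
Proof. by case=> mono gap _; split=> j _; [exact: mono|exact: gap]. Qed.

Lemma tail_le J J' l : (J <= J')%N -> tail J l -> tail J' l.
Proof. by move=> JJ tl j Jj; apply: tl; exact: leq_trans Jj. Qed.

Lemma tail_gap J l i : tail J l -> (J <= i)%N -> l (i + k)%N = l i - r%:Z.
Proof.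
move=> tl Ji; rewrite (tl i Ji) (tl (i + k)%N (leq_trans Ji (leq_addr k i))).
exact: lambda0_shift.
Qed.

(** The gap condition is an equality in the tail. *)
Lemma ecf_tail J l i : tail J l -> (J + k <= i)%N -> ecf l i = 0.
Proof.
move=> tl Ji; have ki : (k <= i)%N by apply: leq_trans Ji; exact: leq_addl.
apply: (ecf_eq0_gap ki).
have := tail_gap tl (i := (i - k)%N); rewrite subnK// => ->; last by lia.
by rewrite opprB addrC subrK.
Qed.

Lemma inf_up J l i : inf l -> tail J l -> ecf l i != 0 ->
  inf (up l i) /\ tail (J + k) (up l i).
Proof.
move=> il tl nz; have iJ : (i < J + k)%N.
  by rewrite ltnNge; apply: contraNN nz => Ji; rewrite (ecf_tail tl).
have tl' : tail (J + k) (up l i).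
  move=> j Jj; rewrite up_neq; last by rewrite gtn_eqF// (leq_trans iJ).
  by apply: tl; apply: leq_trans Jj; exact: leq_addr.
split=> //; have ai N : (i < N)%N -> adm N (up l i).
  move=> iN; have [h1 h2] := ecf_adm (inf_adm N il) iN nz.
  exact: (adm_up hk hr (inf_adm N il)).
split; last by exists (J + k)%N.
  by move=> j; apply: (ai (maxn j.+2 i.+1) (leq_maxr _ _)).1; exact: leq_maxl.
move=> j; apply: (ai (maxn (j + k).+1 i.+1) (leq_maxr _ _)).2; exact: leq_maxl.
Qed.

(** The coefficient of [f], corrected by [beta] at the support of the delta
    function. *)
Definition bfcf N l i : F := reval (beta k cs q1 q3 u N) (py l i) * fcf N l i.

Lemma bfcf_last N l i : (k <= N)%N -> (N - k <= i < N)%N -> l i = l0 i ->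
  bfcf N l i = 0.
Proof.
move=> kN iN li; rewrite /bfcf reval_beta//.
have -> : \prod_(N - k <= j < N)
    ((1 - py l0 j / py l i) / (1 - py l0 j / q3 / py l i)) = 0.
  apply/eqP; rewrite prodf_seq_eq0; apply/hasP; exists i.
    by rewrite mem_index_iota.
  by rewrite /py (pt_ext li) mulfV ?subrr ?mul0r ?py0//= ?eqxx.
by rewrite mul0r.
Qed.

Lemma bfcf_tail J N l i : inf l -> tail J l -> (J + k <= N)%N -> (i < N)%N ->
  (J <= i)%N -> bfcf N l i = 0.
Proof.
move=> il tl JN iN Ji; have kN : (k <= N)%N by apply: leq_trans JN; exact: leq_addl.
case: (leqP (N - k) i) => [Ni|iNk].
  by rewrite bfcf_last ?Ni//; exact: tl.
apply/eqP; rewrite /bfcf mulf_eq0; apply/orP; right; apply/negPn/negP => nz.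
have [_ h] := fcf_adm (inf_adm N il) iN nz.
have := tail_gap tl Ji; have := h ltac:(lia); lia.
Qed.

Lemma inf_dn J N l i : inf l -> tail J l -> (J + k <= N)%N -> (i < N)%N ->
  bfcf N l i != 0 -> inf (dn l i) /\ tail J (dn l i).
Proof.
move=> il tl JN iN nz; have iJ : (i < J)%N.
  by rewrite ltnNge; apply: contraNN nz => Ji; rewrite (bfcf_tail il tl).
have tl' : tail J (dn l i).
  move=> j Jj; rewrite /dn gtn_eqF ?subr0; first exact: tl.
  exact: leq_trans Jj.
split=> //; have nz' : fcf N l i != 0.
  by apply: contraNneq nz => e; rewrite /bfcf e mulr0.
have [h1 h2] := fcf_adm (inf_adm N il) iN nz'.
have {}h1 := h1 ltac:(lia); have {}h2 := h2 ltac:(lia).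
have [mono gap _] := il.
split; last by exists J.
  move=> j; rewrite /dn; have := mono j; have [e|e] := eqVneq j i.
    by rewrite e; case: eqP; move: h1; clear; lia.
  by case: eqP; lia.
move=> j; rewrite /dn; have := gap j; have [e|e] := eqVneq j i.
  by rewrite e; case: eqP; move: h2; clear; lia.
by case: eqP; lia.
Qed.

Lemma ket_ninf l : ~ inf l -> ket l = 0.
Proof. by move=> nl; rewrite /inf_ket insubF//; apply/asboolP. Qed.

Lemma ket_val (l : inf_set k r cs) : ket (val l) = << l >>.
Proof. by rewrite /inf_ket valK. Qed.

Lemma inf_val (l : inf_set k r cs) : inf (val l).
Proof. by have := valP l => /asboolP. Qed.

Definition ce : F := (1 - q1)^-1.
Definition cf : F := (- (1 - q1^-1))^-1.

(** The operators on [N] rows, with values in the semi-infinite space. *)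
Definition eop N (n : int) l : inf_space F k r cs :=
  ce *: \sum_(i < N) (ecf l i * px l i ^ n) *: ket (up l i).

Definition fop N (n : int) l : inf_space F k r cs :=
  cf *: \sum_(i < N) (bfcf N l i * py l i ^ n) *: ket (dn l i).

Lemma eop_stable J N N' n l : inf l -> tail J l -> (J + k <= N)%N ->
  (N <= N')%N -> eop N' n l = eop N n l.
Proof.
move=> il tl JN NN; rewrite /eop; congr (_ *: _).
rewrite [RHS](big_ord_widen N' (fun i : nat => (ecf l i * px l i ^ n) *: ket (up l i)))//.
rewrite [LHS](bigID (fun i : 'I_N' => (i < N)%N)) /= [X in _ + X]big1 ?addr0// => i.
by rewrite -leqNgt => Ni; rewrite (ecf_tail tl) ?(leq_trans JN)// mul0r scale0r.
Qed.

(** A new row [N] multiplies the coefficient by [phi (pt l N / pt l i)] and replaces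
    the factor of [beta] at [N - k] by the one at [N]; the two changes cancel
    because [pt l N = q2 * pt l (N - k)].  For [i >= N - k] the coefficient
    vanishes on both sides, through [beta] or, at [i = N - k], through [phi]. *)
Lemma bfcf_stable J N l i : inf l -> tail J l -> (J + k <= N)%N -> (i < N)%N ->
  bfcf N.+1 l i = bfcf N l i.
Proof.
move=> il tl JN iN; have kN : (k <= N)%N by apply: leq_trans JN; exact: leq_addl.
have fE : fcf N.+1 l i = fcf N l i * phi (pt l N / pt l i).
  by rewrite /fcf big_mkcond big_ord_recr /= iN -big_mkcond.
case: (ltnP i (N - k)) => [iNk|iNk]; last first.
  rewrite [RHS]bfcf_last ?iNk//; last by apply: tl; lia.
  case: (leqP (N.+1 - k) i) => [h|h].
    rewrite bfcf_last ?h// ?(leq_trans kN)// 1?ltnW//.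
    by apply: tl; lia.
  have iE : i = (N - k)%N by lia.
  rewrite /bfcf fE; have -> : pt l N = q2 * pt l i.
    rewrite -[in LHS](subnK kN) -iE pt_shift//.
    by apply: tail_gap tl _; lia.
  have -> : phi (q2 * pt l i / pt l i) = 0.
    by rewrite mulfK// /phi [q1 * q3 * q2]mulrAC hq subrr mulr0 mul0r.
  by rewrite !mulr0.
rewrite /bfcf !reval_beta//; last by rewrite leqW.
rewrite fE subSn// big_nat_recr/=; last by rewrite ltn_subrL hk (leq_trans hk).
rewrite [X in _ = X * _](@big_ltn _ _ _ (N - k) N); last first.
  by rewrite ltn_subrL hk (leq_trans hk).
set B := \prod_(_ <= _ < _) _; set bN := _ / (1 - py l0 N / q3 / _).
set b1 := _ / (1 - py l0 (N - k) / q3 / _).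
suff key : bN * phi (pt l N / pt l i) = b1.
  by rewrite -key mulrACA -[RHS]mulrA [RHS]mulrC -!mulrA; congr (_ * _);
     rewrite mulrCA [RHS]mulrCA; congr (_ * _); rewrite mulrC.
rewrite /bN /b1 {B bN b1}.
have e1 : py l0 N = py l N by rewrite /py (pt_ext (l := l0) (l' := l))// tl//; lia.
have e2 : py l0 (N - k) = py l (N - k).
  by rewrite /py (pt_ext (l := l0) (l' := l))// tl//; lia.
have n1 : 1 - pt l N / pt l i != 0.
  have := ratio_neq (l := l) (i := i) (j := N) (p := 0).
  rewrite expr0z !mul1r; apply; rewrite -[X in X != _]mul1r -(expr0z q1).
  apply: (pt_near (inf_adm N.+1 il)); rewrite ?iN//=.
have n2 : 1 - pt l N / q3 / pt l i != 0.
  rewrite sub1_div//; apply/eqP => e.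
  have [|||b [b1 b2 b3]] := pt_coincidence (inf_adm N.+1 il) (i := i) (j := N)
    (p := 0) (s := -1) => //.
  - by rewrite ltnW//=.
  - by rewrite expr0z mul1r exprN1 mulrC.
  have b0 : b = 0%N by lia.
  by rewrite b0 in b1; lia.
have sh : pt l N = q2 * pt l (N - k).
  rewrite -[in LHS](subnK kN) pt_shift//.
  by apply: tail_gap tl _; lia.
have shw : pt l (N - k) = q1 * q3 * pt l N.
  by rewrite sh q2E mulVKf// mulf_neq0.
rewrite e1 e2 /py /phi shw.
move: (pt l N) (pt l i) (pt0 l i) n1 n2 {sh shw} => y x x0.
have -> : y / q3 / x = y / x / q3 by rewrite mulrAC.
have -> : y * u / q1 / (x * u / q1) = y / x by field; rewrite hq1 x0 hu.
have -> : y * u / q1 / q3 / (x * u / q1) = y / x / q3.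
  by field; rewrite hq1 hq3 x0 hu.
have -> : q1 * q3 * y * u / q1 / (x * u / q1) = q1 * q3 * (y / x).
  by field; rewrite hq1 x0 hu.
have -> : q1 * q3 * y * u / q1 / q3 / (x * u / q1) = q1 * (y / x).
  by field; rewrite hq1 hq3 x0 hu.
move: (y / x) => Y n1 n2.
have [->|n3] := eqVneq (1 - q1 * Y) 0; first by rewrite mulr0 invr0 !mulr0.
have n2' : q3 - Y != 0.
  by apply: contraNneq n2 => /subr0_eq <-; rewrite mulfV// subrr.
by field; rewrite n3 n1 hq3 n2'.
Qed.

Lemma fop_stable J N N' n l : inf l -> tail J l -> (J + k <= N)%N ->
  (N <= N')%N -> fop N' n l = fop N n l.
Proof.
move=> il tl JN; elim: N' => [|N' IH]; first by rewrite leqn0 => /eqP->.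
rewrite leq_eqVlt => /orP[/eqP->//|]; rewrite ltnS => NN.
rewrite -(IH NN) /fop; congr (_ *: _).
have JN' : (J + k <= N')%N := leq_trans JN NN.
have z : bfcf N'.+1 l N' = 0.
  exact: (bfcf_tail il tl (leqW JN') (ltnSn N') (leq_trans (leq_addr k J) JN')).
rewrite big_ord_recr /= z.
rewrite mul0r scale0r addr0; apply: eq_bigr => i _.
by rewrite (bfcf_stable il tl JN').
Qed.

Lemma psi_stable J N N' s l : tail J l -> (J + k <= N)%N -> (N <= N')%N ->
  psi_ser s N' l = psi_ser s N l.
Proof.
move=> tl JN; elim: N' => [|N' IH]; first by rewrite leqn0 => /eqP->.
rewrite leq_eqVlt => /orP[/eqP->//|]; rewrite ltnS => NN.
rewrite -(IH NN) psi_ser_stable//; [lia|apply: tl; lia|apply: tl; lia].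
Qed.

Lemma inf_tail l : inf l -> exists J, tail J l.
Proof. by case. Qed.

Definition tail_of (l : inf_set k r cs) : nat := sval (cid (inf_tail (inf_val l))).

Lemma tail_ofP (l : inf_set k r cs) : tail (tail_of l) (val l).
Proof. by rewrite /tail_of; case: cid. Qed.

(** * The action of the generators *)

(** A number of rows at which the operators on [l] have stabilised. *)
Definition stage_of (l : inf_set k r cs) : nat := tail_of l + k.

Definition eact (n : int) : V -> V :=
  linext (fun l : inf_set k r cs => eop (stage_of l) n (val l)).

Definition fact (n : int) : V -> V :=
  linext (fun l : inf_set k r cs => fop (stage_of l) n (val l)).

Definition pact (s : bool) (n : nat) : V -> V :=
  linext (fun l : inf_set k r cs => psi_ser s (stage_of l) (val l) n *: << l >>).

Lemma eact_linear n : linear (eact n). Proof. exact: linext_linear. Qed.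
Lemma fact_linear n : linear (fact n). Proof. exact: linext_linear. Qed.
Lemma pact_linear s n : linear (pact s n). Proof. exact: linext_linear. Qed.

Lemma inf_lift l : inf l -> exists l' : inf_set k r cs, l = val l'.
Proof. by move=> il; exists (Sub l (introT (asboolP _) il)); rewrite SubK. Qed.

Lemma eact_ket J N n l : inf l -> tail J l -> (J + k <= N)%N ->
  eact n (ket l) = eop N n l.
Proof.
move=> /inf_lift[l' ->] tl JN; rewrite ket_val /eact linextU.
rewrite -(eop_stable n (inf_val l') (@tail_ofP l') (leqnn _) (leq_maxl _ N)).
by rewrite (eop_stable n (inf_val l') tl JN (leq_maxr _ N)).
Qed.

Lemma fact_ket J N n l : inf l -> tail J l -> (J + k <= N)%N ->
  fact n (ket l) = fop N n l.
Proof.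
move=> /inf_lift[l' ->] tl JN; rewrite ket_val /fact linextU.
rewrite -(fop_stable n (inf_val l') (@tail_ofP l') (leqnn _) (leq_maxl _ N)).
by rewrite (fop_stable n (inf_val l') tl JN (leq_maxr _ N)).
Qed.

Lemma pact_ket J N s n l : inf l -> tail J l -> (J + k <= N)%N ->
  pact s n (ket l) = psi_ser s N l n *: ket l.
Proof.
move=> /inf_lift[l' ->] tl JN; rewrite ket_val /pact linextU.
rewrite -(psi_stable s (@tail_ofP l') (leqnn _) (leq_maxl _ N)).
by rewrite (psi_stable s tl JN (leq_maxr _ N)).
Qed.

Definition gen_act (x : egen) : V -> V :=
  match x with
  | Ge n => eact n
  | Gf n => fact n
  | Gpsi s n => pact s n
  | Gpsi0V s => fun v => (if s then 1 else q3 ^+ k)^-1 *: v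
  end.

Lemma gen_act_linear x : linear (gen_act x).
Proof.
case: x => [n|n|s n|s] /=.
- exact: eact_linear.
- exact: fact_linear.
- exact: pact_linear.
- by move=> a v w; rewrite scalerDr !scalerA mulrC.
Qed.
Local Notation FA := (free_act gen_act).
Let FAM := free_actM gen_act_linear.

Lemma FA_e i v : FA (fe F i) v = eact i v.
Proof. exact: free_act_gen. Qed.
Lemma FA_f i v : FA (ff F i) v = fact i v.
Proof. exact: free_act_gen. Qed.

(** The [psi] of the defining relations, extended by 0 to all integers. *)
Definition pext (s : bool) (i : int) (v : V) : V :=
  if (if s then 0 <= i else i <= 0) then pact s `|i|%N v else 0.

Lemma FA_0 v : FA 0 v = 0.
Proof. by have := free_actB gen_act 0 0 v; rewrite !subrr. Qed.

Lemma FA_psi s i v : FA (fpsi F s i) v = pext s i v.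
Proof.
rewrite /fpsi /pext; case: ifP => _; first exact: free_act_gen.
exact: FA_0.
Qed.

Lemma pext_ket J N s i l : inf l -> tail J l -> (J + k <= N)%N ->
  pext s i (ket l) = ext s (psi_ser s N l) i *: ket l.
Proof.
move=> il tl JN; rewrite /pext /ext; case: ifP => _; last by rewrite scale0r.
exact: (pact_ket _ _ il tl JN).
Qed.

Lemma pext_linear s i : linear (pext s i).
Proof.
rewrite /pext; case: (if s then _ else _) => a v w.
  exact: (pact_linear s `|i|%N a v w).
by rewrite scaler0 addr0.
Qed.

(** * The defining relations *)

Lemma FA_gzw D (X : int -> int -> V) m n v : (forall i j, FA (D i j) v = X i j) ->
  FA (gzw_mul q1 q2 q3 D m n) v =
  \sum_(a < 4) gcoef q1 q2 q3 a *: X (m + a%:Z) (n + (3 - a)%N%:Z).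
Proof.
move=> h; apply: (etrans (linfun_sumZ _ _ _ (free_act_linearl gen_act v))).
by apply: eq_bigr => a _; congr (_ *: _); exact: h.
Qed.

Lemma FA_gwz D (X : int -> int -> V) m n v : (forall i j, FA (D i j) v = X i j) ->
  FA (gwz_mul q1 q2 q3 D m n) v =
  \sum_(a < 4) gcoef q1 q2 q3 a *: X (m + (3 - a)%N%:Z) (n + a%:Z).
Proof.
move=> h; apply: (etrans (linfun_sumZ _ _ _ (free_act_linearl gen_act v))).
by apply: eq_bigr => a _; congr (_ *: _); exact: h.
Qed.

Lemma FA_opp x v : FA (- x) v = - FA x v.
Proof. by rewrite -[- x]add0r -[0 - x]/(0 - x) free_actB FA_0 sub0r. Qed.

Lemma FA_rel_zw D D' (X X' : int -> int -> V) m n v :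
  (forall i j, FA (D i j) v = X i j) -> (forall i j, FA (D' i j) v = X' i j) ->
  \sum_(a < 4) gcoef q1 q2 q3 a *: X (m + a%:Z) (n + (3 - a)%N%:Z) +
  \sum_(a < 4) gcoef q1 q2 q3 a *: X' (m + (3 - a)%N%:Z) (n + a%:Z) = 0 ->
  FA (gzw_mul q1 q2 q3 D m n) v = FA (- gwz_mul q1 q2 q3 D' m n) v.
Proof.
move=> h h' e; have e1 := FA_gzw m n h; have e2 := FA_gwz m n h'.
have e3 := FA_opp (gwz_mul q1 q2 q3 D' m n) v.
apply: (etrans e1); apply: (etrans _ (esym e3)); rewrite e2.
by move/eqP: e; rewrite addr_eq0 => /eqP.
Qed.

Lemma FA_rel_wz D D' (X X' : int -> int -> V) m n v :
  (forall i j, FA (D i j) v = X i j) -> (forall i j, FA (D' i j) v = X' i j) ->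
  \sum_(a < 4) gcoef q1 q2 q3 a *: X (m + (3 - a)%N%:Z) (n + a%:Z) +
  \sum_(a < 4) gcoef q1 q2 q3 a *: X' (m + a%:Z) (n + (3 - a)%N%:Z) = 0 ->
  FA (gwz_mul q1 q2 q3 D m n) v = FA (- gzw_mul q1 q2 q3 D' m n) v.
Proof.
move=> h h' e; have e1 := FA_gwz m n h; have e2 := FA_gzw m n h'.
have e3 := FA_opp (gzw_mul q1 q2 q3 D' m n) v.
apply: (etrans e1); apply: (etrans _ (esym e3)); rewrite e2.
by move/eqP: e; rewrite addr_eq0 => /eqP.
Qed.

Lemma FA_ee i j v : FA (fe F i * fe F j) v = eact i (eact j v).
Proof. exact: (etrans (FAM _ _ _) (etrans (FA_e _ _) (congr1 _ (FA_e _ _)))). Qed.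

Lemma FA_ff i j v : FA (ff F i * ff F j) v = fact i (fact j v).
Proof. exact: (etrans (FAM _ _ _) (etrans (FA_f _ _) (congr1 _ (FA_f _ _)))). Qed.

Lemma gcoef_sum x y :
  \sum_(a < 4) gcoef q1 q2 q3 a * (x ^+ a * y ^+ (3 - a)) = g x y.
Proof.
have [g0 g1 g2 g3] := gcoefE.
rewrite !big_ord_recr big_ord0 /= g0 g1 g2 g3 /Defs.g.
have -> : -1 = - (q1 * q2 * q3) :> F by rewrite hq.
rewrite -[(3 - 0)%N]/3%N -[(3 - 1)%N]/2%N -[(3 - 2)%N]/1%N subnn.
by ring.
Qed.

Lemma g_px l i j : g (px l i) (px l j) = u ^+ 3 * g (pt l i) (pt l j).
Proof. by rewrite /px (mulrC (pt l i)) (mulrC (pt l j)) g_hom. Qed.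

Lemma g_py l i j : g (py l i) (py l j) = (u / q1) ^+ 3 * g (pt l i) (pt l j).
Proof.
by rewrite /py -!(mulrA _ u) (mulrC (pt l i)) (mulrC (pt l j)) g_hom.
Qed.

(** A raising may lengthen the part of a sequence that differs from [lambda0] by
    [k] rows, so [N] must leave room for [d] of them; a lowering never lengthens
    it, so one bound serves any number of lowerings. *)
Definition good_e N d l := inf l /\ exists2 J, tail J l & (J + d * k <= N)%N.
Definition good_f N (d : nat) l := inf l /\ exists2 J, tail J l & (J + k <= N)%N.

Lemma good_e_act N d l n : good_e N d.+1 l ->
  eact n (ket l) = ce *: \sum_(i < N) (ecf l i * px l i ^ n) *: ket (up l i).
Proof. by case=> il [J tl JN]; apply: (eact_ket _ il tl); nia. Qed.

Lemma good_e_step N d l i : good_e N d.+1 l -> (i < N)%N -> ecf l i != 0 ->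
  good_e N d (up l i).
Proof.
case=> il [J tl JN] iN nz; have [il' tl'] := inf_up il tl nz.
by split=> //; exists (J + k)%N => //; nia.
Qed.

Lemma good_f_act N d l n : good_f N d.+1 l ->
  fact n (ket l) = cf *: \sum_(i < N) (bfcf N l i * py l i ^ n) *: ket (dn l i).
Proof. by case=> il [J tl JN]; apply: (fact_ket _ il tl JN). Qed.

Lemma good_f_step N d l i : good_f N d.+1 l -> (i < N)%N -> bfcf N l i != 0 ->
  good_f N d (dn l i).
Proof.
case=> il [J tl JN] iN nz; have [il' tl'] := inf_dn il tl JN iN nz.
by split=> //; exists J.
Qed.

Lemma px_up l i j : j != i -> px (up l i) j = px l j.
Proof. by move=> ji; rewrite /px pt_up_neq. Qed.

Lemma pt_dn_neq l i j : j != i -> pt (dn l i) j = pt l j.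
Proof. by move=> ji; apply: pt_ext; rewrite /dn (negPf ji) subr0. Qed.

Lemma py_dn l i j : j != i -> py (dn l i) j = py l j.
Proof. by move=> ji; rewrite /py pt_dn_neq. Qed.

(** Coefficients need comparing only at the vectors of the space, where the target is
    admissible: this is where [pt_far] gets its second hypothesis. *)
Lemma ket_eq0 (a : F) l : (inf l -> a = 0) -> a *: ket l = 0.
Proof.
move=> h; have [il|nil] := pselect (inf l); first by rewrite h// scale0r.
by rewrite ket_ninf// scaler0.
Qed.

Lemma good_ket (l : inf_set k r cs) : exists J,
  [/\ inf (val l), tail J (val l) & << l >> = ket (val l)].
Proof.
exists (tail_of l); split; [exact: inf_val|exact: tail_ofP|].
by rewrite ket_val.
Qed.

Lemma rel_ee_ket m n (l : inf_set k r cs) :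
  FA (gzw_mul q1 q2 q3 (fun i j => fe F i * fe F j) m n) << l >> =
  FA (- gwz_mul q1 q2 q3 (fun i j => fe F j * fe F i) m n) << l >>.
Proof.
have [J [il tl ->]] := good_ket l; move: (val l) il tl => {}l il tl.
apply: (@FA_rel_zw _ _ (fun i j => eact i (eact j (ket l)))
  (fun i j => eact j (eact i (ket l)))) => [i j|i j|]; try exact: FA_ee.
pose N := (J + 2 * k)%N.
have gl : good_e N 2 l by split=> //; exists J.
apply: (quadratic_rel six eact_linear upC px0 px_up (good_e_act (N := N))
  (good_e_step (N := N)) (gc := gcoef q1 q2 q3) (ea := fun a => a)
  (eb := fun a => (3 - a)%N) m n gl).
move=> i j iN jN; apply: ket_eq0 => im; rewrite !gcoef_sum.
have [->|ij] := eqVneq i j.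
  have -> : px (up l j) j = q1 * px l j by rewrite /px pt_up_eq mulrA.
  by rewrite g_q1 !mulr0 addr0.
have ji : j != i by rewrite eq_sym.
rewrite (px_up _ ji) (px_up _ ij) !g_px ![_ * (u ^+ 3 * _)]mulrCA -mulrDr.
by rewrite (exchange (inf_adm N il) (inf_adm N im))// mulr0.
Qed.

Lemma good_f_of (d : nat) N l J : inf l -> tail J l -> (J + k <= N)%N -> good_f N d l.
Proof. by move=> il tl JN; split=> //; exists J. Qed.

Lemma rel_ff_ket m n (l : inf_set k r cs) :
  FA (gwz_mul q1 q2 q3 (fun i j => ff F i * ff F j) m n) << l >> =
  FA (- gzw_mul q1 q2 q3 (fun i j => ff F j * ff F i) m n) << l >>.
Proof.
have [J [il tl ->]] := good_ket l; move: (val l) il tl => {}l il tl.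
apply: (@FA_rel_wz _ _ (fun i j => fact i (fact j (ket l)))
  (fun i j => fact j (fact i (ket l)))) => [i j|i j|]; try exact: FA_ff.
pose N := (J + k)%N.
have gl : good_f N 2 l by apply: good_f_of il tl _.
apply: (quadratic_rel six fact_linear dnC py0 py_dn (good_f_act (N := N))
  (good_f_step (N := N)) (gc := gcoef q1 q2 q3) (ea := fun a => (3 - a)%N)
  (eb := fun a => a) m n gl).
have gs x y : \sum_(a < 4) gcoef q1 q2 q3 a * (x ^+ (3 - a) * y ^+ a) = g y x.
  by rewrite -gcoef_sum; apply: eq_bigr => a _; rewrite [x ^+ _ * _]mulrC.
move=> i j iN jN; apply: ket_eq0 => im; rewrite !gs.
have [->|ij] := eqVneq i j.
  have -> : py l j = q1 * py (dn l j) j.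
    by rewrite /py pt_dn_eq; field.
  by rewrite g_q1 !mulr0 addr0.
have ji : j != i by rewrite eq_sym.
rewrite (py_dn _ ji) (py_dn _ ij) !g_py ![_ * ((u / q1) ^+ 3 * _)]mulrCA -mulrDr.
have bE a b : b != a -> bfcf N l a * bfcf N (dn l a) b =
    (reval (beta k cs q1 q3 u N) (py l a) * reval (beta k cs q1 q3 u N) (py l b)) *
    (fcf N l a * fcf N (dn l a) b).
  by move=> ba; rewrite /bfcf py_dn// mulrACA.
have e := fexchange (inf_adm N il) (inf_adm N im) ij iN jN.
rewrite (bE _ _ ji) (bE _ _ ij) [reval _ (py l j) * _]mulrC -!mulrA -!mulrDr.
by rewrite !mulrA in e *; rewrite e !mulr0.
Qed.

Lemma FA_comm x y (X Y : V -> V) v : FA x =1 X -> FA y =1 Y ->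
  FA (comm x y) v = X (Y v) - Y (X v).
Proof.
move=> hx hy; apply: (etrans (free_actB gen_act _ _ _)); congr (_ - _).
  exact: (etrans (FAM _ _ _) (etrans (hx _) (congr1 X (hy v)))).
exact: (etrans (FAM _ _ _) (etrans (hy _) (congr1 Y (hx v)))).
Qed.

Lemma FA_comm2 x y z (X Y Z : V -> V) v : linear X -> FA x =1 X -> FA y =1 Y ->
  FA z =1 Z -> FA (comm x (comm y z)) v =
  X (Y (Z v)) - X (Z (Y v)) - Y (Z (X v)) + Z (Y (X v)).
Proof.
move=> lX hx hy hz.
have hyz : FA (comm y z) =1 (fun w => Y (Z w) - Z (Y w)).
  by move=> w; exact: (FA_comm w hy hz).
apply: (etrans (FA_comm v hx hyz)); rewrite linearfB//.
by rewrite opprB addrA addrAC.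
Qed.

Lemma rel_serre_e_ket (l : inf_set k r cs) :
  FA (comm (fe F 0) (comm (fe F 1) (fe F (-1)))) << l >> = FA 0 << l >>.
Proof.
have [J [il tl ->]] := good_ket l; move: (val l) il tl => {}l il tl.
apply: (etrans (FA_comm2 (ket l) (eact_linear 0) (FA_e 0) (FA_e 1) (FA_e (-1)))).
apply: (etrans _ (esym (FA_0 _))).
pose N := (J + 3 * k)%N.
have gl : good_e N 3 l by split=> //; exists J.
apply: (cubic_rel six eact_linear upC (good_e_act (N := N))
  (good_e_step (N := N)) gl) => i j h iN jN hN.
apply: ket_eq0 => im.
have := serre_sum_eq0 (fun=> 1) (inf_adm N il) (inf_adm N im) iN jN hN.
rewrite /serre_sum /serre_term !mul1r => e; rewrite -[RHS]e.
by have u0 (a b d : F) : serre_wt (a * u) (b * u) (d * u) = serre_wt a b d;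
  [rewrite /serre_wt !invfM; congr (_ - _ - _ + _);
   rewrite mulrACA mulfV// mulr1|rewrite !u0].
Qed.

Lemma rel_serre_f_ket (l : inf_set k r cs) :
  FA (comm (ff F 0) (comm (ff F 1) (ff F (-1)))) << l >> = FA 0 << l >>.
Proof.
have [J [il tl ->]] := good_ket l; move: (val l) il tl => {}l il tl.
apply: (etrans (FA_comm2 (ket l) (fact_linear 0) (FA_f 0) (FA_f 1) (FA_f (-1)))).
apply: (etrans _ (esym (FA_0 _))).
pose N := (J + k)%N.
have gl : good_f N 3 l by apply: good_f_of il tl _.
apply: (cubic_rel six fact_linear dnC (good_f_act (N := N))
  (good_f_step (N := N)) gl) => i j h iN jN hN.
apply: ket_eq0 => im.
pose W (x : F) := reval (beta k cs q1 q3 u N) (x * u).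
have := fserre_sum_eq0 W (inf_adm N il) (inf_adm N im) iN jN hN.
rewrite /fserre_sum /fserre_term => e; rewrite -[RHS]e.
have pyE l' i' : py l' i' = pt (dn l' i') i' * u.
  by rewrite pt_dn_eq mulrAC.
have u0 (a b d : F) : serre_wt (a * u) (b * u) (d * u) = serre_wt a b d.
  rewrite /serre_wt !invfM; congr (_ - _ - _ + _);
   by rewrite mulrACA mulfV// mulr1.
have bE l' i' : bfcf N l' i' = W (pt (dn l' i') i') * fcf N l' i'.
  by rewrite /bfcf pyE.
rewrite !bE !pyE !u0.
have AC (w1 w2 w3 f1 f2 f3 s : F) : w1 * f1 * (w2 * f2) * (w3 * f3) * s =
  w1 * w2 * w3 * (f1 * f2 * f3) * s by ring.
by rewrite !AC.
Qed.

Lemma rel_psie_ket s m n (l : inf_set k r cs) :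
  FA (gzw_mul q1 q2 q3 (fun i j => fpsi F s i * fe F j) m n) << l >> =
  FA (- gwz_mul q1 q2 q3 (fun i j => fe F j * fpsi F s i) m n) << l >>.
Proof.
have [J [il tl ->]] := good_ket l; move: (val l) il tl => {}l il tl.
apply: (FA_rel_zw (X := fun i j => pext s i (eact j (ket l)))
  (X' := fun i j => eact j (pext s i (ket l)))).
- move=> i j; apply: (etrans (FAM _ _ _)).
  exact: (etrans (FA_psi _ _ _) (congr1 _ (FA_e _ _))).
- move=> i j; apply: (etrans (FAM _ _ _)).
  exact: (etrans (FA_e _ _) (congr1 _ (FA_psi _ _ _))).
pose N := (J + 2 * k)%N.
have gl : good_e N 2 l by split=> //; exists J.
have JN : (J + k <= N)%N by rewrite leq_add2l leq_pmull.
apply: (diagonal_rel (N := N) (C := ce) (wt := ecf) (mv := up) (pp := px)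
  (act := eact) (diag := pext s) (ev := fun l' i => ext s (psi_ser s N l') i)
  (eact_linear) (pext_linear s) (px0 l)
  (fun j => good_e_act j gl) (fun i => pext_ket s i il tl JN) _
  (gc := gcoef q1 q2 q3) (ea := fun a => a) (eb := fun a => (3 - a)%N)).
  move=> i j iN nz; have [il' [J' tl' JN']] := good_e_step gl iN nz.
  by apply: (pext_ket s j il' tl'); rewrite mul1n in JN'.
by move=> i iN; exact: (psi_up s l m iN).
Qed.

Lemma rel_psif_ket s m n (l : inf_set k r cs) :
  FA (gwz_mul q1 q2 q3 (fun i j => fpsi F s i * ff F j) m n) << l >> =
  FA (- gzw_mul q1 q2 q3 (fun i j => ff F j * fpsi F s i) m n) << l >>.
Proof.
have [J [il tl ->]] := good_ket l; move: (val l) il tl => {}l il tl.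
apply: (FA_rel_wz (X := fun i j => pext s i (fact j (ket l)))
  (X' := fun i j => fact j (pext s i (ket l)))).
- move=> i j; apply: (etrans (FAM _ _ _)).
  exact: (etrans (FA_psi _ _ _) (congr1 _ (FA_f _ _))).
- move=> i j; apply: (etrans (FAM _ _ _)).
  exact: (etrans (FA_f _ _) (congr1 _ (FA_psi _ _ _))).
pose N := (J + k)%N.
have gl : good_f N 1 l by split=> //; exists J.
apply: (diagonal_rel (N := N) (C := cf) (wt := bfcf N) (mv := dn) (pp := py)
  (act := fact) (diag := pext s) (ev := fun l' i => ext s (psi_ser s N l') i)
  (fact_linear) (pext_linear s) (py0 l)
  (fun j => good_f_act j gl) (fun i => pext_ket s i il tl (leqnn N)) _
  (gc := gcoef q1 q2 q3) (ea := fun a => (3 - a)%N) (eb := fun a => a)).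
  move=> i j iN nz; have [il' [J' tl' JN']] := good_f_step gl iN nz.
  exact: (pext_ket s j il' tl' JN').
move=> i iN; have := psi_up s (dn l i) m iN.
by rewrite dnK px_dn => ->; rewrite opprK.
Qed.

(** The pair enters [ecf] of the lower row and [fcf] of the upper one.  Raising the
    lower row and lowering the upper one have the same effect on the ratio, so
    whichever move comes first, the other sees the same value of [phi]. *)
Lemma mixed_coef N l i j : (i < N)%N -> (j < N)%N -> i != j ->
  bfcf N l i * ecf (dn l i) j = ecf l j * bfcf N (up l j) i.
Proof.
move=> iN jN ij; have ji : j != i by rewrite eq_sym.
have pyE : py (up l j) i = py l i by rewrite /py pt_up_neq.
rewrite /bfcf pyE mulrCA -mulrA; congr (_ * _).
case: (ltngtP i j) => [lt_ij|lt_ji|e]; last by rewrite e eqxx in ij.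
  have [R hR] := ecf_split1 l lt_ij.
  rewrite (hR l)// (hR (dn l i)) => [|m _ mi]; last first.
    by rewrite /dn (negPf mi) subr0.
  rewrite /fcf (bigD1 (Ordinal jN))//= [in RHS](bigD1 (Ordinal jN))//=.
  rewrite pt_up_eq pt_dn_eq pt_up_neq//.
  have -> : pt l j / (pt l i / q1) = q1 * pt l j / pt l i.
    by rewrite invf_div; ring.
  have -> : \prod_(m < N | (i < m)%N && (m != Ordinal jN))
      phi (pt (up l j) m / pt l i) =
    \prod_(m < N | (i < m)%N && (m != Ordinal jN)) phi (pt l m / pt l i).
    by apply: eq_bigr => m /andP[_ mj]; rewrite (pt_up_neq _ (i := j)).
  by ring.
have -> : ecf (dn l i) j = ecf l j.
  apply: ecf_local => m mj; rewrite /dn ltn_eqF ?subr0//.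
  exact: leq_ltn_trans lt_ji.
rewrite mulrC; congr (_ * _); apply: eq_bigr => m im.
by rewrite !pt_up_neq// gtn_eqF// (ltn_trans lt_ji).
Qed.

Lemma rel_ef_ket m n (l : inf_set k r cs) :
  FA (comm (fe F m) (ff F n)) << l >> =
  FA ((g 1 1)^-1 *: (fpsi F true (m + n) - fpsi F false (m + n))) << l >>.
Proof.
have [J [il tl ->]] := good_ket l; move: (val l) il tl => {}l il tl.
apply: (etrans (FA_comm (ket l) (FA_e m) (FA_f n))).
pose N := (J + 3 * k)%N.
have JN : (J + k <= N)%N by rewrite leq_add2l leq_pmull.
have gl : good_e N 2 l by split=> //; exists J => //; lia.
have to_f d l' : good_e N d.+1 l' -> good_f N d.+1 l'.
  by case=> il' [J' tl' JN']; split=> //; exists J' => //; nia.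
have dn_good d l' i : good_e N d.+1 l' -> (i < N)%N -> bfcf N l' i != 0 ->
    good_e N d (dn l' i).
  case=> il' [J' tl' JN'] iN nz; have JN1 : (J' + k <= N)%N by nia.
  have [il1 tl1] := inf_dn il' tl' JN1 iN nz.
  by split=> //; exists J' => //; nia.
rewrite (mixed_rel (N := N) (good := good_e N) (eact_linear)
  (fact_linear)
  (fun d l' n' g' => good_e_act n' g')
  (fun d l' n' g' => good_f_act n' (to_f d l' g'))
  (fun d l' i g' => good_e_step g') dn_good _ _ _ m n gl).
- have scE a x v : FA (a *: x) v = a *: FA x v.
    exact: (linearfZ a x (free_act_linearl gen_act v)).
  have e1 := scE (g 1 1)^-1 (fpsi F true (m + n) - fpsi F false (m + n)) (ket l).
  apply: (etrans _ (esym e1)).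
  have e2 := free_actB gen_act (fpsi F true (m + n)) (fpsi F false (m + n)) (ket l).
  rewrite e2 !FA_psi !(pext_ket _ _ il tl JN) -scalerBl scalerA.
  apply: (congr1 (fun z => z *: ket l)); rewrite ef_diag.
  + congr (_ * _); apply: eq_bigr => i _.
    rewrite px_dn py_up /bfcf py_up.
    by rewrite !expfzDr//; ring.
  + exact: (inf_adm N il).
  + by move: JN hk; rewrite /N; clear; lia.
  + by move=> j /andP[jN _]; apply: tl; move: jN hk; rewrite /N; clear; lia.
  + rewrite -[X in l X = _](subnK (n := N.-1) (m := k)); last first.
      by move: hk; rewrite /N; clear; lia.
    by apply: (tail_gap tl); move: hk; rewrite /N; clear; lia.
- by move=> l' i j ji; rewrite /px pt_dn_neq.
- by move=> l' i j ji; rewrite /py pt_up_neq.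
- by move=> l' i j iN jN ij; exact: mixed_coef.
Qed.

Lemma rel_psipsi_ket s t i j (l : inf_set k r cs) :
  FA (comm (fpsi F s i) (fpsi F t j)) << l >> = FA 0 << l >>.
Proof.
have [J [il tl ->]] := good_ket l; move: (val l) il tl => {}l il tl.
apply: (etrans (FA_comm (ket l) (FA_psi s i) (FA_psi t j))).
apply: (etrans _ (esym (FA_0 _))).
pose N := (J + k)%N.
have pE s' i' := pext_ket s' i' il tl (leqnn N).
rewrite (pE t j) (pE s i) !(linearfZ _ _ (pext_linear _ _)).
by rewrite (pE t j) (pE s i) !scalerA mulrC subrr.
Qed.

Lemma pact0_ket s (l : inf_set k r cs) :
  pact s 0%N << l >> = (if s then 1 else q3 ^+ k) *: << l >>.
Proof.
have [J [il tl ->]] := good_ket l; move: (val l) il tl => {}l il tl.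
by rewrite (pact_ket s 0 il tl (leqnn _)) psi_ser0// leq_addl.
Qed.

Lemma pact0 s v : pact s 0%N v = (if s then 1 else q3 ^+ k) *: v.
Proof.
apply: linear_ext v; first exact: pact_linear.
  by move=> a v w; rewrite scalerDr !scalerA mulrC.
exact: pact0_ket.
Qed.

Lemma level_neq0 s : (if s then 1 else q3 ^+ k) != 0 :> F.
Proof. by case: s; rewrite ?oner_eq0// expf_neq0. Qed.

Lemma gen_act_rel x y : erel q1 q2 q3 x y -> forall v, FA x v = FA y v.
Proof.
move=> xy; apply: linear_ext; [exact: free_act_linearr gen_act_linear _..|].
move=> l; case: xy => [m n|m n|s m n|s m n|m n|s t i j|s|s||].
- exact: rel_ee_ket.
- exact: rel_ff_ket.
- exact: rel_psie_ket.
- exact: rel_psif_ket.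
- exact: rel_ef_ket.
- exact: rel_psipsi_ket.
- apply: (etrans (FAM _ _ _)); apply: (etrans _ (esym (free_act1 _ _))).
  apply: (etrans (free_act_gen _ _ _)); apply: (etrans (congr1 _ (free_act_gen _ _ _))).
  by apply: (etrans (pact0 _ _)); rewrite scalerA mulfV ?scale1r// level_neq0.
- apply: (etrans (FAM _ _ _)); apply: (etrans _ (esym (free_act1 _ _))).
  apply: (etrans (free_act_gen _ _ _)); apply: (etrans (congr1 _ (free_act_gen _ _ _))).
  apply: (etrans (congr1 _ (pact0 _ _))).
  by rewrite /= scalerA mulVf ?scale1r// level_neq0.
- exact: rel_serre_e_ket.
- exact: rel_serre_f_ket.
Qed.

(** * Limits of the finite modules *)

Lemma lambda0_shifts j b : l0 (j + k * b) = l0 j - r%:Z * b%:Z.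
Proof.
elim: b => [|b IH]; first by rewrite muln0 addn0 mulr0 subr0.
rewrite mulnS [(k + _)%N]addnC addnA lambda0_shift// IH -addn1 PoszD; lia.
Qed.

(** Between [j] and a row of the tail at a multiple of [k] the gap conditions make
    [l] descend at least as much as [lambda0]. *)
Lemma inf_ge l j : inf l -> l0 j <= l j.
Proof.
move=> il; have [J tl] := inf_tail il.
have jJ : (J <= j + k * J)%N by nia.
have := adm_gap hk hr (inf_adm (j + k * J).+1 il) (leqnn (j + k * J)) (ltnSn _).
by rewrite (tl _ jJ) lambda0_shifts; lia.
Qed.

Lemma inf_fin N l : inf l -> in_fin k r (trunc N l).
Proof.
case=> mono gap _; apply/andP; split.
  apply/forallP => i; apply/forallP => j; apply/implyP => /eqP ji.
  by rewrite !ffunE ji.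
apply/forallP => i; apply/forallP => j; apply/implyP => /eqP ji.
by rewrite !ffunE ji.
Qed.

Lemma extend_trunc N l : tail N l -> extend k r cs (trunc N l) = l.
Proof.
move=> tl; apply/funext => j; rewrite /extend.
case: insubP => [i _ <-|]; first by rewrite ffunE.
by rewrite -leqNgt => /tl.
Qed.

Lemma embed_linear N : linear (@embed N).
Proof. exact: linext_linear. Qed.

Lemma embed_trunc N l : tail N l -> embed (fin_ket F k r (trunc N l)) = ket l.
Proof.
move=> tl; rewrite /fin_ket; case: insubP => [m _ em|nf].
  rewrite [embed _](linextU (fun m => ket (extend k r cs (val m)))) em.
  by rewrite extend_trunc.
rewrite ket_ninf; last by move=> il; rewrite inf_fin in nf.
exact: (linearf0 (@embed_linear N)).
Qed.

Lemma trunc_up N l (i : 'I_N) : trunc N l + bf1 i = trunc N (up l i).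
Proof. by apply/ffunP => j; rewrite !ffunE. Qed.

Lemma trunc_dn N l (i : 'I_N) : trunc N l - bf1 i = trunc N (dn l i).
Proof. by apply/ffunP => j; rewrite !ffunE. Qed.

Lemma in_plusZ N a (w : fin_space F k r N) : (a != 0 -> in_plus w) -> in_plus (a *: w).
Proof.
move=> h m; rewrite mcoeffZ mulf_eq0 negb_or => /andP[/h h1 w0]; exact: h1.
Qed.

Lemma in_plus_sum N (w : 'I_N -> fin_space F k r N) :
  (forall i, in_plus (w i)) -> in_plus (\sum_i w i).
Proof.
move=> h; elim/big_rec: _ => [|i v _ IH] m; first by rewrite mcoeff0 eqxx.
rewrite mcoeffD; have [e|nz] := eqVneq ((w i)@_m) 0; last by move=> _; exact: h nz.
by rewrite e add0r => /IH.
Qed.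

Lemma in_plus_ket N l : (forall j, l0 j <= l j) -> in_plus (fin_ket F k r (trunc N l)).
Proof.
move=> h m; rewrite /fin_ket; case: insubP => [m' _ em|_]; last first.
  by rewrite mcoeff0 eqxx.
rewrite mcoeffU; have [<-|_] := eqVneq m' m; last by rewrite mulr0n eqxx.
by move=> _ j; rewrite em ffunE; exact: h.
Qed.

Lemma up_ge l i j : l j <= up l i j.
Proof. by rewrite /up lerDl ler0n. Qed.

Lemma e_coef_trunc N l (i : 'I_N) : e_coef q1 q3 (trunc N l) i = ecf l i.
Proof.
rewrite /ecf (big_ord_widen N (fun j => phi (pt l i / pt l j))); last exact: ltnW.
apply: eq_bigr => j _; rewrite !ffunE /phi /pt.
rewrite !expfzDr// !exprN1 !expr1z -!invr_expz.
have a0 n : q1 ^ n != 0 by rewrite expfz_neq0.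
have b0 n : q3 ^ n != 0 by rewrite expfz_neq0.
have -> : q1 ^ l i * q3 ^ i / (q1 ^ l j * q3 ^ j) = q1 ^ l i / q1 ^ l j * (q3 ^ i / q3 ^ j).
  by rewrite invfM; ring.
move: (q1 ^ l i / q1 ^ l j) (q3 ^ i / q3 ^ j) => a b.
by congr (_ / _); ring.
Qed.

Lemma f_coef_trunc N l (i : 'I_N) : f_coef q1 q3 (trunc N l) i = fcf N l i.
Proof.
apply: eq_bigr => j _; rewrite !ffunE /phi /pt.
rewrite !expfzDr// !exprN1 !expr1z -!invr_expz.
have -> : q1 ^ l j * q3 ^ j / (q1 ^ l i * q3 ^ i) = q1 ^ l j / q1 ^ l i * (q3 ^ j / q3 ^ i).
  by rewrite invfM; ring.
move: (q1 ^ l j / q1 ^ l i) (q3 ^ j / q3 ^ i) => a b.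
by congr (_ / _); ring.
Qed.

Lemma embed_sum N (a : 'I_N -> F) (w : 'I_N -> fin_space F k r N) C :
  embed (C *: \sum_i a i *: w i) = C *: \sum_i a i *: embed (w i).
Proof.
rewrite (linearfZ _ _ (@embed_linear N)); congr (_ *: _).
exact: (linfun_sumZ _ _ _ (@embed_linear N)).
Qed.

Lemma e_limit J N n l : inf l -> tail J l -> (J + k <= N)%N ->
  in_plus (e_mod k r q1 q3 u n (trunc N l)) /\
  embed (e_mod k r q1 q3 u n (trunc N l)) = eact n (ket l).
Proof.
move=> il tl JN; split.
  apply: in_plusZ => _; apply: in_plus_sum => i; rewrite trunc_up.
  apply: in_plusZ => _; apply: in_plus_ket => j.
  exact: le_trans (inf_ge j il) (up_ge _ _ _).
rewrite (eact_ket n il tl JN) /e_mod embed_sum.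
apply: (congr1 (fun w => ce *: w)).
apply: eq_bigr => i _; rewrite e_coef_trunc ffunE trunc_up.
have [->|nz] := eqVneq (ecf l i) 0; first by rewrite mul0r !scale0r.
rewrite embed_trunc//; have [_ tl'] := inf_up il tl nz.
exact: tail_le JN tl'.
Qed.

Lemma f_limit J N n l : inf l -> tail J l -> (J + k <= N)%N ->
  in_plus (f_mod k r cs q1 q3 u n (trunc N l)) /\
  embed (f_mod k r cs q1 q3 u n (trunc N l)) = fact n (ket l).
Proof.
move=> il tl JN.
have -> : f_mod k r cs q1 q3 u n (trunc N l) =
    cf *: \sum_(i < N) (bfcf N l i * py l i ^ n) *: fin_ket F k r (trunc N (dn l i)).
  apply: (congr1 (fun w => cf *: w)); apply: eq_bigr => i _; rewrite trunc_dn.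
  apply: (congr1 (fun a => a *: fin_ket F k r (trunc N (dn l i)))).
  rewrite f_coef_trunc ffunE.
  have -> // : q1 ^ (l i - 1) * q3 ^ i%:Z * u = py l i.
  by rewrite /py /pt expfzDr// exprN1; ring.
have good (i : 'I_N) : bfcf N l i * py l i ^ n != 0 ->
    inf (dn l i) /\ tail J (dn l i).
  move=> nz; apply: (inf_dn il tl JN (ltn_ord i)).
  by apply: contraNneq nz => ->; rewrite mul0r.
split.
  apply: in_plusZ => _; apply: in_plus_sum => i.
  apply: in_plusZ => /good[id _]; apply: in_plus_ket => j.
  exact: inf_ge.
rewrite (fact_ket n il tl JN) embed_sum.
apply: (congr1 (fun w => cf *: w)).
apply: eq_bigr => i _.
have [->|nz] := eqVneq (bfcf N l i * py l i ^ n) 0; first by rewrite !scale0r.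
rewrite embed_trunc//; have [_ tl'] := good _ nz.
by apply: tail_le tl'; apply: leq_trans JN; exact: leq_addr.
Qed.

Lemma psi_limit J N s n l : inf l -> tail J l -> (J + k <= N)%N ->
  in_plus (psi_mod k r cs q1 q3 u s n (trunc N l)) /\
  embed (psi_mod k r cs q1 q3 u s n (trunc N l)) = pact s n (ket l).
Proof.
move=> il tl JN; have kN : (k <= N)%N by apply: leq_trans JN; exact: leq_addl.
rewrite /psi_mod (psi_mod_rser s l kN); split.
  by apply: in_plusZ => _; apply: in_plus_ket => j; exact: inf_ge.
rewrite (linearfZ _ _ (@embed_linear N)) (pact_ket s n il tl JN) embed_trunc//.
by apply: tail_le tl; apply: leq_trans JN; exact: leq_addr.
Qed.

Lemma semi_infinite_module : exists act : ealg q1 q2 q3 -> V -> V,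
  [/\ is_module act,
      forall l : inf_set k r cs,
      [/\ is_ind_limit
            (fun N n => e_mod k r q1 q3 u n (trunc N (val l)))
            (fun n : int => act (E_e q1 q2 q3 n) << l >>),
          is_ind_limit
            (fun N n => f_mod k r cs q1 q3 u n (trunc N (val l)))
            (fun n : int => act (E_f q1 q2 q3 n) << l >>)
        & forall s : bool, is_ind_limit
            (fun N n => psi_mod k r cs q1 q3 u s n (trunc N (val l)))
            (fun n : nat => act (E_psi q1 q2 q3 s n) << l >>)]
    & has_level act 1 (q3 ^+ k)].
Proof.
have actg x v : quot_act gen_act (ecl q1 q2 q3 (fgen F x)) v = gen_act x v.
  apply: (etrans (quot_act_ecl gen_act_linear gen_act_rel _ _)); exact: free_act_gen.
exists (quot_act gen_act); split.
- exact: quot_act_module gen_act_linear gen_act_rel.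
- move=> l; have il := inf_val l; have tl := @tail_ofP l.
  split=> [||s]; exists (tail_of l + k)%N => N NN n.
  + have [h1 h2] := e_limit n il tl NN; split=> //; apply: (etrans h2).
    exact: etrans (congr1 (eact n) (ket_val l)) (esym (actg (Ge n) _)).
  + have [h1 h2] := f_limit n il tl NN; split=> //; apply: (etrans h2).
    exact: etrans (congr1 (fact n) (ket_val l)) (esym (actg (Gf n) _)).
  + have [h1 h2] := psi_limit s n il tl NN; split=> //; apply: (etrans h2).
    exact: etrans (congr1 (pact s n) (ket_val l)) (esym (actg (Gpsi s n) _)).
- move=> v; split.
  + exact: etrans (actg (Gpsi true 0) v) (pact0 true v).
  + exact: etrans (actg (Gpsi false 0) v) (pact0 false v).
Qed.

End SemiInfiniteModule.

(** * The theorem *)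

Theorem theorem6p5 (R : realType) (k r : nat) (q1 q2 q3 u : R[i])
  (c : k.-1.-tuple int)
  (hk : (1 <= k)%N) (hr : (2 <= r)%N)
  (hu : u != 0) (hq1 : q1 != 0) (hq2 : q2 != 0) (hq3 : q3 != 0)
  (hq : q1 * q2 * q3 = 1)
  (hres : q1 ^ (1 - r%:Z) * q3 ^ (k%:Z + 1) = 1)
  (hgen : forall n m : int, q1 ^ n * q3 ^ m = 1 <->
     exists a : int, n = (1 - r%:Z) * a /\ m = (k%:Z + 1) * a)
  (hc : path <=%R (0 : int) (rcons c r%:Z)) :
  exists act : ealg q1 q2 q3 ->
               inf_space R[i] k r c -> inf_space R[i] k r c,
  [/\ is_module act,
      forall l : inf_set k r c,
      [/\ is_ind_limit
            (fun N n => e_mod k r q1 q3 u n (trunc N (val l)))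
            (fun n : int => act (E_e q1 q2 q3 n) << l >>),
          is_ind_limit
            (fun N n => f_mod k r c q1 q3 u n (trunc N (val l)))
            (fun n : int => act (E_f q1 q2 q3 n) << l >>)
        & forall s : bool, is_ind_limit
            (fun N n => psi_mod k r c q1 q3 u s n (trunc N (val l)))
            (fun n : nat => act (E_psi q1 q2 q3 s n) << l >>)]
    & has_level act 1 (q3 ^+ k)].
Proof.
apply: semi_infinite_module => //; last by rewrite pnatr_eq0.
by split=> // n m; exact: (hgen n m).1.
Qed.
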